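(* Let $\gamma\in\mathrm{SL}_2(\mathbb{Z})$ be a primitive hyperbolic element with $\mathrm{sgn}(Q_\gamma)>0$ and $\mathrm{tr}(\gamma)>2$. Then for $\mathrm{Re}(s)>1$ and $z\in\mathbb{H}$, \[ E_{0,\gamma}(z,s)=-\frac{\Gamma\!\left(\frac{s+1}{2}\right)}{2D_\gamma^{\frac{s-1}{2}}\sqrt{\pi}\,\Gamma\!\left(\frac{s}{2}\right)}\int_{\tau_0}^{\gamma\tau_0}Q(z,\tau;s)\,\frac{d\tau}{Q_\gamma(\tau,1)}, \] where $\tau_0\in S_\gamma$ and the integral is taken along $S_\gamma$.
   Context: $\Gamma=\mathrm{SL}_2(\mathbb{Z})$. For $\gamma=\begin{pmatrix}a&b\\c&d\end{pmatrix}$, $Q_\gamma(X,Y)=cX^2+(d-a)XY-bY^2$ and $\mathrm{sgn}(Q_\gamma)=\mathrm{sgn}(c)$; $D_\gamma=\mathrm{tr}(\gamma)^2-4$; the real fixed points $w_\gamma>w'_\gamma$, $S_\gamma$ the geodesic joining them; primitive means the stabilizer of $w_\gamma$ in $\Gamma$ is $\{\pm\gamma^n\}$. $\Gamma$ acts on integral binary quadratic forms by $(Q\circ g)(X,Y)=Q(\alpha X+\beta Y,\kappa X+\delta Y)$, $Q\sim Q'$ iff $Q'=Q\circ g$ for some $g\in\Gamma$. For $\mathrm{Re}(s)>1$: $E_{0,\gamma}(z,s)=\sum_{Q\sim Q_\gamma}\frac{(\mathrm{Im} z)^s}{|Q(z,1)|^s}$ and $Q(z,\tau;s)=\sum_{g\in\Gamma}\cosh(d_{\mathrm{hyp}}(gz,\tau))^{-s}$,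 with $d_{\mathrm{hyp}}$ the hyperbolic distance on $\mathbb{H}$, $\cosh d_{\mathrm{hyp}}(z,\tau)=1+\frac{|z-\tau|^2}{2\mathrm{Im}z\,\mathrm{Im}\tau}$. *)

(* Defs.v *)
From HB Require Import structures.
From mathcomp Require Import all_boot all_order all_algebra.
From mathcomp Require Import complex ring lra.
From mathcomp Require Import all_classical all_reals all_analysis.

Set Implicit Arguments.
Unset Strict Implicit.
Unset Printing Implicit Defensive.

Import Order.TTheory GRing.Theory Num.Theory.
Import numFieldNormedType.Exports.

Local Open Scope classical_set_scope.
Local Open Scope ring_scope.
Local Open Scope complex_scope.

Local Notation Re := complex.Re.
Local Notation Im := complex.Im.

Section ComplexAnalysis.
Variable R : realType.

Definition cexp (u : R[i]) : R[i] :=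
  (expR (Re u))%:C * (cos (Im u) +i* sin (Im u)).

(* x ^ s = exp (s ln x); meaningful only for x > 0, as ln is 0 elsewhere. *)
Definition cpow (x : R) (s : R[i]) : R[i] := cexp (s * (ln x)%:C).

(* Sum of an absolutely convergent family of real numbers: the positive part
   minus the negative part. *)
Definition rsum (T : choiceType) (D : set T) (f : T -> R) : R :=
  fine (\esum_(x in D) (EFin \o f)^\+ x)%E
  - fine (\esum_(x in D) (EFin \o f)^\- x)%E.

Definition csum (T : choiceType) (D : set T) (f : T -> R[i]) : R[i] :=
  rsum D (fun x => Re (f x)) +i* rsum D (fun x => Im (f x)).

Definition cintegral (D : set R) (f : R -> R[i]) : R[i] :=
  Rintegral lebesgue_measure D (fun t => Re (f t))
  +i* Rintegral lebesgue_measure D (fun t => Im (f t)).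

(* The oriented integral: the sign changes when a and b are exchanged. *)
Definition ointegral (a b : R) (f : R -> R[i]) : R[i] :=
  if a <= b then cintegral `[a, b] f else - cintegral `[b, a] f.

Definition path_integral (p : R -> R[i]) (a b : R) (f : R[i] -> R[i]) : R[i] :=
  ointegral a b (fun t =>
    f (p t) * (derive1 (fun u => Re (p u)) t +i* derive1 (fun u => Im (p u)) t)).

(* Euler's integral, which represents the Gamma function for Re s > 0. *)
Definition cGamma (s : R[i]) : R[i] :=
  cintegral `]0, +oo[ (fun t => cpow t (s - 1) * (expR (- t))%:C).

Definition cosh (x : R) : R := (expR x + expR (- x)) / 2%:R.

Definition arcosh (x : R) : R := ln (x + Num.sqrt (x ^+ 2 - 1)).

Lemma arcoshK (x : R) : 1 <= x -> cosh (arcosh x) = x.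
Proof.
move=> x1; rewrite /cosh /arcosh.
set r := Num.sqrt _.
have r2 : r ^+ 2 = x ^+ 2 - 1 by rewrite sqr_sqrtr// subr_ge0 expr_ge1// (le_trans ler01).
have r0 : 0 <= r by exact: sqrtr_ge0.
have y0 : 0 < x + r by lra.
rewrite expRN lnK ?posrE//.
have -> : (x + r)^-1 = x - r.
  apply: (mulfI (lt0r_neq0 y0)); rewrite mulfV ?gt_eqF//.
  have -> : (x + r) * (x - r) = x ^+ 2 - r ^+ 2 by ring.
  by rewrite r2; ring.
by field.
Qed.

End ComplexAnalysis.

Section HalfPlane.
Variable R : realType.

Definition upper_half_plane : set R[i] := [set z | 0 < Im z].

Definition dhyp (z t : R[i]) : R :=
  arcosh (1 + Normc.normc (z - t) ^+ 2 / (2%:R * Im z * Im t)).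

Lemma cosh_dhyp (z t : R[i]) : upper_half_plane z -> upper_half_plane t ->
  cosh (dhyp z t) = 1 + Normc.normc (z - t) ^+ 2 / (2%:R * Im z * Im t).
Proof.
move=> z0 t0; apply: arcoshK; rewrite lerDl divr_ge0 ?sqr_ge0//.
by rewrite !mulr_ge0// ltW.
Qed.

(* The geodesic of the upper half plane with real endpoints w' < w. *)
Definition geodesic (w w' : R) : set R[i] :=
  [set z | upper_half_plane z /\
           Normc.normc (z - ((w + w') / 2%:R)%:C) = (w - w') / 2%:R].

(* Its parametrization by the angle in ]0, pi[, and the inverse of that. *)
Definition geodesic_point (w w' : R) (theta : R) : R[i] :=
  ((w + w') / 2%:R + (w - w') / 2%:R * cos theta)
  +i* ((w - w') / 2%:R * sin theta).

Definition geodesic_angle (w w' : R) (z : R[i]) : R :=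
  acos ((Re z - (w + w') / 2%:R) / ((w - w') / 2%:R)).

Definition geodesic_integral (w w' : R) (z0 z1 : R[i]) (f : R[i] -> R[i])
    : R[i] :=
  path_integral (geodesic_point w w')
    (geodesic_angle w w' z0) (geodesic_angle w w' z1) f.

Lemma geodesic_angleK (w w' : R) (z : R[i]) : w' < w -> geodesic w w' z ->
  geodesic_point w w' (geodesic_angle w w' z) = z.
Proof.
move=> ww' [/=]; case: z => x y /= y0 /eqP.
rewrite /geodesic_point /geodesic_angle /= subr0.
set m := (w + w') / 2%:R; set r := (w - w') / 2%:R.
have r0 : 0 < r by rewrite divr_gt0// subr_gt0.
clearbody m r.
rewrite -(eqrXn2 (n := 2)) ?sqrtr_ge0 ?ltW// sqr_sqrtr ?addr_ge0 ?sqr_ge0// => /eqP e.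
have c1 : -1 <= (x - m) / r <= 1.
  rewrite -ler_norml normrM normfV (gtr0_norm r0) ler_pdivrMr// mul1r.
  rewrite -(ler_pXn2r (n := 2)) ?nnegrE ?(ltW r0)// real_normK ?num_real//.
  by have := sqr_ge0 y; lra.
congr (_ +i* _); first by rewrite acosK//; field; lra.
rewrite sin_acos//.
have -> : 1 - ((x - m) / r) ^+ 2 = (y / r) ^+ 2.
  have r2 : r ^+ 2 != 0 by rewrite expf_neq0// gt_eqF.
  by rewrite !expr_div_n -[X in X - _](divff r2) -mulrBl; congr (_ / _); lra.
rewrite sqrtr_sqr gtr0_norm ?divr_gt0//; field; lra.
Qed.

End HalfPlane.

Definition SL2Z : set 'M[int]_2 := [set g | \det g = 1].

(* (A, B, C) stands for the form A X^2 + B X Y + C Y^2. *)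
Definition qform : Type := (int * int * int)%type.
HB.instance Definition _ := Choice.on qform.

Definition qeval (K : comNzRingType) (Q : qform) (x y : K) : K :=
  Q.1.1%:~R * x ^+ 2 + Q.1.2%:~R * x * y + Q.2%:~R * y ^+ 2.

Definition qcomp (Q : qform) (g : 'M[int]_2) : qform :=
  let: (A, B, C) := Q in
  (A * g 0 0 ^+ 2 + B * g 0 0 * g 1 0 + C * g 1 0 ^+ 2,
   2%:R * A * g 0 0 * g 0 1 + B * (g 0 0 * g 1 1 + g 0 1 * g 1 0)
     + 2%:R * C * g 1 0 * g 1 1,
   A * g 0 1 ^+ 2 + B * g 0 1 * g 1 1 + C * g 1 1 ^+ 2).

Lemma qcompE (K : comNzRingType) (Q : qform) (g : 'M[int]_2) (x y : K) :
  qeval (qcomp Q g) x y =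
  qeval Q ((g 0 0)%:~R * x + (g 0 1)%:~R * y) ((g 1 0)%:~R * x + (g 1 1)%:~R * y).
Proof. by case: Q => [[A B] C]; rewrite /qeval /=; ring. Qed.

Definition qequiv (Q Q' : qform) : Prop :=
  exists2 g, SL2Z g & Q' = qcomp Q g.

Definition fixform (g : 'M[int]_2) : qform :=
  (g 1 0, g 1 1 - g 0 0, - g 0 1).

Definition qsgn (Q : qform) : int := Num.sg Q.1.1.

Definition discr (g : 'M[int]_2) : int := (\tr g) ^+ 2 - 4%:R.

Definition hyperbolic (g : 'M[int]_2) : Prop := SL2Z g /\ 2%:R < `|\tr g|.

Definition mobius (K : fieldType) (g : 'M[int]_2) (x : K) : K :=
  ((g 0 0)%:~R * x + (g 0 1)%:~R) / ((g 1 0)%:~R * x + (g 1 1)%:~R).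

(* The first conjunct says that g does not send x to the point at infinity. *)
Definition fixes (K : fieldType) (g : 'M[int]_2) (x : K) : Prop :=
  (g 1 0)%:~R * x + (g 1 1)%:~R != 0 /\ mobius g x = x.

Definition stabilizer (K : fieldType) (x : K) : set 'M[int]_2 :=
  [set g | SL2Z g /\ fixes g x].

(* w is meant to be the larger real fixed point of g. *)
Definition primitive (R : realType) (g : 'M[int]_2) (w : R) : Prop :=
  stabilizer w = [set h | exists n : int, h = g ^ n \/ h = - (g ^ n)].

Definition E0 (R : realType) (g : 'M[int]_2) (z s : R[i]) : R[i] :=
  csum [set Q : qform | qequiv Q (fixform g)]
    (fun Q => cpow (Im z) s / cpow (Normc.normc (qeval Q z 1)) s).

Definition Qker (R : realType) (z t s : R[i]) : R[i] :=
  csum SL2Z (fun g => cpow (cosh (dhyp (mobius g z) t)) (- s)).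

(* Main.v *)
(* Parametrize the axis of gamma by its arc length u. For g in SL_2(Z), cosh d(g z, tau_u) has the
   form A exp(-u) + B exp(u), where A and B are multiples of |p - w q|^2 and |p - w' q|^2 for the
   column (p, q) = g (z, 1), and 4 A B = |Q(z, 1)|^2 / (D (Im z)^2) for Q = Q_gamma o g. Translating
   g by gamma moves u by the length of the axis, which is the range of the integral; as gamma is
   primitive, the elements g with the same Q are exactly +- gamma^n h. Thus the sum over g of the
   integrals over one period unfolds to twice the sum over Q of integrals over the real line, each of
   which, after recentering u, is (|Q(z, 1)| / (sqrt D Im z))^(-s) times the integral of cosh^(-s), a quotient of Gamma values.
   All sums and integrals are reduced to positive real ones through positive and negative parts. *)
Require Import Defs.
From mathcomp Require Import all_boot all_order all_algebra.
From mathcomp Require Import complex ring lra zify.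
From mathcomp Require Import all_classical all_reals all_analysis.
From mathcomp Require Import measurable_realfun gauss_integral.

Set Implicit Arguments.
Unset Strict Implicit.
Unset Printing Implicit Defensive.

Import Order.TTheory GRing.Theory Num.Theory.
Import numFieldNormedType.Exports.

Local Open Scope classical_set_scope.
Local Open Scope ring_scope.
Local Open Scope complex_scope.

(** * Integrals over the real line *)

Section RealLine.
Context {R : realType}.
Notation mu := (@lebesgue_measure R).

(** Three obstacles shape the development. [csum], [Rintegral] and division are total, and [fine]
    sends an infinite value to 0, so every interchange, and every constant moved out of a sum,
    carries a finiteness proof. Its source is one estimate: [cosh d(g z, tau_u)] is at least a
    constant times [exp (-|u|) |g|^2], and the sum of [|g|^(-2 sigma)] over SL_2(Z) is finite for
    [sigma > 1], being dominated in suitable coordinates by a product of three sums over the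
    integers. Convergence of the sum over forms is then deduced from the unfolding itself. The
    constant comes from [Gamma ((s+1)/2) int cosh^(-s) = sqrt pi Gamma (s/2)], a double integral
    evaluated in both orders. As the statement divides by [Gamma (s/2)], this value has to be proved
    nonzero for complex [s]: the functional equation moves [s] far to the right, where the integrand
    is concentrated. The minus sign is one of orientation: [w] is the attracting fixed point, so
    [gamma] decreases the angle on the half-circle, whereas [d tau / Q_gamma] is positive in the
    direction of increasing angle. *)

Lemma bigcup_itvNnn : \bigcup_n `[- n%:R, n%:R]%classic = [set: R].
Proof.
apply/seteqP; split => // x _.
exists (Num.truncn `|x|).+1 => //=.
by rewrite in_itv/= -ler_norml ltW// truncnS_gt.
Qed.

(** Both sides are limits, by monotone convergence, of the substitution on the compact intervals
    [[-n, n]]. The image of the line is given as the union of the [[F (-n), F n]] so that these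
    exhaust exactly [D]. Continuity of [G] is local to [D] with a view to [t^(s-1) exp (-t)] on []0,
    +oo[]. *)
Lemma ge0_integral_substitution (F f G : R -> R) (D : set R) :
  (forall x : R, is_derive x 1 F (f x)) -> continuous f ->
  (forall x, 0 < f x) ->
  D = \bigcup_n `[F (- n%:R), F n%:R]%classic ->
  (forall x, D x -> {for x, continuous G}) -> (forall x, D x -> 0 <= G x) ->
  (\int[mu]_(x in D) (G x)%:E = \int[mu]_x (G (F x) * f x)%:E)%E.
Proof.
move=> dF cf f0 DE cG G0.
have F'E : derive1 F = f.
  by apply/funext => x; rewrite derive1E; apply: derive_val.
have cF : continuous F.
  by move=> x; apply/differentiable_continuous/derivable1_diffP; exact: ex_derive.
have incF : {homo F : x y / x < y}.
  move=> x y xy.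
  have cF' : {within `[x, y], continuous F} by exact: continuous_subspaceT.
  have [c _ FE] := MVT xy (fun x _ => dF x) cF'.
  by rewrite -subr_gt0 FE mulr_gt0// subr_gt0.
have FD x : D (F x).
  have : [set: R] x by []; rewrite -bigcup_itvNnn DE => -[n _ /=].
  rewrite in_itv/= => /andP[nx xn]; exists n => //=.
  by rewrite in_itv/= !ltW_homo.
have sub n : `[F (- n%:R), F n%:R]%classic `<=` D.
  by rewrite DE => x xn; exists n.
have cGn n : {within `[F (- n%:R), F n%:R], continuous G}.
  by apply: continuous_in_subspaceT => x; rewrite inE => /sub /cG.
have cgf : continuous (fun x => G (F x) * f x).
  move=> x; apply: cvgM; last exact: cf.
  apply: continuous_comp; first exact: cF.
  exact/cG.
have l1 : (\int[mu]_(x in `[F (- n%:R)%R, F n%:R%R]) (G x)%:E @[n --> \oo] -->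
   \int[mu]_(x in D) (G x)%:E)%E.
  rewrite DE; apply: ge0_nondecreasing_set_cvg_integral => //.
  - move=> m n mn; rewrite subsetEset => x /=; rewrite !in_itv/= => /andP[a b].
    by rewrite (le_trans _ a) ?(le_trans b)// ltW_homo// ?lerN2 ler_nat.
  - move=> n; apply/measurable_EFinP; apply: subspace_continuous_measurable_fun => //.
  - by move=> n x xn; rewrite lee_fin G0//; exact: (sub n).
have l2 : (\int[mu]_(x in `[(- n%:R)%R, n%:R%R]) (G (F x) * f x)%:E @[n --> \oo] -->
   \int[mu]_x (G (F x) * f x)%:E)%E.
  rewrite -bigcup_itvNnn; apply: ge0_nondecreasing_set_cvg_integral => //.
  - move=> m n mn; rewrite subsetEset => x /=; rewrite !in_itv/= => /andP[a b].
    by rewrite (le_trans _ a) ?(le_trans b)// ?lerN2 ler_nat.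
  - move=> n; apply/measurable_EFinP; apply: measurable_funTS.
    exact: continuous_measurable_fun.
  - by move=> n x xn; rewrite lee_fin mulr_ge0// ?G0// ltW.
apply: (cvg_unique _ l1) => //.
suff <- : (fun n => \int[mu]_(x in `[(- n%:R)%R, n%:R%R]) (G (F x) * f x)%:E)%E =
  (fun n => \int[mu]_(x in `[F (- n%:R)%R, F n%:R%R]) (G x)%:E)%E by [].
apply/funext => n; rewrite integration_by_substitution_increasing ?F'E//.
- by rewrite (@le_trans _ _ 0)// ?oppr_le0.
- by move=> x y _ _; exact: incF.
- by apply/cvg_ex; exists (f (- n%:R)); apply: cvg_at_right_filter; exact: cf.
- by apply/cvg_ex; exists (f n%:R); apply: cvg_at_left_filter; exact: cf.
- split=> [x _| |]; first exact: ex_derive.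
  + by apply: cvg_at_right_filter; exact: cF.
  + by apply: cvg_at_left_filter; exact: cF.
Qed.

(** As [f > 0], multiplication by [f] commutes with taking positive and negative parts, so the
    nonnegative case applies to each part and the results subtract, even when they are infinite. *)
Lemma integral_substitution (F f G : R -> R) (D : set R) :
  (forall x : R, is_derive x 1 F (f x)) -> continuous f ->
  (forall x, 0 < f x) ->
  D = \bigcup_n `[F (- n%:R), F n%:R]%classic ->
  (forall x, D x -> {for x, continuous G}) ->
  (\int[mu]_(x in D) (G x)%:E = \int[mu]_x (G (F x) * f x)%:E)%E.
Proof.
move=> dF cf f0 DE cG.
rewrite integralE [RHS]integralE.
rewrite (funerpos G) (funerneg G) (funerpos (fun x => G (F x) * f x)).
rewrite (funerneg (fun x => G (F x) * f x)).
have cmax (H : R -> R) x : {for x, continuous H} -> {for x, continuous H^\+}.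
  by move=> cH; apply: (@continuous_max _ _ H (cst 0)) => //; exact: cst_continuous.
congr (_ - _)%E.
  rewrite (ge0_integral_substitution dF cf f0 DE)//; last first.
    by move=> x Dx; apply: cmax; exact: cG.
  apply: eq_integral => x _; congr EFin.
  by rewrite /funrpos maxr_pMl ?(ltW (f0 _))// mul0r.
rewrite (ge0_integral_substitution dF cf f0 DE)//; last first.
  move=> x Dx; apply: (@continuous_max _ _ (- G) (cst 0)); last exact: cst_continuous.
  by apply: continuousN; exact: cG.
apply: eq_integral => x _; congr EFin.
by rewrite /funrneg maxr_pMl ?(ltW (f0 _))// mul0r mulNr.
Qed.

Lemma integral_shift (c : R) (G : R -> R) : continuous G ->
  (\int[mu]_x (G (x + c))%:E = \int[mu]_x (G x)%:E)%E.
Proof.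
move=> cG; have dF (x : R) : is_derive x 1 (fun x => x + c) (cst 1 x).
  by apply: is_derive_eq; rewrite addr0.
rewrite (@integral_substitution (fun x => x + c) (cst 1) G setT dF).
- by apply: eq_integral => x _; rewrite mulr1.
- exact: cst_continuous.
- by move=> x; exact: ltr01.
- apply/seteqP; split=> // x _.
  have : [set: R] (x - c) by []; rewrite -bigcup_itvNnn => -[n _ /=].
  rewrite in_itv/= => /andP[a b]; exists n => //=; rewrite in_itv/=; lra.
- by move=> x _; exact: cG.
Qed.

Lemma integral_itv0y_exp (G : R -> R) :
  (forall x, 0 < x -> {for x, continuous G}) ->
  (\int[mu]_(x in `]0%R, +oo[) (G x)%:E = \int[mu]_x (G (expR x) * expR x)%:E)%E.
Proof.
move=> cG; rewrite (@integral_substitution expR expR G)//.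
- exact: continuous_expR.
- by move=> x; exact: expR_gt0.
- apply/seteqP; split=> [x|x [n _]]/=; rewrite in_itv/= ?andbT.
    move=> x0; have : [set: R] (ln x) by [].
    rewrite -bigcup_itvNnn => -[n _ /=].
    rewrite in_itv/= => /andP[a b]; exists n => //=.
    by rewrite in_itv/= -{1 2}(lnK x0) !ler_expR a.
  by rewrite !in_itv/= andbT => /andP[+ _]; apply: lt_le_trans; exact: expR_gt0.
- by move=> x/=; rewrite in_itv/= andbT; exact: cG.
Qed.

(** The common comparison function: the Gamma kernel and the powers of [cosh] are both dominated by
    multiples of it. *)
Lemma integrable_expR_Nabs (k : R) : 0 < k ->
  mu.-integrable setT (EFin \o (fun x => expR (- (k * `|x|)))).
Proof.
move=> k0.
have cf : continuous (fun x : R => expR (- (k * `|x|))).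
  move=> x; apply: continuous_comp; last exact: continuous_expR.
  apply: continuousN; apply: continuousM; first exact: cst_continuous.
  exact: norm_continuous.
apply/integrableP; split.
  by apply/measurable_EFinP; exact: continuous_measurable_fun.
under eq_integral do rewrite gee0_abs ?lee_fin ?expR_ge0//.
rewrite ge0_symfun_integralT//; last first.
  by move=> x /=; rewrite normrN.
rewrite -set_itvcy.
under eq_integral.
  move=> x; rewrite inE/= in_itv/= andbT => x0.
  rewrite (ger0_norm x0); over.
rewrite (@ge0_continuous_FTC2y _ _ (fun x => - k^-1 * expR (- (k * x))) 0 0) ?ltry//.
- apply: continuous_subspaceT => x; apply: continuous_comp; last exact: continuous_expR.
  by apply: continuousN; apply: continuousM => //; exact: cst_continuous.
- rewrite -[X in _ --> X](mulr0 (- k^-1)); apply: cvgM; first exact: cvg_cst.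
  apply: (@cvg_comp _ _ _ (fun x => k * x) (fun x => expR (- x)) _ +oo%R); last exact: cvgr_expR.
  by apply: gt0_cvgMry => //; exact: cvg_cst.
- apply: (@cvg_at_right_filter _ _ (fun x => - k^-1 * expR (- (k * x)))).
  apply: (@continuousM _ _ (cst (- k^-1)) (fun x => expR (- (k * x))) 0).
    exact: cst_continuous.
  apply: continuous_comp; last exact: continuous_expR.
  by apply: continuousN; apply: continuousM => //; exact: cst_continuous.
- move=> x _; rewrite derive1E.
  have D : is_derive x 1 (fun x : R => - k^-1 * expR (- (k * x)))
     (- k^-1 * (expR (- (k * x)) * - (k * 1))).
    by apply: is_derive_eq.
  by rewrite (@derive_val _ _ _ _ _ _ _ D); field; rewrite gt_eqF.
Qed.

(** Integration by parts with vanishing boundary terms, used for the functional equation of Gamma.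
    Dominated convergence reduces it to [[-n, n]], where the integral is [F n - F (-n)]. *)
Lemma integral_derivativeT (F f : R -> R) :
  (forall x : R, is_derive x 1 F (f x)) -> continuous f ->
  mu.-integrable setT (EFin \o f) ->
  F x @[x --> +oo%R] --> (0 : R) -> F x @[x --> -oo%R] --> (0 : R) ->
  (\int[mu]_x (f x)%:E = 0)%E.
Proof.
move=> dF cf fi Fy FNy.
have F'E : derive1 F = f.
  by apply/funext => x; rewrite derive1E; apply: derive_val.
have cF : continuous F.
  by move=> x; apply/differentiable_continuous/derivable1_diffP; exact: ex_derive.
have l1 : (\int[mu]_(x in `[(- n%:R)%R, n%:R%R]) (f x)%:E @[n --> \oo] -->
   \int[mu]_x (f x)%:E)%E.
  under eq_cvg do rewrite integral_mkcond.
  apply: (@dominated_cvg _ _ _ mu setT _ _ _ (abse \o (EFin \o f))) => //.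
  - move=> n; apply/(measurable_restrictT (EFin \o f)) => //.
    by apply: measurable_funTS; exact: (measurable_int _ fi).
  - move=> x _; apply: cvg_near_cst; exists (Num.truncn `|x|).+1 => // n /= nx.
    rewrite patchE ifT// inE/= in_itv/= -ler_norml ltW//.
    by rewrite (lt_le_trans (truncnS_gt _))// ler_nat.
  - exact: integrable_abse.
  - move=> n x _; rewrite /= patchE; case: ifP => // _.
    (* Outside the interval the restriction takes the default value [point], which is 0 in the
       extended reals. *)
    by rewrite -[point]/(0%E) abse0 lee_fin.
have l2 : (\int[mu]_(x in `[(- n%:R)%R, n%:R%R]) (f x)%:E @[n --> \oo] --> (0 - 0 : R)%:E)%E.
  (* The index is shifted because the fundamental theorem is applied on an interval with distinct
     ends, which excludes [n = 0]. *)
  have : (F n.+1%:R - F (- n.+1%:R)) @[n --> \oo] --> (0 - 0 : R).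
    have ny : (n.+1%:R : R) @[n --> \oo] --> +oo%R.
      by apply: (cvg_comp _ _ _ (@cvgr_idn R)); rewrite (cvg_shiftS id).
    apply: cvgB; first exact: cvg_comp Fy.
    apply: cvg_comp FNy; apply: cvg_comp ny _.
    by apply/cvgNrNy; exact: cvg_id.
  have E n : (\int[mu]_(x in `[(- n.+1%:R)%R, n.+1%:R%R]) (f x)%:E =
      (F n.+1%:R - F (- n.+1%:R))%:E)%E.
    rewrite (@continuous_FTC2 _ f F) ?EFinB//.
    - by rewrite (@lt_trans _ _ 0)// oppr_lt0.
    - exact: continuous_subspaceT.
    - split=> [x _| |]; first exact: ex_derive.
      + by apply: cvg_at_right_filter; exact: cF.
      + by apply: cvg_at_left_filter; exact: cF.
    - by move=> x _; rewrite F'E.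
  move=> h; rewrite -cvg_shiftS/=; under eq_cvg do rewrite E.
  by apply: cvg_EFin; [exact: nearW|exact: h].
by have := cvg_unique _ l1 l2; rewrite subr0; apply.
Qed.

End RealLine.

(** * Unordered sums *)

Section UnorderedSums.
Context {R : realType}.

(** Enumeration by [pickle] turns an unordered sum into a series, to which the measurability and
    interchange results for series apply. Indices that code nothing, or a point outside [D],
    contribute 0. *)
Lemma esum_nneseries (T : countType) (D : set T) (a : T -> \bar R) :
  (forall t, D t -> (0 <= a t)%E) ->
  (\esum_(t in D) a t = \sum_(n <oo) (if pickle_inv n is Some t then
     if t \in D then a t else 0 else 0))%E.
Proof.
move=> a0.
pose b (n : nat) : \bar R := if pickle_inv n is Some t then
  if t \in D then a t else 0%E else 0%E.
rewrite -[X in (_ = \sum_(n <oo) X n)%E]/b.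
have b0 n : (0 <= b n)%E.
  rewrite /b; case: (pickle_inv n) => // t; case: ifPn => // /[!inE]; exact: a0.
rewrite nneseries_esumT//.
have -> : (\esum_(t in D) a t = \esum_(t in D) b (pickle t))%E.
  by apply: eq_esum => t Dt; rewrite /b pickleK_inv mem_set.
rewrite -(esum_image D pickle b); last first.
  by move=> x y _ _ /(congr1 (@pickle_inv T)); rewrite !pickleK_inv => -[].
rewrite esum_mkcond; apply: eq_esum => n _.
case: ifPn => // nD; rewrite /b; case E1 : (pickle_inv n) => [t|//].
case: ifPn => // /[!inE] Dt; exfalso; move: nD; rewrite notin_setE; apply.
by exists t => //; have := @pickle_invK T n; rewrite E1.
Qed.

Lemma measurable_esum d (X : measurableType d) (T : countType) (D : set T)
    (E : set X) (f : T -> X -> \bar R) :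
  (forall t, D t -> measurable_fun E (f t)) ->
  (forall t x, D t -> E x -> (0 <= f t x)%E) ->
  measurable_fun E (fun x => \esum_(t in D) f t x)%E.
Proof.
move=> mf f0.
apply: (@eq_measurable_fun _ _ _ _ _ (fun x => (\sum_(n <oo) (if pickle_inv n is Some t then
     if t \in D then f t x else 0 else 0))%E)).
  by move=> x /[!inE] Ex; rewrite esum_nneseries// => t Dt; exact: f0.
apply: ge0_emeasurable_sum => [n x Ex _|n _].
  by case: (pickle_inv n) => [t|//]; case: ifPn => // /[!inE] Dt; exact: f0.
case: (pickle_inv n) => [t|//].
by case: (boolP (t \in D)) => // /[!inE]; exact: mf.
Qed.

Lemma integral_esum d (X : measurableType d) (mu : {measure set X -> \bar R})
    (T : countType) (D : set T) (E : set X) (f : T -> X -> \bar R) :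
  measurable E -> (forall t, D t -> measurable_fun E (f t)) ->
  (forall t x, D t -> E x -> (0 <= f t x)%E) ->
  (\int[mu]_(x in E) (\esum_(t in D) f t x) =
   \esum_(t in D) (\int[mu]_(x in E) f t x))%E.
Proof.
move=> mE mf f0.
rewrite esum_nneseries; last by move=> t Dt; apply: integral_ge0 => x Ex; exact: f0.
under eq_integral.
  by move=> x /[!inE] Ex; rewrite esum_nneseries; [over|move=> t Dt; exact: f0].
rewrite integral_nneseries//.
- apply: eq_eseriesr => n _; case: (pickle_inv n) => [t|]; last exact: integral0.
  by case: ifPn => // _; exact: integral0.
- move=> n; case: (pickle_inv n) => [t|//].
  by case: (boolP (t \in D)) => // /[!inE]; exact: mf.
- move=> n x Ex; case: (pickle_inv n) => [t|//].
  by case: ifPn => // /[!inE] Dt; exact: f0.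
Qed.

Lemma ge0_esumZl (T : choiceType) (D : set T) (k : R) (f : T -> R) : 0 <= k ->
  (forall t, D t -> 0 <= f t) ->
  (\esum_(t in D) (k * f t)%:E = k%:E * \esum_(t in D) (f t)%:E)%E.
Proof.
(* One inequality suffices: applied to [k^-1] and [k * f] it gives the reverse one. *)
have le (c : R) (h : T -> R) : 0 <= c -> (forall t, D t -> 0 <= h t) ->
    (\esum_(t in D) (c * h t)%:E <= c%:E * \esum_(t in D) (h t)%:E)%E.
  move=> c0 h0; apply: ge_ereal_sup => _ [X [fX XD] <-].
  have -> : (\sum_(t \in X) (c * h t)%:E = c%:E * \sum_(t \in X) (h t)%:E)%E.
    by rewrite !fsbig_finite//= !sumEFin -mulr_sumr EFinM.
  by rewrite lee_wpmul2l ?lee_fin//; apply: ereal_sup_ubound; exists X.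
move=> k0 f0; apply/eqP; rewrite eq_le le//=.
have [->|kn0] := eqVneq k 0.
  by rewrite mul0e esum_ge0// => t _; rewrite mul0r.
have kp : 0 < k by rewrite lt_neqAle eq_sym kn0.
have kv0 : 0 <= k^-1 by rewrite invr_ge0.
have kf0 t : D t -> 0 <= k * f t by move=> Dt; rewrite mulr_ge0// f0.
have := le _ _ kv0 kf0; under eq_esum do rewrite mulKf//.
have ke0 : (0 <= k%:E)%E by rewrite lee_fin.
by move=> /(lee_wpmul2l ke0); rewrite muleA -EFinM mulfV// mul1e.
Qed.

(** [f] and [g] may differ from the positive and negative parts of [f - g] that define [rsum]; every
    nonnegative splitting with finite sums yields the same value. Linearity of [rsum] and [csum]
    rests on this. *)
Lemma rsumB (T : choiceType) (D : set T) (f g : T -> R) :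
  (forall t, D t -> 0 <= f t) -> (forall t, D t -> 0 <= g t) ->
  (\esum_(t in D) (f t)%:E < +oo)%E -> (\esum_(t in D) (g t)%:E < +oo)%E ->
  rsum D (fun t => f t - g t) =
  fine (\esum_(t in D) (f t)%:E) - fine (\esum_(t in D) (g t)%:E).
Proof.
move=> f0 g0 sf sg.
have fabs (h : T -> R) : (forall t, D t -> 0 <= h t) ->
   (\esum_(t in D) `|(EFin \o h) t| = \esum_(t in D) (h t)%:E)%E.
  by move=> h0; apply: eq_esum => t Dt; rewrite gee0_abs// lee_fin h0.
have Sf : summable D (EFin \o f) by rewrite /summable fabs.
have Sg : summable D (EFin \o g) by rewrite /summable fabs.
have Sfg := summableB Sf Sg.
have fin (h : T -> \bar R) : (forall t, D t -> (0 <= h t)%E) ->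
    (\esum_(t in D) h t < +oo)%E -> \esum_(t in D) h t \is a fin_num.
  by move=> h0 hs; rewrite ge0_fin_numE// esum_ge0.
have pos : (\esum_(x in D) (fun t => (f t - g t)%:E)^\+ x)%E \is a fin_num.
  apply: fin => //; apply: le_lt_trans (summable_funepos Sfg).
  by apply: le_esum => // t Dt; exact: lee_abs.
have neg : (\esum_(x in D) (fun t => (f t - g t)%:E)^\- x)%E \is a fin_num.
  apply: fin => //; apply: le_lt_trans (summable_funeneg Sfg).
  by apply: le_esum => // t Dt; exact: lee_abs.
rewrite /rsum -!fineB//; last 2 first.
- by apply: fin => // t Dt; rewrite lee_fin f0.
- by apply: fin => // t Dt; rewrite lee_fin g0.
congr fine; rewrite -(esumB Sf Sg)//.
Qed.

Lemma esum_fin_num (T : choiceType) (D : set T) (f : T -> R) :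
  (forall t, D t -> 0 <= f t) -> (\esum_(t in D) (f t)%:E < +oo)%E ->
  \esum_(t in D) (f t)%:E \is a fin_num.
Proof. by move=> f0 foo; rewrite ge0_fin_numE// esum_ge0// => t Dt; rewrite lee_fin f0. Qed.

Lemma posnegE (x : R) : x = Num.max x 0 - Num.max (- x) 0.
Proof.
have [x0|/ltW x0] := leP 0 x; first by rewrite max_r ?subr0// oppr_le0.
by rewrite max_l ?oppr_ge0// sub0r opprK.
Qed.

Lemma rsum_posneg (T : choiceType) (D : set T) (f : T -> R) :
  rsum D f = fine (\esum_(t in D) (Num.max (f t) 0)%:E)
    - fine (\esum_(t in D) (Num.max (- f t) 0)%:E).
Proof.
rewrite /rsum; congr (fine _ - fine _); apply: eq_esum => t _.
  by rewrite funeposE /= EFin_max.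
by rewrite funenegE /= EFin_max.
Qed.

Lemma posneg_lty (T : choiceType) (D : set T) (f : T -> R) :
  (\esum_(t in D) `|f t|%:E < +oo)%E ->
  (\esum_(t in D) (Num.max (f t) 0)%:E < +oo)%E /\
  (\esum_(t in D) (Num.max (- f t) 0)%:E < +oo)%E.
Proof.
move=> foo; split; apply: le_lt_trans foo; apply: le_esum => t _; rewrite lee_fin ge_max normr_ge0 andbT.
  exact: ler_norm.
by rewrite -normrN ler_norm.
Qed.

Lemma rsumZl (T : choiceType) (D : set T) (k : R) (f : T -> R) :
  (\esum_(t in D) `|f t|%:E < +oo)%E -> rsum D (fun t => k * f t) = k * rsum D f.
Proof.
move=> /posneg_lty[fp fn].
have m0 x : 0 <= Num.max x 0 :> R by rewrite le_max lexx orbT.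
have Z c (h : T -> R) : 0 <= c -> (\esum_(t in D) (Num.max (h t) 0)%:E < +oo)%E ->
    (\esum_(t in D) (c * Num.max (h t) 0)%:E < +oo)%E.
  move=> c0 hoo; rewrite ge0_esumZl//; apply: lte_mul_pinfty; rewrite ?lee_fin//.
have fZ c (h : T -> R) : 0 <= c -> (\esum_(t in D) (Num.max (h t) 0)%:E < +oo)%E ->
    fine (\esum_(t in D) (c * Num.max (h t) 0)%:E) = c * fine (\esum_(t in D) (Num.max (h t) 0)%:E).
  by move=> c0 hoo; rewrite ge0_esumZl// fineM// esum_fin_num.
rewrite [rsum D f]rsum_posneg.
have [k0|/ltW k0] := leP 0 k.
  have -> : (fun t => k * f t) = (fun t => k * Num.max (f t) 0 - k * Num.max (- f t) 0).
    by apply/funext => t; rewrite -mulrBr -posnegE.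
  rewrite (@rsumB T D (fun t => k * Num.max (f t) 0) (fun t => k * Num.max (- f t) 0)
    (fun t _ => mulr_ge0 k0 (m0 _)) (fun t _ => mulr_ge0 k0 (m0 _))
    (Z _ f k0 fp) (Z _ (fun t => - f t) k0 fn)).
  by rewrite (fZ _ f k0 fp) (fZ _ (fun t => - f t) k0 fn) mulrBr.
have nk0 : 0 <= - k by rewrite oppr_ge0.
have -> : (fun t => k * f t) = (fun t => (- k) * Num.max (- f t) 0 - (- k) * Num.max (f t) 0).
  by apply/funext => t; rewrite -mulrBr -opprB mulrNN -posnegE.
rewrite (@rsumB T D (fun t => - k * Num.max (- f t) 0) (fun t => - k * Num.max (f t) 0)
  (fun t _ => mulr_ge0 nk0 (m0 _)) (fun t _ => mulr_ge0 nk0 (m0 _))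
  (Z _ (fun t => - f t) nk0 fn) (Z _ f nk0 fp)).
by rewrite (fZ _ f nk0 fp) (fZ _ (fun t => - f t) nk0 fn) mulrBr !mulNr opprK addrC.
Qed.

Lemma rsumD (T : choiceType) (D : set T) (f g : T -> R) :
  (\esum_(t in D) `|f t|%:E < +oo)%E -> (\esum_(t in D) `|g t|%:E < +oo)%E ->
  rsum D (fun t => f t + g t) = rsum D f + rsum D g.
Proof.
move=> /posneg_lty[fp fn] /posneg_lty[gp gn].
have m0 x : 0 <= Num.max x 0 :> R by rewrite le_max lexx orbT.
have -> : (fun t => f t + g t) = (fun t => (Num.max (f t) 0 + Num.max (g t) 0) -
   (Num.max (- f t) 0 + Num.max (- g t) 0)).
  by apply/funext => t; rewrite {1}(posnegE (f t)) {1}(posnegE (g t)); ring.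
have A (u v : T -> R) : \esum_(t in D) (Num.max (u t) 0 + Num.max (v t) 0)%:E =
   (\esum_(t in D) (Num.max (u t) 0)%:E + \esum_(t in D) (Num.max (v t) 0)%:E)%E.
  by rewrite -esumD// => t _; rewrite lee_fin.
have foo (u v : T -> R) : (\esum_(t in D) (Num.max (u t) 0)%:E < +oo)%E ->
    (\esum_(t in D) (Num.max (v t) 0)%:E < +oo)%E ->
    (\esum_(t in D) (Num.max (u t) 0 + Num.max (v t) 0)%:E < +oo)%E.
  by move=> u1 v1; rewrite A lte_add_pinfty.
rewrite (@rsumB T D (fun t => Num.max (f t) 0 + Num.max (g t) 0)
  (fun t => Num.max (- f t) 0 + Num.max (- g t) 0)
  (fun t _ => addr_ge0 (m0 _) (m0 _)) (fun t _ => addr_ge0 (m0 _) (m0 _))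
  (foo f g fp gp) (foo (fun t => - f t) (fun t => - g t) fn gn)).
rewrite (A f g) (A (fun t => - f t) (fun t => - g t)) !rsum_posneg.
have F (u : T -> R) : (\esum_(t in D) (Num.max (u t) 0)%:E < +oo)%E ->
    \esum_(t in D) (Num.max (u t) 0)%:E \is a fin_num.
  by move=> u1; exact: esum_fin_num.
rewrite (fineD (F f fp) (F g gp)) (fineD (F (fun t => - f t) fn) (F (fun t => - g t) gn)).
by rewrite opprD addrACA.
Qed.

Lemma csumZl (T : choiceType) (D : set T) (k : R[i]) (f : T -> R[i]) :
  (\esum_(t in D) `|complex.Re (f t)|%:E < +oo)%E ->
  (\esum_(t in D) `|complex.Im (f t)|%:E < +oo)%E ->
  csum D (fun t => k * f t) = k * csum D f.
Proof.
move=> f1 f2; case: k => a b.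
have S c (h : T -> R) : (\esum_(t in D) `|h t|%:E < +oo)%E ->
    (\esum_(t in D) `|c * h t|%:E < +oo)%E.
  move=> hoo; under eq_esum do rewrite normrM.
  by rewrite ge0_esumZl//; apply: lte_mul_pinfty; rewrite ?lee_fin.
rewrite /csum; simpc; congr (_ +i* _).
  have -> : (fun t => complex.Re ((a +i* b) * f t)) =
    (fun t => a * complex.Re (f t) + (- b) * complex.Im (f t)).
    by apply/funext => t; case: (f t) => c d /=; rewrite mulNr.
  rewrite (@rsumD T D (fun t => a * complex.Re (f t)) (fun t => - b * complex.Im (f t)) (S _ _ f1) (S _ _ f2)).
  by rewrite (@rsumZl T D a _ f1) (@rsumZl T D (- b) _ f2) mulNr.
have -> : (fun t => complex.Im ((a +i* b) * f t)) =
    (fun t => a * complex.Im (f t) + b * complex.Re (f t)).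
  by apply/funext => t; case: (f t).
rewrite (@rsumD T D (fun t => a * complex.Im (f t)) (fun t => b * complex.Re (f t)) (S _ _ f2) (S _ _ f1)).
by rewrite (@rsumZl T D a _ f2) (@rsumZl T D b _ f1).
Qed.

Lemma esum_int (f : int -> \bar R) : (forall n, (0 <= f n)%E) ->
  (\esum_(n in [set: int]) f n =
   \esum_(n in [set: nat]) f (Posz n) + \esum_(n in [set: nat]) f (Negz n))%E.
Proof.
move=> f0; rewrite (esumID (range Posz))//.
congr (_ + _)%E.
  by rewrite setTI esum_image// => x y _ _ [].
rewrite setTI (_ : ~` range Posz = range Negz) ?esum_image//.
- by move=> x y _ _ [].
- apply/seteqP; split=> [[n|n] h|_ [n _ <-] [m]] //=; last by exists n.
  by exfalso; apply: h; exists n.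
Qed.

End UnorderedSums.

(** * Complex powers and integrals *)

Section ComplexPowers.
Context {R : realType}.
Implicit Types (x y : R) (s t u v : R[i]).

Lemma cexpE (a b : R) : cexp (a +i* b) = (expR a * cos b) +i* (expR a * sin b).
Proof. by rewrite /cexp /=; simpc. Qed.

Lemma Re_cexp u : complex.Re (cexp u) = expR (complex.Re u) * cos (complex.Im u).
Proof. by case: u => a b; rewrite cexpE. Qed.

Lemma Im_cexp u : complex.Im (cexp u) = expR (complex.Re u) * sin (complex.Im u).
Proof. by case: u => a b; rewrite cexpE. Qed.

Lemma cexpD u v : cexp (u + v) = cexp u * cexp v.
Proof.
case: u v => [a b] [c d]; rewrite [LHS](cexpE (a + c) (b + d)) !cexpE.
simpc; rewrite expRD cosD sinD.
by congr (_ +i* _); ring.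
Qed.

Lemma cexp0 : cexp (0 : R[i]) = 1.
Proof. by rewrite [LHS](cexpE 0 0) expR0 cos0 sin0 mulr1 mulr0. Qed.

Lemma cexp_neq0 u : cexp u != 0.
Proof.
apply/eqP => u0; have := cexpD u (- u); rewrite subrr cexp0 u0 mul0r.
by move/eqP; rewrite oner_eq0.
Qed.

Lemma cexpN u : cexp (- u) = (cexp u)^-1.
Proof.
by apply: (mulfI (cexp_neq0 u)); rewrite -cexpD subrr cexp0 divff// cexp_neq0.
Qed.

Lemma cexp_real x : cexp x%:C = (expR x)%:C.
Proof. by rewrite cexpE cos0 sin0 mulr1 mulr0. Qed.

Lemma normc_cexp u : Normc.normc (cexp u) = expR (complex.Re u).
Proof.
case: u => a b; rewrite cexpE /= !exprMn -mulrDr cos2Dsin2 mulr1 sqrtr_sqr.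
by rewrite ger0_norm// expR_ge0.
Qed.

Lemma cpow_neq0 x s : cpow x s != 0.
Proof. exact: cexp_neq0. Qed.

Lemma cpowM x y s : 0 < x -> 0 < y -> cpow (x * y) s = cpow x s * cpow y s.
Proof.
by move=> x0 y0; rewrite /cpow -cexpD lnM ?posrE// -mulrDr -rmorphD.
Qed.

Lemma cpowDr x s t : cpow x (s + t) = cpow x s * cpow x t.
Proof. by rewrite /cpow mulrDl cexpD. Qed.

Lemma cpowNr x s : cpow x (- s) = (cpow x s)^-1.
Proof. by rewrite /cpow mulNr cexpN. Qed.

Lemma cpow_expR x s : cpow (expR x) s = cexp (s * x%:C).
Proof. by rewrite /cpow expRK. Qed.

Lemma cpowr1 x : 0 < x -> cpow x 1 = x%:C.
Proof. by move=> x0; rewrite /cpow mul1r cexp_real lnK ?posrE. Qed.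

Lemma normc_cpow x s : Normc.normc (cpow x s) = expR (complex.Re s * ln x).
Proof. by rewrite normc_cexp; case: s => a b /=; rewrite mulr0 subr0. Qed.

Lemma normc_real x : Normc.normc x%:C = `|x|.
Proof. by rewrite /= expr0n addr0 sqrtr_sqr. Qed.

Lemma ler_Re_normc u : `|complex.Re u| <= Normc.normc u.
Proof.
case: u => a b /=; rewrite -sqrtr_sqr ler_sqrt ?lerDl ?sqr_ge0//.
by rewrite addr_ge0 ?sqr_ge0.
Qed.

Lemma ler_Im_normc u : `|complex.Im u| <= Normc.normc u.
Proof.
case: u => a b /=; rewrite -sqrtr_sqr ler_sqrt ?lerDr ?sqr_ge0//.
by rewrite addr_ge0 ?sqr_ge0.
Qed.

Lemma Re_mul_real u x : complex.Re (u * x%:C) = complex.Re u * x.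
Proof. by case: u => a b /=; rewrite mulr0 subr0. Qed.

Lemma Im_mul_real u x : complex.Im (u * x%:C) = complex.Im u * x.
Proof. by case: u => a b /=; rewrite mulr0 add0r. Qed.

End ComplexPowers.

(** * Complex-valued integrals on the line and Fubini's theorem *)

Section ComplexIntegrals.
Context {R : realType}.
Notation mu := (@lebesgue_measure R).

Definition ccontinuous (f : R -> R[i]) :=
  continuous (fun x => complex.Re (f x)) /\ continuous (fun x => complex.Im (f x)).

Definition cintegrable (D : set R) (f : R -> R[i]) :=
  mu.-integrable D (EFin \o (fun x => complex.Re (f x))) /\
  mu.-integrable D (EFin \o (fun x => complex.Im (f x))).

Lemma eq_cintegral D (f g : R -> R[i]) : (forall x, D x -> f x = g x) ->
  cintegral D f = cintegral D g.
Proof.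
by move=> fg; congr (_ +i* _); apply: eq_Rintegral => x /[!inE] Dx; rewrite fg.
Qed.

Lemma ccontinuousM (f g : R -> R[i]) : ccontinuous f -> ccontinuous g ->
  ccontinuous (fun x => f x * g x).
Proof.
move=> [f1 f2] [g1 g2].
have -> : (fun x => f x * g x) = (fun x =>
  (complex.Re (f x) * complex.Re (g x) - complex.Im (f x) * complex.Im (g x))
  +i* (complex.Re (f x) * complex.Im (g x) + complex.Im (f x) * complex.Re (g x))).
  by apply/funext => x; case: (f x) (g x) => [a b] [c d]; simpc.
split=> x /=.
  by apply: cvgB; apply: cvgM; [exact: f1|exact: g1|exact: f2|exact: g2].
by apply: cvgD; apply: cvgM; [exact: f1|exact: g2|exact: f2|exact: g1].
Qed.

Lemma ccontinuousB (f g : R -> R[i]) : ccontinuous f -> ccontinuous g ->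
  ccontinuous (fun x => f x - g x).
Proof.
move=> [f1 f2] [g1 g2].
have -> : (fun x => f x - g x) = (fun x =>
  (complex.Re (f x) - complex.Re (g x)) +i* (complex.Im (f x) - complex.Im (g x))).
  by apply/funext => x; case: (f x) (g x) => [a b] [c d]; simpc.
by split=> x /=; apply: cvgB; [exact: f1|exact: g1|exact: f2|exact: g2].
Qed.

Lemma ccontinuous_cst (k : R[i]) : ccontinuous (fun=> k).
Proof. by split=> x; exact: cst_continuous. Qed.

Lemma ccontinuous_real (f : R -> R) : continuous f -> ccontinuous (fun x => (f x)%:C).
Proof. by move=> cf; split => //= x; exact: cst_continuous. Qed.

Lemma ccontinuous_cexp (f : R -> R[i]) : ccontinuous f ->
  ccontinuous (fun x => cexp (f x)).
Proof.
move=> [f1 f2]; split=> x; under eq_fun do rewrite ?Re_cexp ?Im_cexp.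
  apply: cvgM; first by apply: cvg_comp; [exact: f1|exact: continuous_expR].
  by apply: cvg_comp; [exact: f2|exact: continuous_cos].
apply: cvgM; first by apply: cvg_comp; [exact: f1|exact: continuous_expR].
by apply: cvg_comp; [exact: f2|exact: continuous_sin].
Qed.

Lemma ccontinuous_cexp_lin (s : R[i]) : ccontinuous (fun x => cexp (s * x%:C)).
Proof.
apply: ccontinuous_cexp; apply: ccontinuousM; first exact: ccontinuous_cst.
by apply: ccontinuous_real => x.
Qed.

Lemma cintegrable_le (f : R -> R[i]) (g : R -> R) : ccontinuous f ->
  (forall x, Normc.normc (f x) <= g x) -> mu.-integrable setT (EFin \o g) ->
  cintegrable setT f.
Proof.
move=> [f1 f2] fg ig; split; apply: le_integrable ig => //.
- by apply/measurable_EFinP; exact: continuous_measurable_fun.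
- move=> x _ /=; rewrite lee_fin (le_trans (ler_Re_normc _))// (le_trans (fg x))//.
  exact: ler_norm.
- by apply/measurable_EFinP; exact: continuous_measurable_fun.
- move=> x _ /=; rewrite lee_fin (le_trans (ler_Im_normc _))// (le_trans (fg x))//.
  exact: ler_norm.
Qed.

Lemma cintegral_shift (c : R) (f : R -> R[i]) : ccontinuous f ->
  cintegral setT (fun x => f (x + c)) = cintegral setT f.
Proof.
move=> [f1 f2]; congr (_ +i* _); congr fine; exact: (integral_shift c).
Qed.

Lemma integrable_shift (c : R) (f : R -> R) : continuous f ->
  mu.-integrable setT (EFin \o f) ->
  mu.-integrable setT (EFin \o (fun x => f (x + c))).
Proof.
move=> cf /integrableP[_ fi]; apply/integrableP; split.
  apply/measurable_EFinP; apply: continuous_measurable_fun => x.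
  apply: (cvg_comp (fun x => x + c) f); last exact: cf.
  by apply: cvgD; [exact: cvg_id|exact: cvg_cst].
rewrite (integral_shift c (G := fun x => `|f x|))// => x.
by apply: (cvg_comp f (fun x => `|x|)); [exact: cf|exact: norm_continuous].
Qed.

Lemma cintegrable_shift (c : R) (f : R -> R[i]) : ccontinuous f ->
  cintegrable setT f -> cintegrable setT (fun x => f (x + c)).
Proof.
by move=> [f1 f2] [i1 i2]; split; [exact: (integrable_shift c f1 i1)|exact: (integrable_shift c f2 i2)].
Qed.

Lemma cmulE (k u : R[i]) : k * u =
  (complex.Re k * complex.Re u - complex.Im k * complex.Im u) +i*
  (complex.Re k * complex.Im u + complex.Im k * complex.Re u).
Proof. by case: k u => [a b] [c d]; simpc. Qed.

Lemma csubE (u v : R[i]) : u - v =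
  (complex.Re u - complex.Re v) +i* (complex.Im u - complex.Im v).
Proof. by case: u v => [a b] [c d]; simpc. Qed.

Lemma integrableZl_EFin (D : set R) (c : R) (g : R -> R) : measurable D ->
  mu.-integrable D (EFin \o g) -> mu.-integrable D (EFin \o (fun x => c * g x)).
Proof. by move=> mD ig; apply: (fun m => integrableZl m c ig). Qed.

Lemma cintegralZl (D : set R) (k : R[i]) (f : R -> R[i]) : measurable D ->
  cintegrable D f -> cintegral D (fun x => k * f x) = k * cintegral D f.
Proof.
move=> mD [f1 f2]; rewrite [RHS]cmulE; congr (_ +i* _).
  under eq_Rintegral do rewrite cmulE /=.
  by rewrite RintegralB ?RintegralZl//; exact: integrableZl_EFin.
under eq_Rintegral do rewrite cmulE /=.
by rewrite RintegralD ?RintegralZl//; exact: integrableZl_EFin.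
Qed.

Lemma cintegralB (D : set R) (f g : R -> R[i]) : measurable D ->
  cintegrable D f -> cintegrable D g ->
  cintegral D (fun x => f x - g x) = cintegral D f - cintegral D g.
Proof.
move=> mD [f1 f2] [g1 g2]; rewrite [RHS]csubE; congr (_ +i* _).
  under eq_Rintegral do rewrite csubE /=.
  by rewrite RintegralB.
under eq_Rintegral do rewrite csubE /=.
by rewrite RintegralB.
Qed.

Lemma cintegrableB (D : set R) (f g : R -> R[i]) : measurable D ->
  cintegrable D f -> cintegrable D g -> cintegrable D (fun x => f x - g x).
Proof.
move=> mD [f1 f2] [g1 g2]; split.
  have h := fun m => integrableB m f1 g1.
  by under eq_fun do rewrite csubE; apply: h.
have h := fun m => integrableB m f2 g2.
by under eq_fun do rewrite csubE; apply: h.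
Qed.

Lemma cintegrableZl (D : set R) (k : R[i]) (f : R -> R[i]) : measurable D ->
  cintegrable D f -> cintegrable D (fun x => k * f x).
Proof.
move=> mD [f1 f2]; split.
  have h := fun m => integrableB m (integrableZl_EFin (complex.Re k) mD f1)
    (integrableZl_EFin (complex.Im k) mD f2).
  by under eq_fun do rewrite cmulE; apply: h.
have h := fun m => integrableD m (integrableZl_EFin (complex.Re k) mD f2)
    (integrableZl_EFin (complex.Im k) mD f1).
by under eq_fun do rewrite cmulE; apply: h.
Qed.

Lemma cintegral_real D (g : R -> R) :
  cintegral D (fun x => (g x)%:C) = (Rintegral mu D g)%:C.
Proof.
rewrite /cintegral /=; congr (_ +i* _).
by rewrite /Rintegral integral0.
Qed.

Lemma cintegralZr (D : set R) (k : R[i]) (f : R -> R[i]) : measurable D ->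
  cintegrable D f -> cintegral D (fun x => f x * k) = cintegral D f * k.
Proof.
move=> mD fi; rewrite mulrC -cintegralZl//.
by apply: eq_cintegral => x _; rewrite mulrC.
Qed.

Lemma Re_cintegral D (f : R -> R[i]) :
  complex.Re (cintegral D f) = Rintegral mu D (fun x => complex.Re (f x)).
Proof. by []. Qed.

(** Tonelli applied to the majorant [g] gives joint integrability. Integrability is asked of every
    section, rather than of almost every one, so that the [fine] inside each inner integral can be
    undone pointwise. *)
Lemma cintegral_fubini (f : R -> R -> R[i]) (g : R -> R -> R) :
  measurable_fun setT (fun xy : R * R => complex.Re (f xy.1 xy.2)) ->
  measurable_fun setT (fun xy : R * R => complex.Im (f xy.1 xy.2)) ->
  measurable_fun setT (fun xy : R * R => g xy.1 xy.2) ->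
  (forall x y, Normc.normc (f x y) <= g x y) ->
  (\int[mu]_y \int[mu]_x (g x y)%:E < +oo)%E ->
  (forall x, cintegrable setT (f x)) -> (forall y, cintegrable setT (f ^~ y)) ->
  cintegral setT (fun x => cintegral setT (f x)) =
  cintegral setT (fun y => cintegral setT (f ^~ y)).
Proof.
move=> mRe mIm mg fg goo fx fy.
have g0 x y : 0 <= g x y.
  by rewrite (le_trans _ (fg x y))//; case: (f x y) => a b; exact: sqrtr_ge0.
have gi : (mu \x mu)%E.-integrable setT (fun xy : R * R => (g xy.1 xy.2)%:E).
  apply/integrable21ltyP; first exact/measurable_EFinP.
  by under eq_integral do under eq_integral do rewrite gee0_abs ?lee_fin//.
have fin (h : R -> R) : mu.-integrable setT (EFin \o h) ->
    ((Rintegral mu setT h)%:E = \int[mu]_x (h x)%:E)%E.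
  by move=> hi; rewrite /Rintegral fineK//; exact: integrable_fin_num.
have eq_complex2 (a b a' b' : R) : a = a' -> b = b' -> a +i* b = a' +i* b' by move=> -> ->.
apply: eq_complex2 => /=; apply: (congr1 (@fine R)).
  under eq_integral => x _ do rewrite (fin _ (fx x).1).
  under [RHS]eq_integral => y _ do rewrite (fin _ (fy y).1).
  apply: (@Fubini _ _ _ _ _ mu mu (fun xy : R * R => (complex.Re (f xy.1 xy.2))%:E)).
  apply: le_integrable gi => //; first exact/measurable_EFinP.
  move=> [x y] _ /=; rewrite lee_fin (le_trans (ler_Re_normc _))// (le_trans (fg x y))//.
  exact: ler_norm.
under eq_integral => x _ do rewrite (fin _ (fx x).2).
under [RHS]eq_integral => y _ do rewrite (fin _ (fy y).2).
apply: (@Fubini _ _ _ _ _ mu mu (fun xy : R * R => (complex.Im (f xy.1 xy.2))%:E)).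
apply: le_integrable gi => //; first exact/measurable_EFinP.
move=> [x y] _ /=; rewrite lee_fin (le_trans (ler_Im_normc _))// (le_trans (fg x y))//.
exact: ler_norm.
Qed.

End ComplexIntegrals.

(** * Elementary inequalities for exp, sin, cos and cosh *)

Section RealBounds.
Context {R : realType}.

Lemma ler_norm_sin (x : R) : `|sin x| <= `|x|.
Proof.
wlog x0 : x / 0 <= x.
  move=> h; have [/h//|/ltW x0] := leP 0 x.
  by rewrite -normrN -sinN -(normrN x); apply: h; rewrite oppr_ge0.
have [|c _ E] := @MVT_segment R sin cos 0 x x0 (fun y _ => is_derive_sin y).
  by apply: continuous_subspaceT; exact: continuous_sin.
have -> : sin x = cos c * x by rewrite -[RHS]/(cos c * x) -{2}(subr0 x) -E sin0 subr0.
by rewrite normrM ler_piMl// cos_max.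
Qed.

Lemma ler_norm_mul_cos (e x : R) : 0 <= e -> `|e * cos x| <= e.
Proof. by move=> e0; rewrite normrM (ger0_norm e0) ler_piMr// cos_max. Qed.

Lemma ler_norm_mul_sin (e x : R) : 0 <= e -> `|e * sin x| <= e.
Proof.
by move=> e0; rewrite normrM (ger0_norm e0) ler_piMr// ler_norml sin_geN1 sin_le1.
Qed.

Lemma cos_ge1B (x : R) : 1 - x ^+ 2 / 2%:R <= cos x.
Proof.
have -> : cos x = 1 - 2%:R * sin (x / 2%:R) ^+ 2.
  have {1}-> : x = x / 2%:R + x / 2%:R by field.
  by rewrite cosD -!expr2 cos2sin2; ring.
have : sin (x / 2%:R) ^+ 2 <= (x / 2%:R) ^+ 2.
  rewrite -[leLHS]real_normK ?num_real// -[leRHS]real_normK ?num_real//.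
  by rewrite ler_pXn2r ?nnegrE//; exact: ler_norm_sin.
by move=> h; rewrite lerD2l lerN2; move: h; rewrite expr_div_n; lra.
Qed.

Lemma expRB_ge (x : R) : 0 <= x -> 2%:R * x <= expR x - expR (- x).
Proof.
move=> x0.
have dF (y : R) : is_derive y 1 (fun y => expR y - expR (- y)) (expR y + expR (- y)).
  by apply: is_derive_eq; rewrite mulrN1 opprK.
have cF : continuous (fun y : R => expR y - expR (- y)).
  by move=> y; apply/differentiable_continuous/derivable1_diffP; exact: ex_derive.
have [|c _ E] := @MVT_segment R _ _ 0 x x0 (fun y _ => dF y).
  exact: continuous_subspaceT.
rewrite oppr0 subrr subr0 addr0 in E.
rewrite E ler_wpM2r//.
have := sqr_ge0 (expR (c / 2%:R) - expR (- (c / 2%:R))).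
rewrite sqrrB -!expRM_natl -expRD subrr expR0 mulrN.
have -> : 2%:R * (c / 2%:R) = c by field.
lra.
Qed.

Lemma sqr_le_expR (x : R) : x ^+ 2 <= expR x + expR (- x) - 2%:R.
Proof.
wlog x0 : x / 0 <= x.
  move=> h; have [/h//|/ltW x0] := leP 0 x.
  by have := h (- x); rewrite oppr_ge0 sqrrN opprK (addrC (expR (- x))); apply.
pose h := x / 2%:R; have h0 : 0 <= h by rewrite divr_ge0.
have xE : x = 2%:R * h by rewrite /h; field.
have -> : expR x + expR (- x) - 2%:R = (expR h - expR (- h)) ^+ 2.
  rewrite sqrrB -!expRM_natl -expRD subrr expR0 mulrN -xE.
  lra.
have h20 : 0 <= 2%:R * h by rewrite mulr_ge0.
have le2 := expRB_ge h0.
by rewrite xE ler_pXn2r// nnegrE// (le_trans h20).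
Qed.

(** Two-sided exponential decay of Euler's integrand after [t = exp x]. For [x >= 0] the constant
    [4 a^2] comes from [(x/2 - 2 a)^2 >= 0] and [exp x >= (1 + x/2)^2]. *)
Lemma gamma_exponent_le (a x : R) : 0 < a ->
  a * x - expR x <= 4%:R * a ^+ 2 - a * `|x|.
Proof.
move=> a0; have [x0|x0] := leP 0 x.
  have y0 : 0 <= x / 2%:R by rewrite divr_ge0.
  have e2 : (1 + x / 2%:R) ^+ 2 <= expR x.
    have {2}-> : x = 2%:R * (x / 2%:R) by field.
    rewrite expRM_natl ler_pXn2r ?nnegrE ?expR_ge0 ?expR_ge1Dx//.
    by rewrite addr_ge0.
  rewrite ger0_norm//.
  have := sqr_ge0 (x / 2%:R - 2%:R * a).
  move: e2; rewrite !expr2; nra.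
rewrite ltr0_norm//; have := expR_ge0 x; have := sqr_ge0 a; rewrite expr2; nra.
Qed.

Lemma cosh_ge (x : R) : expR `|x| / 2%:R <= Defs.cosh x.
Proof.
rewrite /Defs.cosh ler_pM2r ?invr_gt0//; have [x0|x0] := leP 0 x.
  by rewrite ger0_norm// lerDl expR_ge0.
by rewrite ltr0_norm// lerDr expR_ge0.
Qed.

Lemma cosh_gt0 (x : R) : 0 < Defs.cosh x.
Proof. by apply: lt_le_trans (cosh_ge x); rewrite divr_gt0// expR_gt0. Qed.

Lemma continuous_cosh : continuous (@Defs.cosh R).
Proof.
move=> x; apply: cvgM; last exact: cvg_cst.
apply: cvgD; first exact: continuous_expR.
apply: (cvg_comp (fun x : R => - x) expR); last exact: continuous_expR.
by apply: cvgN; exact: cvg_id.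
Qed.

Lemma cosh2D1 (x : R) :
  Defs.cosh x ^+ 2 = 1 + ((expR x - expR (- x)) / 2%:R) ^+ 2.
Proof.
rewrite /Defs.cosh !expr_div_n sqrrD sqrrB -expRD subrr expR0.
by field.
Qed.

End RealBounds.

Section Tails.
Context {R : realType}.

Lemma cvg_expR_Ny (C k : R) : 0 < k -> C * expR (- (k * x)) @[x --> +oo%R] --> (0 : R).
Proof.
move=> k0; rewrite -[X in _ --> X](mulr0 C); apply: cvgM; first exact: cvg_cst.
apply: (@cvg_comp _ _ _ (fun x => k * x) (fun x => expR (- x)) _ +oo%R); last exact: cvgr_expR.
by apply: gt0_cvgMry => //; exact: cvg_cst.
Qed.

Lemma tail_cvg0 (f : R -> R) (C k : R) : 0 < k ->
  (forall x, `|f x| <= C * expR (- (k * `|x|))) ->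
  f x @[x --> +oo%R] --> (0 : R) /\ f x @[x --> -oo%R] --> (0 : R).
Proof.
move=> k0 fC.
have main (g : R -> R) : (forall x, `|g x| <= C * expR (- (k * `|x|))) ->
    g x @[x --> +oo%R] --> (0 : R).
  move=> gC.
  apply: (@squeeze_cvgr _ _ _ _ (fun x => - (C * expR (- (k * x))))
    (fun x => C * expR (- (k * x)))).
  - near=> x; have x0 : 0 <= x by near: x; exact: nbhs_pinfty_ge.
    by rewrite -ler_norml (le_trans (gC x))// ger0_norm.
  - by rewrite -oppr0; apply: cvgN; exact: cvg_expR_Ny.
  - exact: cvg_expR_Ny.
split; first exact: main.
by apply/cvgNy_compNP; apply: main => x /=; rewrite -(normrN x).
Unshelve. all: by end_near. Qed.

End Tails.

(** * The Gamma function *)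

Section Gamma.
Context {R : realType}.
Notation mu := (@lebesgue_measure R).

(** Euler's integrand after [t = exp x]; the factor [dt = t dx] turns [t^(s-1)] into [t^s]. In this
    form it is continuous on the whole line and scaling [t] becomes a shift of [x]. *)
Definition gamma_kernel (s : R[i]) (x : R) : R[i] :=
  cexp (s * x%:C) * (expR (- expR x))%:C.

Lemma ccontinuous_gamma_kernel s : ccontinuous (gamma_kernel s).
Proof.
apply: ccontinuousM; first exact: ccontinuous_cexp_lin.
apply: ccontinuous_real => x; apply: (cvg_comp (fun x : R => - expR x) expR).
  by apply: cvgN; exact: continuous_expR.
exact: continuous_expR.
Qed.

Lemma normc_gamma_kernel s x :
  Normc.normc (gamma_kernel s x) = expR (complex.Re s * x - expR x).
Proof.
rewrite Normc.normcM normc_cexp Re_mul_real normc_real ger0_norm ?expR_ge0//.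
by rewrite -expRD.
Qed.

Lemma integrable_gamma_kernel_bound (a : R) : 0 < a ->
  mu.-integrable setT (EFin \o (fun x => expR (a * x - expR x))).
Proof.
move=> a0.
have ib : mu.-integrable setT
    (EFin \o (fun x => expR (4%:R * a ^+ 2) * expR (- (a * `|x|)))).
  exact: (integrableZl measurableT _ (integrable_expR_Nabs a0)).
apply: le_integrable ib => //.
  apply/measurable_EFinP; apply: continuous_measurable_fun => x.
  apply: (cvg_comp (fun x : R => a * x - expR x) expR); last exact: continuous_expR.
  apply: cvgB; last exact: continuous_expR.
  by apply: cvgM; [exact: cvg_cst|exact: cvg_id].
move=> x _ /=; rewrite lee_fin ger0_norm ?expR_ge0// -expRD ger0_norm ?expR_ge0//.
by rewrite ler_expR gamma_exponent_le.
Qed.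

Lemma cintegrable_gamma_kernel s : 0 < complex.Re s ->
  cintegrable setT (gamma_kernel s).
Proof.
move=> s0; apply: cintegrable_le (integrable_gamma_kernel_bound s0).
  exact: ccontinuous_gamma_kernel.
by move=> x; rewrite normc_gamma_kernel.
Qed.

Lemma cGammaE s : cGamma s = cintegral setT (gamma_kernel s).
Proof.
have E (x : R) : cpow (expR x) (s - 1) * (expR (- expR x))%:C * (expR x)%:C =
    gamma_kernel s x.
  rewrite cpowDr cpow_expR cpowNr cpowr1 ?expR_gt0// /gamma_kernel.
  have : (expR x)%:C != 0 by rewrite (inj_eq (@complexI _)) gt_eqF ?expR_gt0.
  by move=> e0; field.
have c1 (x : R) : 0 < x ->
    {for x, continuous (fun t => complex.Re (cpow t (s - 1) * (expR (- t))%:C))} /\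
    {for x, continuous (fun t => complex.Im (cpow t (s - 1) * (expR (- t))%:C))}.
  move=> x0; have [r i] := ccontinuous_gamma_kernel (s - 1).
  have K (t : R) : 0 < t -> cpow t (s - 1) * (expR (- t))%:C =
      gamma_kernel (s - 1) (ln t).
    by move=> t0; rewrite /gamma_kernel lnK ?posrE.
  have near_pos : \forall t \near x, 0 < t by exact: lt_nbhsr.
  split.
    rewrite /prop_for /continuous_at K//.
    have rl : {for x, continuous (fun t => complex.Re (gamma_kernel (s - 1) (ln t)))}.
      apply: (@cvg_comp _ _ _ (@ln R) (fun y => complex.Re (gamma_kernel (s - 1) y)) _
        (nbhs (ln x))); [exact: continuous_ln|exact: r].
    apply: cvg_trans rl; apply: near_eq_cvg.
    by apply: filterS near_pos => t t0; rewrite K.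
  rewrite /prop_for /continuous_at K//.
  have il : {for x, continuous (fun t => complex.Im (gamma_kernel (s - 1) (ln t)))}.
    apply: (@cvg_comp _ _ _ (@ln R) (fun y => complex.Im (gamma_kernel (s - 1) y)) _
      (nbhs (ln x))); [exact: continuous_ln|exact: i].
  apply: cvg_trans il; apply: near_eq_cvg.
  by apply: filterS near_pos => t t0; rewrite K.
have eq_complex2 (p q p' q' : R) : p = p' -> q = q' -> p +i* q = p' +i* q' by move=> -> ->.
apply: eq_complex2; apply: (congr1 (@fine R)).
  rewrite (@integral_itv0y_exp R (fun t => complex.Re _)); last by move=> x /c1[].
  by apply: eq_integral => x _; rewrite -E [in RHS]Re_mul_real.
rewrite (@integral_itv0y_exp R (fun t => complex.Im _)); last by move=> x /c1[].
by apply: eq_integral => x _; rewrite -E [in RHS]Im_mul_real.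
Qed.

(** Replacing [t] by [c t] in Euler's integral is the shift of [x = ln t] by [ln c]. *)
Lemma cintegral_gamma_scale s (c : R) : 0 < c -> 0 < complex.Re s ->
  cintegral setT (fun x => cexp (s * x%:C) * (expR (- (c * expR x)))%:C) =
  cpow c (- s) * cGamma s.
Proof.
move=> c0 s0; rewrite cGammaE -[in RHS](cintegral_shift (ln c)); last first.
  exact: ccontinuous_gamma_kernel.
rewrite -cintegralZl//; last first.
  by apply: cintegrable_shift; [exact: ccontinuous_gamma_kernel|exact: cintegrable_gamma_kernel].
apply: eq_cintegral => x _; rewrite /gamma_kernel /cpow.
rewrite mulrA -cexpD; congr (cexp _ * (expR (- _))%:C).
  by rewrite rmorphD/=; ring.
by rewrite expRD lnK ?posrE// mulrC.
Qed.

Lemma cintegrable_gamma_scale s (c : R) : 0 < c -> 0 < complex.Re s ->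
  cintegrable setT (fun x => cexp (s * x%:C) * (expR (- (c * expR x)))%:C).
Proof.
move=> c0 s0.
have := cintegrableZl (cpow c (- s)) measurableT
  (cintegrable_shift (ln c) (ccontinuous_gamma_kernel s) (cintegrable_gamma_kernel s0)).
suff E x : cpow c (- s) * gamma_kernel s (x + ln c) =
    cexp (s * x%:C) * (expR (- (c * expR x)))%:C by under eq_fun do rewrite E.
rewrite /gamma_kernel /cpow mulrA -cexpD; congr (cexp _ * (expR (- _))%:C).
  by rewrite rmorphD/=; ring.
by rewrite expRD lnK ?posrE// mulrC.
Qed.

Lemma gamma_kernelE (a b x : R) : gamma_kernel (a +i* b) x =
  (expR (a * x - expR x) * cos (b * x)) +i* (expR (a * x - expR x) * sin (b * x)).
Proof.
rewrite /gamma_kernel; have -> : (a +i* b) * x%:C = (a * x) +i* (b * x) by simpc.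
by rewrite cexpE expRD; simpc; congr (_ +i* _); ring.
Qed.

(** The difference [s k_s - k_(s+1)] of the two kernels is the derivative of [exp (s x - exp x)],
    which tends to 0 at both ends; real and imaginary parts are integrated separately. *)
Lemma cGammaS (s : R[i]) : 0 < complex.Re s -> cGamma (s + 1) = s * cGamma s.
Proof.
case: s => a b /= a0.
have a10 : 0 < a + 1 by rewrite addr_gt0.
have i1 := @cintegrable_gamma_kernel (a +i* b) a0.
have i2 := @cintegrable_gamma_kernel ((a + 1) +i* b) a10.
have -> : a +i* b + 1 = (a + 1) +i* b by simpc.
rewrite !cGammaE -cintegralZl//; apply/esym/eqP; rewrite -subr_eq0.
rewrite -cintegralB//; last exact: cintegrableZl.
have E1 x : expR ((a + 1) * x - expR x) = expR (a * x - expR x) * expR x.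
  by rewrite -expRD; congr expR; ring.
have E x : (a +i* b) * gamma_kernel (a +i* b) x - gamma_kernel ((a + 1) +i* b) x =
  (expR (a * x - expR x) * (a - expR x) * cos (b * x) -
    expR (a * x - expR x) * b * sin (b * x)) +i*
  (expR (a * x - expR x) * (a - expR x) * sin (b * x) +
    expR (a * x - expR x) * b * cos (b * x)).
  by rewrite !gamma_kernelE E1; simpc; congr (_ +i* _); ring.
rewrite (eq_cintegral (fun x _ => E x)).
have [c1 c2] := ccontinuousB (ccontinuousM (ccontinuous_cst (a +i* b))
  (ccontinuous_gamma_kernel (a +i* b))) (ccontinuous_gamma_kernel ((a + 1) +i* b)).
have [j1 j2] := cintegrableB measurableT (cintegrableZl (a +i* b) measurableT i1) i2.
move: c1 c2 j1 j2; under eq_fun do rewrite E/=; move=> c1.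
under eq_fun do rewrite E/=; move=> c2 j1 j2.
have bound x : expR (a * x - expR x) <= expR (4%:R * a ^+ 2) * expR (- (a * `|x|)).
  by rewrite -expRD ler_expR gamma_exponent_le.
have z1 : (\int[mu]_x ((expR (a * x - expR x) * (a - expR x) * cos (b * x) -
    expR (a * x - expR x) * b * sin (b * x))%:E) = 0)%E.
  have [ty tNy] := @tail_cvg0 R (fun x => expR (a * x - expR x) * cos (b * x)) _ _ a0
    (fun x => le_trans (ler_norm_mul_cos (b * x) (expR_ge0 _)) (bound x)).
  apply: (@integral_derivativeT R (fun x => expR (a * x - expR x) * cos (b * x))) => //.
  by move=> x; apply: is_derive_eq; rewrite /GRing.scale/=; ring.
have z2 : (\int[mu]_x ((expR (a * x - expR x) * (a - expR x) * sin (b * x) +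
    expR (a * x - expR x) * b * cos (b * x))%:E) = 0)%E.
  have [ty tNy] := @tail_cvg0 R (fun x => expR (a * x - expR x) * sin (b * x)) _ _ a0
    (fun x => le_trans (ler_norm_mul_sin (b * x) (expR_ge0 _)) (bound x)).
  apply: (@integral_derivativeT R (fun x => expR (a * x - expR x) * sin (b * x))) => //.
  by move=> x; apply: is_derive_eq; rewrite /GRing.scale/=; ring.
by rewrite /cintegral /Rintegral /= z1 z2.
Qed.

End Gamma.

(** * Absence of zeros of Gamma in the right half-plane *)

Section GammaNonvanishing.
Context {R : realType}.
Notation mu := (@lebesgue_measure R).

Let h (a x : R) := expR (a * x - expR x).
Let g (a : R) := Rintegral mu setT (h a).

Let gE (a : R) : g a = complex.Re (cGamma a%:C).
Proof.
rewrite cGammaE; apply: eq_Rintegral => x _.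
by rewrite gamma_kernelE mul0r cos0 mulr1.
Qed.

Let gS (a : R) : 0 < a -> g (a + 1) = a * g a.
Proof.
move=> a0; rewrite !gE; have := @cGammaS R a%:C a0.
have -> : (a + 1)%:C = a%:C + 1 by rewrite rmorphD.
move=> ->.
by rewrite cmulE /= mul0r subr0.
Qed.

Let ih (a : R) : 0 < a -> mu.-integrable setT (EFin \o h a).
Proof. exact: integrable_gamma_kernel_bound. Qed.

Let g_gt0 (a : R) : 0 < a -> 0 < g a.
Proof.
move=> a0.
have h0 x : 0 <= h a x by exact: expR_ge0.
have fin : (\int[mu]_x (h a x)%:E)%E \is a fin_num.
  by apply: integrable_fin_num => //; exact: ih.
rewrite -lte_fin /g /Rintegral fineK//.
have m01 : mu `[0, 1]%classic = 1%E.
  by rewrite lebesgue_measure_itv/= lte_fin ltr01 oppr0 adde0.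
apply: (@lt_le_trans _ _ (\int[mu]_(x in `[0%R, 1%R]) (expR (- expR 1))%:E)%E).
  by rewrite integral_cst//= m01 mule1 lte_fin expR_gt0.
apply: (@le_trans _ _ (\int[mu]_(x in `[0%R, 1%R]) (h a x)%:E)%E).
  apply: ge0_le_integral => //.
  - by apply: measurable_funTS; exact: (measurable_int _ (ih a0)).
  move=> x /=; rewrite in_itv/= => /andP[x0 x1]; rewrite lee_fin ler_expR.
  by rewrite -[leLHS]add0r lerD ?mulr_ge0 ?(ltW a0)// lerN2 ler_expR.
apply: ge0_subset_integral => //; first exact: (measurable_int _ (ih a0)).
by move=> x _; rewrite lee_fin.
Qed.

(* Gamma (a + i b) is the integral of h a x * exp (i b x), where the weight h a x has most of its mass
   near x = ln a: there b (x - ln a) is small, so that rotating by exp (- i b ln a) gives a positive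
   real part, by the bound 1 - x^2 / 2 <= cos x. *)
Let cGamma_neq0_concentrated (a b : R) : 1 < a -> b ^+ 2 < 2%:R * (a - 1) ->
  cGamma (a +i* b) != 0.
Proof.
move=> a1 ba; apply/eqP => G0.
have a0 : 0 < a by rewrite (lt_trans _ a1).
have a10 : 0 < a - 1 by rewrite subr_gt0.
have a20 : 0 < a + 1 by rewrite addr_gt0.
pose l := ln a; pose k := cexp (0 +i* - (b * l)).
have ig := @cintegrable_gamma_kernel R (a +i* b) a0.
have kint : complex.Re (cintegral setT (fun x => k * gamma_kernel (a +i* b) x)) = 0.
  by rewrite cintegralZl// -cGammaE G0 mulr0.
have kE x : complex.Re (k * gamma_kernel (a +i* b) x) = h a x * cos (b * (x - l)).
  rewrite /k cexpE gamma_kernelE expR0 !mul1r; simpc => /=.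
  rewrite cosN sinN mulrBr cosB -/(h a x); ring.
(* Bounding [(x - l)^2] by [exp (x - l) + exp (l - x) - 2], with [exp l = a], leaves a combination
   of [h a], [h (a + 1)] and [h (a - 1)] with these coefficients. Its integral is a combination of
   real Gamma values, all multiples of [g (a - 1)]; the resulting factor [a - 1 - b^2 / 2] is the
   origin of the hypothesis on [b]. *)
pose c1 := 1 + b ^+ 2; pose c2 := b ^+ 2 / 2%:R / a; pose c3 := b ^+ 2 / 2%:R * a.
have minor x : c1 * h a x - c2 * h (a + 1) x - c3 * h (a - 1) x <= h a x * cos (b * (x - l)).
  have e1 : h (a + 1) x = h a x * expR x by rewrite /h -expRD; congr expR; ring.
  have e2 : h (a - 1) x = h a x * expR (- x) by rewrite /h -expRD; congr expR; ring.
  have -> : c1 * h a x - c2 * h (a + 1) x - c3 * h (a - 1) x =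
      h a x * (1 - b ^+ 2 * (expR (x - l) + expR (- (x - l)) - 2%:R) / 2%:R).
    rewrite e1 e2 opprB expRD expRN [expR (l - x)]expRD expRN /l lnK ?posrE// /c1 /c2 /c3.
    rewrite !expRN; have : expR x != 0 by rewrite gt_eqF ?expR_gt0.
    by move=> ex0; field; rewrite ex0 gt_eqF.
  rewrite ler_pM2l ?expR_gt0// (le_trans _ (cos_ge1B _))//.
  rewrite lerD2l lerN2 ler_pM2r ?invr_gt0// exprMn ler_wpM2l ?sqr_ge0//.
  exact: sqr_le_expR.
have i1 := integrableZl_EFin c1 measurableT (ih a0).
have i2 := integrableZl_EFin c2 measurableT (ih a20).
have i3 := integrableZl_EFin c3 measurableT (ih a10).
have i12 : mu.-integrable setT (EFin \o (fun x => c1 * h a x - c2 * h (a + 1) x)).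
  by apply: (fun m => integrableB m i1 i2).
have i123 : mu.-integrable setT
    (EFin \o (fun x => c1 * h a x - c2 * h (a + 1) x - c3 * h (a - 1) x)).
  by apply: (fun m => integrableB m i12 i3).
have ik : mu.-integrable setT (EFin \o (fun x => h a x * cos (b * (x - l)))).
  have [i _] := cintegrableZl k measurableT ig.
  by move: i; under eq_fun do rewrite kE.
have := @le_Rintegral _ _ _ mu setT _ _ measurableT i123 ik (fun x _ => minor x).
have -> : Rintegral mu setT (fun x => h a x * cos (b * (x - l))) = 0.
  by rewrite -kint Re_cintegral; apply: eq_Rintegral => x _; rewrite kE.
rewrite RintegralB// RintegralB// !RintegralZl//; try exact: ih.
rewrite -/(g a) -/(g (a + 1)) -/(g (a - 1)).
have gaE : g a = (a - 1) * g (a - 1) by have := gS a10; rewrite subrK.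
rewrite (gS a0) gaE.
have g0 := g_gt0 a10.
have -> : c1 * ((a - 1) * g (a - 1)) - c2 * (a * ((a - 1) * g (a - 1))) - c3 * g (a - 1)
   = g (a - 1) * (a - 1 - b ^+ 2 / 2%:R).
  by rewrite /c1 /c2 /c3; field; rewrite gt_eqF.
rewrite leNgt mulr_gt0//; lra.
Qed.

(** Adding integers keeps the imaginary part and increases the real part, so the concentrated case
    is eventually reached; the functional equation carries nonvanishing back to [s]. *)
Lemma cGamma_neq0 (s : R[i]) : 0 < complex.Re s -> cGamma s != 0.
Proof.
move=> s0.
have down n (t : R[i]) : 0 < complex.Re t -> cGamma (t + n%:R) != 0 -> cGamma t != 0.
  elim: n t => [|n IH] t t0; first by rewrite addr0.
  rewrite -natr1 addrA cGammaS; last first.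
    have -> : complex.Re (t + n%:R) = complex.Re t + n%:R.
      by rewrite -(rmorph_nat (real_complex R)); case: (t).
    by rewrite ltr_wpDr.
  by rewrite mulf_eq0 negb_or => /andP[_]; exact: IH.
have [n nb] : exists n : nat, (complex.Im s) ^+ 2 < 2%:R * n%:R :> R.
  exists (Num.truncn ((complex.Im s) ^+ 2)).+1.
  have := truncnS_gt ((complex.Im s) ^+ 2); have := sqr_ge0 (complex.Im s); lra.
apply: (down n.+1 s s0).
have -> : s + n.+1%:R = (complex.Re s + n.+1%:R) +i* complex.Im s.
  by rewrite -(rmorph_nat (real_complex R)); case: (s) => a b; simpc.
apply: cGamma_neq0_concentrated.
  by rewrite -natr1 addrA ltr_pwDl// ltr_wpDr.
rewrite -natr1; lra.
Qed.

End GammaNonvanishing.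

(** * The integral of a power of cosh *)

Section CoshIntegral.
Context {R : realType}.
Notation mu := (@lebesgue_measure R).

Let sinh (u : R) := (expR u - expR (- u)) / 2%:R.

Lemma ccontinuous_cpow_cosh (s : R[i]) : ccontinuous (fun u => cpow (Defs.cosh u) s).
Proof.
apply: ccontinuous_cexp; apply: ccontinuousM; first exact: ccontinuous_cst.
apply: ccontinuous_real => x; apply: (cvg_comp (@Defs.cosh R) (@ln R)).
  exact: continuous_cosh.
exact/continuous_ln/cosh_gt0.
Qed.

Lemma cintegrable_cpow_cosh (s : R[i]) : 0 < complex.Re s ->
  cintegrable setT (fun u => cpow (Defs.cosh u) (- s)).
Proof.
move=> s0; apply: cintegrable_le (integrableZl_EFin (expR (complex.Re s * ln 2%:R))
  measurableT (integrable_expR_Nabs s0)); first exact: ccontinuous_cpow_cosh.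
move=> u; rewrite normc_cpow -expRD ler_expR.
have -> : complex.Re (- s) = - complex.Re s by case: (s).
have : `|u| - ln 2%:R <= ln (Defs.cosh u).
  rewrite -[X in X - _]expRK -ln_div ?posrE ?expR_gt0//.
  by rewrite ler_ln ?posrE ?cosh_gt0 ?divr_gt0 ?expR_gt0// cosh_ge.
nra.
Qed.

(** With [x = exp (v/2) sinh u] and [cosh^2 = 1 + sinh^2], the integrand becomes
    [exp (- exp v) exp (- v/2)] times the Gaussian [exp (- x^2) dx] over the line. *)
Lemma integral_gauss_sinh (v : R) :
  (\int[mu]_u (expR (- (Defs.cosh u ^+ 2 * expR v)) * Defs.cosh u)%:E =
   (expR (- expR v) * expR (- (v / 2%:R)) * Num.sqrt pi)%:E)%E.
Proof.
pose e := expR (v / 2%:R); have e0 : 0 < e by exact: expR_gt0.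
have e2 : e ^+ 2 = expR v.
  by rewrite -expRM_natl; congr expR; field.
have dF (u : R) : is_derive u 1 (fun u => e * sinh u) (e * Defs.cosh u).
  by rewrite /sinh /Defs.cosh; apply: is_derive_eq; rewrite /GRing.scale/=; ring.
have cs : continuous (fun u : R => e * sinh u).
  by move=> u; apply/differentiable_continuous/derivable1_diffP; exact: ex_derive.
have cf : continuous (fun u : R => e * Defs.cosh u).
  by move=> u; apply: cvgM; [exact: cvg_cst|exact: continuous_cosh].
have cover : [set: R] = \bigcup_n `[e * sinh (- n%:R), e * sinh n%:R]%classic.
  apply/seteqP; split=> // x _.
  have : [set: R] (x / e) by []; rewrite -bigcup_itvNnn => -[n _ /=].
  rewrite !in_itv/= => /andP[nx xn]; exists n => //=.
  have ns : n%:R <= sinh n%:R.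
    by rewrite /sinh ler_pdivlMr// mulrC expRB_ge.
  have sN : sinh (- n%:R) = - sinh n%:R by rewrite /sinh opprK; ring.
  have h1 : - n%:R * e <= x by rewrite -ler_pdivlMr.
  have h2 : x <= n%:R * e by rewrite -ler_pdivrMr.
  have h3 : n%:R * e <= sinh n%:R * e by rewrite ler_wpM2r// ltW.
  by rewrite in_itv/= sN; apply/andP; split; lra.
rewrite EFinM.
have -> : (Num.sqrt pi)%:E = (\int[mu]_x (gauss_fun (e * sinh x) * (e * Defs.cosh x))%:E)%E :> \bar R.
  by rewrite -(ge0_integral_substitution dF cf (fun u => mulr_gt0 e0 (cosh_gt0 u)) cover)
    ?integralT_gauss// => x _; [exact: continuous_gauss_fun|exact: gauss_fun_ge0].
pose k := expR (- expR v) * expR (- (v / 2%:R)); have k0 : 0 <= k by rewrite mulr_ge0 ?expR_ge0.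
rewrite -/k -ge0_integralZl_EFin//; first last.
- apply/measurable_EFinP; apply: continuous_measurable_fun => u; apply: cvgM; last exact: cf.
  apply: (cvg_comp (fun u => e * sinh u) gauss_fun); last exact: continuous_gauss_fun.
  exact: cs.
- by move=> u _; rewrite lee_fin mulr_ge0 ?gauss_fun_ge0// mulr_ge0 ?(ltW e0) ?(ltW (cosh_gt0 _)).
apply: eq_integral => u _; rewrite -EFinM; congr EFin.
have kE : k * e = expR (- expR v) by rewrite /k -mulrA -expRD addNr expR0 mulr1.
have -> : k * (gauss_fun (e * sinh u) * (e * Defs.cosh u)) =
    k * e * gauss_fun (e * sinh u) * Defs.cosh u by ring.
rewrite kE; congr (_ * _).
rewrite /gauss_fun -expRD; congr expR.
have -> : (e * sinh u) ^+ 2 = expR v * sinh u ^+ 2 by rewrite -e2; ring.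
by rewrite cosh2D1 /sinh; ring.
Qed.

(** The double integral of [exp (a v) exp (- cosh^2 u exp v) cosh u], with [a = (s + 1) / 2], is
    evaluated in both orders. In [v] first it is a Gamma integral scaled by [cosh^2 u], giving
    [Gamma (a) cosh^(1 - 2 a) u], and [1 - 2 a = - s]. In [u] first it is a Gaussian, leaving
    [sqrt pi] times the kernel of [Gamma (s/2)]. *)
Lemma cintegral_cpow_cosh (s : R[i]) : 0 < complex.Re s ->
  cGamma ((s + 1) / 2%:R) * cintegral setT (fun u => cpow (Defs.cosh u) (- s)) =
  (Num.sqrt pi)%:C * cGamma (s / 2%:R).
Proof.
move=> s0; set a := (s + 1) / 2%:R.
have half (t : R[i]) : complex.Re (t / 2%:R) = complex.Re t / 2%:R.
  by rewrite -(rmorph_nat (real_complex R)) -fmorphV Re_mul_real.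
have Re1 : complex.Re (s + 1) = complex.Re s + 1 by case: (s).
have a0 : 0 < complex.Re a by rewrite half Re1; lra.
have aE : a = s / 2%:R + 2%:R^-1 by rewrite /a; field.
pose f u v := cexp (a * v%:C) * (expR (- (Defs.cosh u ^+ 2 * expR v)) * Defs.cosh u)%:C.
pose g (u v : R) := expR (complex.Re a * v) * (expR (- (Defs.cosh u ^+ 2 * expR v)) * Defs.cosh u).
have mcosh1 : measurable_fun setT (fun xy : R * R => Defs.cosh xy.1).
  by apply: measurableT_comp; [exact: (continuous_measurable_fun continuous_cosh)|exact: measurable_fst].
have mcosh : measurable_fun setT (fun xy : R * R =>
    expR (- (Defs.cosh xy.1 ^+ 2 * expR xy.2)) * Defs.cosh xy.1).
  apply: measurable_funM => //; apply: measurableT_comp => //.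
  apply: measurableT_comp => //; apply: measurable_funM.
    exact: measurable_funX.
  by apply: measurableT_comp; [exact: measurable_expR|exact: measurable_snd].
have [ce1 ce2] := ccontinuous_cexp_lin a.
have mg : measurable_fun setT (fun xy : R * R => g xy.1 xy.2).
  apply: measurable_funM => //; apply: measurableT_comp => //.
  apply: measurable_funM => //; exact: measurable_snd.
have mRe : measurable_fun setT (fun xy : R * R => complex.Re (f xy.1 xy.2)).
  under eq_fun do rewrite Re_mul_real; apply: measurable_funM => //.
  exact: (measurableT_comp (continuous_measurable_fun ce1) (@measurable_snd _ _ _ _)).
have mIm : measurable_fun setT (fun xy : R * R => complex.Im (f xy.1 xy.2)).
  under eq_fun do rewrite Im_mul_real; apply: measurable_funM => //.
  exact: (measurableT_comp (continuous_measurable_fun ce2) (@measurable_snd _ _ _ _)).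
have c0 u v : 0 <= expR (- (Defs.cosh u ^+ 2 * expR v)) * Defs.cosh u :> R.
  by rewrite mulr_ge0 ?expR_ge0// ltW ?cosh_gt0.
have fg u v : Normc.normc (f u v) <= g u v.
  by rewrite Normc.normcM normc_cexp Re_mul_real normc_real ger0_norm.
have igauss v : mu.-integrable setT
    (EFin \o (fun u => expR (- (Defs.cosh u ^+ 2 * expR v)) * Defs.cosh u)).
  apply/integrableP; split.
    apply/measurable_EFinP; apply: continuous_measurable_fun => u.
    apply: cvgM; last exact: continuous_cosh.
    apply: (cvg_comp (fun u => - (Defs.cosh u ^+ 2 * expR v)) expR); last exact: continuous_expR.
    apply: cvgN; apply: cvgM; last exact: cvg_cst.
    by apply: cvgM; exact: continuous_cosh.
  under eq_integral do rewrite gee0_abs ?lee_fin ?c0//.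
  by rewrite integral_gauss_sinh ltry.
have s20 : 0 < complex.Re (s / 2%:R) by rewrite half divr_gt0.
(* For the majorant the inner integral is again the Gaussian one, and what remains is a multiple of
   the real Gamma integral at [Re s / 2 > 0]. *)
have gint : (\int[mu]_v \int[mu]_u (g u v)%:E < +oo)%E.
  have E v : (\int[mu]_u (g u v)%:E =
      (Num.sqrt pi)%:E * (expR (complex.Re (s / 2%:R) * v - expR v))%:E)%E.
    transitivity ((expR (complex.Re a * v))%:E *
        \int[mu]_u (expR (- (Defs.cosh u ^+ 2 * expR v)) * Defs.cosh u)%:E)%E.
      under eq_integral do rewrite EFinM.
      by apply: ge0_integralZl_EFin => //; first [move=> u _; rewrite lee_fin; exact: c0
        |exact: (measurable_int _ (igauss v))|exact: expR_ge0].
    rewrite integral_gauss_sinh -!EFinM; congr EFin.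
    have -> : expR (complex.Re a * v) * (expR (- expR v) * expR (- (v / 2%:R)) * Num.sqrt pi) =
      Num.sqrt pi * (expR (complex.Re a * v) * expR (- expR v) * expR (- (v / 2%:R))) by ring.
    congr (_ * _).
    by rewrite -!expRD half half Re1; congr expR; field.
  under eq_integral do rewrite E.
  rewrite integralZl//; last exact: integrable_gamma_kernel_bound.
  by rewrite lte_mul_pinfty// ?lee_fin ?sqrtr_ge0//; apply: integrable_lty => //; exact: integrable_gamma_kernel_bound.
have fE1 u v : f u v = cexp (a * v%:C) * (expR (- (Defs.cosh u ^+ 2 * expR v)))%:C * (Defs.cosh u)%:C.
  by rewrite /f rmorphM mulrA.
have i1 u : cintegrable setT (fun v => cexp (a * v%:C) * (expR (- (Defs.cosh u ^+ 2 * expR v)))%:C).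
  exact: (cintegrable_gamma_scale (exprn_gt0 2 (cosh_gt0 u)) a0).
have fu u : cintegrable setT (f u).
  have := cintegrableZl (Defs.cosh u)%:C measurableT (i1 u).
  by under eq_fun do rewrite mulrC -fE1.
have fv v : cintegrable setT (f ^~ v).
  apply: (@cintegrable_le _ _ (g ^~ v)) => //.
    apply: ccontinuousM; first exact: ccontinuous_cst.
    apply: ccontinuous_real => u; apply: cvgM; last exact: continuous_cosh.
    apply: (cvg_comp (fun u => - (Defs.cosh u ^+ 2 * expR v)) expR); last exact: continuous_expR.
    apply: cvgN; apply: cvgM; last exact: cvg_cst.
    by apply: cvgM; exact: continuous_cosh.
  exact: integrableZl_EFin.
have := cintegral_fubini mRe mIm mg fg gint fu fv.
have L u : cintegral setT (f u) = cGamma a * cpow (Defs.cosh u) (- s).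
  under eq_cintegral => v _ do rewrite fE1.
  rewrite cintegralZr// cintegral_gamma_scale ?exprn_gt0 ?cosh_gt0//.
  rewrite expr2 cpowM ?cosh_gt0// -cpowDr (mulrC _ (cGamma a)) -mulrA; congr (_ * _).
  rewrite -[X in _ * X](cpowr1 (cosh_gt0 u)) -cpowDr; congr cpow.
  by rewrite /a; field.
have Rr v : cintegral setT (f ^~ v) = (Num.sqrt pi)%:C * gamma_kernel (s / 2%:R) v.
  rewrite cintegralZl//; last by split; [exact: igauss|exact: integrable0].
  rewrite cintegral_real /Rintegral integral_gauss_sinh.
  have -> : cexp (a * v%:C) = cexp (s / 2%:R * v%:C) * (expR (v / 2%:R))%:C.
    rewrite -cexp_real -cexpD aE mulrDl; congr (cexp (_ + _)).
    by rewrite -(rmorph_nat (real_complex R)) -fmorphV -rmorphM mulrC.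
  have e1 : (expR (v / 2%:R))%:C * (expR (- (v / 2%:R)))%:C = 1 :> R[i].
    by rewrite -rmorphM -expRD subrr expR0.
  rewrite -[RHS]mul1r -e1 /gamma_kernel [fine _]/= !rmorphM.
  by ring.
rewrite (eq_cintegral (fun u _ => L u)) (eq_cintegral (fun v _ => Rr v)).
rewrite (cintegralZl _ measurableT (cintegrable_cpow_cosh s0)) => ->.
by rewrite (cintegralZl _ measurableT (cintegrable_gamma_kernel s20)) -cGammaE.
Qed.

End CoshIntegral.

(** * SL_2(Z) and quadratic forms *)

Section IntegralMatrices.

Lemma det_mx22 (K : comNzRingType) (M : 'M[K]_2) :
  \det M = M 0 0 * M 1 1 - M 0 1 * M 1 0.
Proof.
rewrite (expand_det_row _ 0) !big_ord_recl big_ord0 addr0 /cofactor !det_mx11 !mxE.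
have -> : lift ord0 (ord0 : 'I_1) = 1 :> 'I_2 by exact/val_inj.
have -> : lift (1 : 'I_2) (0 : 'I_1) = 0 :> 'I_2 by exact/val_inj.
by rewrite /= expr0 expr1 mul1r mulN1r mulrN.
Qed.

Lemma SL2ZP (g : 'M[int]_2) : SL2Z g <-> g 0 0 * g 1 1 - g 0 1 * g 1 0 = 1.
Proof. by rewrite /SL2Z /= det_mx22. Qed.

Lemma SL2Z_mul (g h : 'M[int]_2) : SL2Z g -> SL2Z h -> SL2Z (g *m h).
Proof. by rewrite /SL2Z /= det_mulmx => -> ->; rewrite mulr1. Qed.

Lemma SL2Z_opp (g : 'M[int]_2) : SL2Z g -> SL2Z (- g).
Proof. by move=> /SL2ZP h; apply/SL2ZP; rewrite !mxE !mulrNN. Qed.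

Lemma SL2Z_unit (g : 'M[int]_2) : SL2Z g -> g \is a GRing.unit.
Proof.
move=> h; suff : g \in unitmx by [].
by rewrite unitmxE (h : \det g = 1) unitr1.
Qed.

Lemma SL2Z_inv (g : 'M[int]_2) : SL2Z g -> SL2Z (g^-1 : 'M[int]_2).
Proof.
move=> h; have := congr1 determinant (mulmxV (SL2Z_unit h)).
by rewrite det_mulmx det1 (h : \det g = 1) mul1r.
Qed.

Lemma SL2Z_expz (g : 'M[int]_2) (n : int) : SL2Z g -> SL2Z (g ^ n).
Proof.
move=> hg; have hn (m : nat) : SL2Z (g ^+ m).
  elim: m => [|m IH]; first by rewrite expr0 /SL2Z/= det1.
  by rewrite exprS; exact: SL2Z_mul.
case: n => n; first exact: hn.
by rewrite NegzE -exprnN; apply: SL2Z_inv; exact: hn.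
Qed.

Lemma qcompA (Q : qform) (g h : 'M[int]_2) :
  qcomp (qcomp Q g) h = qcomp Q (g *m h).
Proof.
case: Q => [[A B] C]; rewrite /qcomp !mxE !big_ord_recl !big_ord0 !addr0.
have -> : lift ord0 (ord0 : 'I_1) = 1 :> 'I_2 by exact/val_inj.
by congr (_, _, _); ring.
Qed.

Lemma qcomp1 (Q : qform) : qcomp Q 1 = Q.
Proof.
case: Q => [[A B] C]; rewrite /qcomp !mxE /=.
by congr (_, _, _); ring.
Qed.

Lemma qcompN (Q : qform) (g : 'M[int]_2) : qcomp Q (- g) = qcomp Q g.
Proof. by case: Q => [[A B] C]; rewrite /qcomp !mxE; congr (_, _, _); ring. Qed.

Lemma qcomp_fixform (g : 'M[int]_2) : SL2Z g -> qcomp (fixform g) g = fixform g.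
Proof.
move=> /SL2ZP; rewrite /fixform /qcomp.
set a := g 0 0; set b := g 0 1; set c := g 1 0; set d := g 1 1 => h.
have lc (x y k : int) : x - y = k * (a * d - b * c - 1) -> x = y.
  by rewrite h subrr mulr0 => /eqP; rewrite subr_eq0 => /eqP.
congr (_, _, _).
- by apply: (lc _ _ c); ring.
- by apply: (lc _ _ (d - a)); ring.
- by apply: (lc _ _ (- b)); ring.
Qed.

Lemma qcomp_fixform_expz (g : 'M[int]_2) (n : int) : SL2Z g ->
  qcomp (fixform g) (g ^ n) = fixform g.
Proof.
move=> hg; have hn (m : nat) : qcomp (fixform g) (g ^+ m) = fixform g.
  elim: m => [|m IH]; first exact: qcomp1.
  by rewrite exprS -[_ * _]/(_ *m _) -qcompA qcomp_fixform.
case: n => n; first exact: hn.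
rewrite NegzE -exprnN -{1}(hn n.+1) qcompA.
have u : g ^+ n.+1 \is a GRing.unit by rewrite unitrX// SL2Z_unit.
by rewrite (mulmxV u) qcomp1.
Qed.

(** The conclusions say that [fixform h] is proportional to [fixform g]: a matrix preserving the
    form has the same fixed points. *)
Lemma fixform_stabilizer (g h : 'M[int]_2) : SL2Z h ->
  qcomp (fixform g) h = fixform g ->
  g 1 0 * (h 0 0 - h 1 1) = h 1 0 * (g 0 0 - g 1 1) /\
  g 1 0 * h 0 1 = h 1 0 * g 0 1.
Proof.
move=> /SL2ZP; rewrite /fixform /qcomp.
set a := g 0 0; set b := g 0 1; set c := g 1 0; set d := g 1 1.
set p := h 0 0; set q := h 0 1; set k := h 1 0; set l := h 1 1 => det.
case=> e1 e2 _.
(* Each conclusion is certified by an explicit combination, with coefficients [k1], [k2], [k3], of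
   the hypotheses. Over the integers the combination yields twice the equation, and the 2 is
   cancelled. *)
have lc (x y k1 k2 k3 : int) : 2%:R * x - 2%:R * y =
    k1 * (c * p ^+ 2 + (d - a) * p * k + - b * k ^+ 2 - c) +
    k2 * (2%:R * c * p * q + (d - a) * (p * l + q * k) + 2%:R * - b * k * l - (d - a)) +
    k3 * (p * l - q * k - 1) -> x = y.
  rewrite e1 e2 det !subrr !mulr0 !addr0 -mulrBr => /eqP.
  by rewrite mulf_eq0 /= subr_eq0 => /eqP.
split.
  by apply: (lc _ _ (2%:R * l) (- k) (- (2%:R * c * p + (d - a) * k))); ring.
by apply: (lc _ _ (- (2%:R * q)) p (- ((d - a) * p - 2%:R * b * k))); ring.
Qed.

End IntegralMatrices.

Local Arguments qcomp : simpl never.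

(** * The axis of a hyperbolic element *)

Section HyperbolicDynamics.
Context {R : realType}.
Implicit Types (g h : 'M[int]_2) (w x : R) (z : R[i]).

(* |(1, -w) g (z, 1)^T|^2 *)
Definition rownorm w z g : R :=
  (((g 0 0)%:~R - w * (g 1 0)%:~R) * complex.Re z + ((g 0 1)%:~R - w * (g 1 1)%:~R)) ^+ 2
  + (((g 0 0)%:~R - w * (g 1 0)%:~R) * complex.Im z) ^+ 2.

Lemma mulmx22 (K : pzSemiRingType) (M N : 'M[K]_2) (i j : 'I_2) :
  (M *m N) i j = M i 0 * N 0 j + M i 1 * N 1 j.
Proof.
rewrite mxE !big_ord_recl big_ord0 addr0.
by have -> : lift ord0 (ord0 : 'I_1) = 1 :> 'I_2 by exact/val_inj.
Qed.

Lemma rownormN w z g : rownorm w z (- g) = rownorm w z g.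
Proof. by rewrite /rownorm !mxE !rmorphN /=; ring. Qed.

(** The hypotheses say that the row [(1, -w)] is a left eigenvector of [g] with eigenvalue [k]. *)
Lemma rownorm_mul w z k g h : (g 0 0)%:~R - w * (g 1 0)%:~R = k ->
  (g 0 1)%:~R - w * (g 1 1)%:~R = - (w * k) ->
  rownorm w z (g *m h) = k ^+ 2 * rownorm w z h.
Proof.
move=> e1 e2; rewrite /rownorm !mulmx22 !rmorphD !rmorphM /=.
have -> : forall p q : R, (g 0 0)%:~R * p + (g 0 1)%:~R * q -
    w * ((g 1 0)%:~R * p + (g 1 1)%:~R * q) = k * (p - w * q).
  move=> p q; have -> : (g 0 0)%:~R = k + w * (g 1 0)%:~R by rewrite -e1; ring.
  have -> : (g 0 1)%:~R = - (w * k) + w * (g 1 1)%:~R by rewrite -e2; ring.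
  by ring.
have -> : forall p q : R, (g 0 0)%:~R * p + (g 0 1)%:~R * q -
    w * ((g 1 0)%:~R * p + (g 1 1)%:~R * q) = k * (p - w * q).
  move=> p q; have -> : (g 0 0)%:~R = k + w * (g 1 0)%:~R by rewrite -e1; ring.
  have -> : (g 0 1)%:~R = - (w * k) + w * (g 1 1)%:~R by rewrite -e2; ring.
  by ring.
by ring.
Qed.

Lemma rownorm_gt0 w z g : SL2Z g -> 0 < complex.Im z -> 0 < rownorm w z g.
Proof.
move=> /SL2ZP det y0; rewrite /rownorm.
set p : R := (g 0 0)%:~R - _; set q : R := (g 0 1)%:~R - _.
have [p0|p0] := eqVneq p 0.
  have [q0|q0] := eqVneq q 0.
    have : (g 0 0 * g 1 1 - g 0 1 * g 1 0)%:~R = 0 :> R.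
      rewrite rmorphB !rmorphM /=.
      have -> : (g 0 0)%:~R = w * (g 1 0)%:~R :> R by apply/eqP; rewrite -subr_eq0 -/p p0.
      have -> : (g 0 1)%:~R = w * (g 1 1)%:~R :> R by apply/eqP; rewrite -subr_eq0 -/q q0.
      by ring.
    by rewrite det => /eqP; rewrite oner_eq0.
  by rewrite p0 mul0r add0r mul0r expr0n addr0 exprn_even_gt0.
by rewrite ltr_wpDl ?sqr_ge0// exprn_even_gt0//= mulf_neq0// gt_eqF.
Qed.

(** [axisD] and [axisM] are Vieta's formulas, so that [Q_gamma = c (X - w Y) (X - w' Y)] over the
    reals. The fixed points thus enter polynomially, and not through a square root of the
    discriminant. *)
Record axis (gamma : 'M[int]_2) (w w' : R) := Axis {
  axisSL : SL2Z gamma ;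
  axis_c : 0 < (gamma 1 0)%:~R :> R ;
  axis_lt : w' < w ;
  axisD : (gamma 1 0)%:~R * (w + w') = (gamma 0 0)%:~R - (gamma 1 1)%:~R ;
  axisM : (gamma 1 0)%:~R * (w * w') = - (gamma 0 1)%:~R ;
  axis_tr : 2%:R < (gamma 0 0)%:~R + (gamma 1 1)%:~R :> R }.

Lemma hyperbolic_axis (gamma : 'M[int]_2) w w' : SL2Z gamma ->
  fixes gamma w -> fixes gamma w' -> w' < w -> 0 < qsgn (fixform gamma) ->
  2%:R < \tr gamma -> axis gamma w w'.
Proof.
move=> sl [j1 f1] [j2 f2] ww' sg tr.
have c0 : 0 < (gamma 1 0)%:~R :> R by move: sg; rewrite /qsgn /= sgr_gt0 ltr0z.
have quad x : (gamma 1 0)%:~R * x + (gamma 1 1)%:~R != 0 -> mobius gamma x = x ->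
   (gamma 1 0)%:~R * x ^+ 2 + ((gamma 1 1)%:~R - (gamma 0 0)%:~R) * x - (gamma 0 1)%:~R = 0.
  rewrite /mobius => j0 /eqP; rewrite eq_sym -subr_eq0 => /eqP e.
  have := congr1 ( *%R ((gamma 1 0)%:~R * x + (gamma 1 1)%:~R)) e; rewrite mulr0 => <-.
  by field.
have q1 := quad _ j1 f1; have q2 := quad _ j2 f2.
have D : (gamma 1 0)%:~R * (w + w') = (gamma 0 0)%:~R - (gamma 1 1)%:~R.
  apply: (@mulIf _ (w - w')); first by rewrite subr_eq0 gt_eqF.
  apply/eqP; rewrite -subr_eq0 -(subr0 0) -{1}q1 -q2; apply/eqP; ring.
split=> //.
- have -> : - (gamma 0 1)%:~R = (gamma 1 0)%:~R * (w + w') * w - (gamma 1 0)%:~R * w ^+ 2 :> R.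
    by rewrite D -[LHS](subr0 _) -q1; ring.
  by ring.
- move: tr; rewrite /mxtrace !big_ord_recl big_ord0 addr0.
  have -> : lift ord0 (ord0 : 'I_1) = 1 :> 'I_2 by exact/val_inj.
  by rewrite -rmorphD/= -(ltr_int R) /= => h; move: h.
Qed.

Section Axis.
Variables (gamma : 'M[int]_2) (w w' : R).
Hypothesis ax : axis gamma w w'.

Let a : R := (gamma 0 0)%:~R.
Let b : R := (gamma 0 1)%:~R.
Let c : R := (gamma 1 0)%:~R.
Let d : R := (gamma 1 1)%:~R.
Let eps := c * w + d.

Let detR : a * d - b * c = 1.
Proof. by have /SL2ZP h := axisSL ax; rewrite /a /b /c /d -!rmorphM -rmorphB h. Qed.

Let D : c * (w + w') = a - d. Proof. exact: axisD. Qed.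
Let M : c * (w * w') = - b. Proof. exact: axisM. Qed.
Let c0 : 0 < c. Proof. exact: axis_c ax. Qed.
Let ww' : w' < w. Proof. exact: axis_lt ax. Qed.

Lemma axis_epsV : (c * w + d) * (c * w' + d) = 1.
Proof.
rewrite -detR.
have -> : (c * w + d) * (c * w' + d) = c * (c * (w * w')) + d * (c * (w + w')) + d ^+ 2 by ring.
by rewrite M D; ring.
Qed.

(** [c w + d] and [c w' + d] are the eigenvalues of [gamma] on [(w, 1)] and [(w', 1)]. They are
    mutually inverse, their sum is the trace, which exceeds 2, and [c > 0] with [w' < w] makes the
    first the larger one. *)
Lemma axis_eps_gt1 : 1 < eps.
Proof.
have e' : c * w' + d = a + d - eps by rewrite /eps -[a](subrK d) -D; ring.
have lt : c * w' + d < c * w + d by rewrite ltrD2r ltr_pM2l.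
have tr : 2%:R < a + d by exact: axis_tr ax.
have := axis_epsV; rewrite -/eps e' in lt *; rewrite -/eps in lt *; nra.
Qed.

Lemma axis_epsVE : eps^-1 = c * w' + d.
Proof.
have e0 : eps != 0 by rewrite gt_eqF// (lt_trans ltr01 axis_eps_gt1).
by apply: (mulfI e0); rewrite divff// axis_epsV.
Qed.

Definition axis_length := 2%:R * ln eps.

Lemma axis_length_gt0 : 0 < axis_length.
Proof. by rewrite mulr_gt0// ln_gt0// axis_eps_gt1. Qed.

Lemma expR_axis_length : expR axis_length = eps ^+ 2.
Proof.
by rewrite expRM_natl lnK// posrE (lt_trans ltr01 axis_eps_gt1).
Qed.

(** Thus [c (w - w')] is the positive square root of the discriminant; the computation carries it in
    this form until the very end. *)
Lemma axis_discr : (discr gamma)%:~R = (c * (w - w')) ^+ 2 :> R.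
Proof.
rewrite /discr /mxtrace !big_ord_recl big_ord0 addr0.
have -> : lift ord0 (ord0 : 'I_1) = 1 :> 'I_2 by exact/val_inj.
rewrite rmorphB rmorphXn rmorphD /= -/a -/d.
have -> : (c * (w - w')) ^+ 2 = (c * (w + w')) ^+ 2 - 4%:R * c * (c * (w * w')) by ring.
have -> : (4%:R : int)%:~R = 4%:R * (a * d - b * c) :> R by rewrite detR mulr1.
by rewrite D M; ring.
Qed.

Lemma rownorm_axis z h :
  rownorm w z (gamma *m h) = expR (- axis_length) * rownorm w z h /\
  rownorm w' z (gamma *m h) = expR axis_length * rownorm w' z h.
Proof.
have e0 : eps != 0 by rewrite gt_eqF// (lt_trans ltr01 axis_eps_gt1).
rewrite expRN expR_axis_length -exprVn; split; apply: rownorm_mul; rewrite -/a -/b -/c -/d.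
- by rewrite axis_epsVE -[a](subrK d) -D; ring.
- by rewrite axis_epsVE -[b]opprK -M; ring.
- by rewrite /eps -[a](subrK d) -D; ring.
- by rewrite /eps -[b]opprK -M; ring.
Qed.

Lemma rownorm_axis_expz z h (n : int) :
  rownorm w z (gamma ^ n *m h) = expR (- (n%:~R * axis_length)) * rownorm w z h /\
  rownorm w' z (gamma ^ n *m h) = expR (n%:~R * axis_length) * rownorm w' z h.
Proof.
have pos (m : nat) k :
  rownorm w z (gamma ^+ m *m k) = expR (- (m%:R * axis_length)) * rownorm w z k /\
  rownorm w' z (gamma ^+ m *m k) = expR (m%:R * axis_length) * rownorm w' z k.
  elim: m => [|m [IH1 IH2]].
    by rewrite expr0 mul1mx mul0r oppr0 expR0 !mul1r.
  rewrite exprS -[_ * _]/(_ *m _) -mulmxA.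
  have [-> ->] := rownorm_axis z (gamma ^+ m *m k); rewrite IH1 IH2.
  by split; rewrite mulrA -expRD; congr (expR _ * _); rewrite -natr1; ring.
case: n => m; first exact: pos.
have u : gamma ^+ m.+1 \is a GRing.unit by rewrite unitrX// (SL2Z_unit (axisSL ax)).
rewrite NegzE -exprnN; have [p1 p2] := pos m.+1 ((gamma ^+ m.+1)^-1 *m h).
rewrite mulmxA (mulmxV u) mul1mx in p1 p2.
rewrite p1 p2.
by split; rewrite mulrA -expRD rmorphN /= (_ : _ + _ = 0) ?expR0 ?mul1r//; ring.
Qed.

Lemma stabilizer_fixform h : SL2Z h -> qcomp (fixform gamma) h = fixform gamma ->
  stabilizer w h.
Proof.
move=> slh qh; split=> //; have [/(congr1 (intr : int -> R)) E1 /(congr1 (intr : int -> R)) E2] :=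
  fixform_stabilizer slh qh.
have /SL2ZP/(congr1 (intr : int -> R)) det := slh.
rewrite !rmorphM !rmorphB /= !rmorphM /= in E1 E2 det.
set p : R := (h 0 0)%:~R in E1 E2 det *; set q : R := (h 0 1)%:~R in E1 E2 det *.
set k : R := (h 1 0)%:~R in E1 E2 det *; set l : R := (h 1 1)%:~R in E1 E2 det *.
rewrite -/a -/b -/c -/d in E1 E2.
have quad : k * w ^+ 2 + (l - p) * w - q = 0.
  apply: (mulfI (lt0r_neq0 c0)); rewrite mulr0.
  have -> : c * (k * w ^+ 2 + (l - p) * w - q) = k * c * w ^+ 2 - c * (p - l) * w - c * q by ring.
  rewrite E1 E2 -D -[b]opprK -M; ring.
(* If the denominator vanished at [w], the quadratic equation would make the numerator vanish too,
   and [h] would kill [(w, 1)], against determinant 1. *)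
have j0 : k * w + l != 0.
  apply/eqP => j0; have pw : p * w + q = 0.
    have -> : p * w + q = w * (k * w + l) - (k * w ^+ 2 + (l - p) * w - q) by ring.
    by rewrite j0 quad mulr0 subr0.
  have : p * l - q * k = 0.
    have -> : l = - (k * w) by apply/eqP; rewrite -subr_eq0 opprK addrC j0.
    have -> : q = - (p * w) by apply/eqP; rewrite -subr_eq0 opprK addrC pw.
    by ring.
  by rewrite det => /eqP; rewrite oner_eq0.
split => //; rewrite /mobius -/p -/q -/k -/l.
apply: (mulIf j0); rewrite divfK//; apply/eqP; rewrite -subr_eq0 -oppr_eq0; apply/eqP.
by rewrite -quad; ring.
Qed.

(** If [g] and [h] give the same form, [g h^-1] preserves [Q_gamma], hence fixes [w] and is
    [+- gamma^n] by primitivity. For uniqueness, [rownorm w 'i] ignores the sign and is multiplied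
    by [exp (- n L)], [L] being the axis length, so it determines [n]; the sign is determined
    because a matrix of determinant 1 differs from its opposite. *)
Lemma fixform_fiber (h : 'M[int]_2) : primitive gamma w -> SL2Z h ->
  set_bij [set: bool * int]
    [set g | SL2Z g /\ qcomp (fixform gamma) g = qcomp (fixform gamma) h]
    (fun p => (if p.1 then (gamma ^ p.2 *m h) else - (gamma ^ p.2 *m h)) : 'M[int]_2).
Proof.
move=> prim slh; have sl := axisSL ax.
have y0 : 0 < complex.Im ('i : R[i]) by rewrite /= ltr01.
split.
- move=> [e n] _ /=; have sn : SL2Z (gamma ^ n *m h) by apply: SL2Z_mul => //; exact: SL2Z_expz.
  case: e; rewrite ?qcompN -qcompA qcomp_fixform_expz//; split=> //.
  exact: SL2Z_opp.
- move=> [e n] [f m] _ _ /= E.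
  have nm : n = m.
    have /(congr1 (rownorm w 'i)) := E.
    have -> (x : bool) (k : 'M[int]_2) : rownorm w 'i (if x then k else - k) = rownorm w 'i k.
      by case: x; rewrite ?rownormN.
    have -> (x : bool) (k : 'M[int]_2) : rownorm w 'i (if x then k else - k) = rownorm w 'i k.
      by case: x; rewrite ?rownormN.
    rewrite (rownorm_axis_expz _ _ _).1 (rownorm_axis_expz _ _ _).1.
    move/(mulIf (lt0r_neq0 (rownorm_gt0 w slh y0)))/expR_inj/oppr_inj.
    by move/(mulIf (lt0r_neq0 axis_length_gt0))/intr_inj.
  move: E; rewrite nm; set k := _ *m _ => E.
  have slk : SL2Z k by apply: SL2Z_mul => //; exact: SL2Z_expz.
  have kN : k <> - k.
    move=> kk; have := SL2ZP k; rewrite /iff => -[/(_ slk) + _].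
    have z i j : k i j = 0.
      have : k i j = (- k) i j by rewrite -kk.
      have aux (q : int) : q = - q -> q = 0 by lia.
      by rewrite [(- k) i j]mxE => /aux.
    by rewrite !z.
  case: e f E => [] [] // E; congr (_, _); exfalso;
    first [exact: (kN E)|exact: (kN (esym E))].
- move=> g [slg qg].
  have sh : SL2Z (g *m (h^-1 : 'M[int]_2)) by apply: SL2Z_mul => //; exact: SL2Z_inv.
  have gh : g = g *m (h^-1 : 'M[int]_2) *m h.
    by rewrite -mulmxA (mulVmx (SL2Z_unit slh)) mulmx1.
  have : stabilizer w (g *m (h^-1 : 'M[int]_2)).
    apply: stabilizer_fixform => //; rewrite -qcompA qg qcompA (mulmxV (SL2Z_unit slh)).
    exact: qcomp1.
  rewrite prim => -[n [E|E]].
    by exists (true, n) => //=; rewrite -E -gh.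
  by exists (false, n) => //=; rewrite [RHS]gh E mulNmx.
Qed.

End Axis.

Lemma automorphy_gt0 (g : 'M[int]_2) (x y : R) : SL2Z g -> 0 < y ->
  0 < ((g 1 0)%:~R * x + (g 1 1)%:~R) ^+ 2 + ((g 1 0)%:~R * y) ^+ 2.
Proof.
move=> /SL2ZP/(congr1 (intr : int -> R)); rewrite rmorphB !rmorphM /= => det y0.
set c : R := (g 1 0)%:~R in det *; set d : R := (g 1 1)%:~R in det *.
have [c0|c0] := eqVneq c 0.
  have d0 : d != 0 by apply/eqP => d0; move/eqP: det; rewrite c0 d0 !mulr0 subrr eq_sym oner_eq0.
  by rewrite c0 !mul0r add0r expr0n addr0 exprn_even_gt0.
by rewrite ltr_wpDl ?sqr_ge0// exprn_even_gt0//= mulf_neq0// gt_eqF.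
Qed.

Lemma mobius_complexE (g : 'M[int]_2) (x y : R) : SL2Z g -> 0 < y ->
  let J := ((g 1 0)%:~R * x + (g 1 1)%:~R) ^+ 2 + ((g 1 0)%:~R * y) ^+ 2 in
  mobius g (x +i* y) =
   ((((g 0 0)%:~R * x + (g 0 1)%:~R) * ((g 1 0)%:~R * x + (g 1 1)%:~R)
     + (g 0 0)%:~R * (g 1 0)%:~R * y ^+ 2) / J) +i* (y / J).
Proof.
move=> slg y0; have := automorphy_gt0 x slg y0.
have /SL2ZP/(congr1 (intr : int -> R)) := slg; rewrite rmorphB !rmorphM /=.
set a : R := (g 0 0)%:~R; set b : R := (g 0 1)%:~R.
set c : R := (g 1 0)%:~R; set d : R := (g 1 1)%:~R => det.
set J := _ + (c * y) ^+ 2 => J0.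
rewrite /mobius -!(rmorph_int (real_complex R)) -/a -/b -/c -/d.
  have jE : c%:C * (x +i* y) + d%:C = (c * x + d) +i* (c * y) by simpc.
  have j0 : (c * x + d) +i* (c * y) != 0.
    apply/eqP => -[e1 e2]; move: J0; rewrite /J e1 e2 expr0n addr0 ltxx //.
  rewrite jE; apply: (mulIf j0); rewrite divfK//; simpc.
  congr (_ +i* _).
    have -> : y / J * (c * y) = y * (a * d - b * c) / J * (c * y) by rewrite det mulr1.
    have -> : a * x + b = (a * x + b) * J / J by rewrite mulfK// gt_eqF.
    by rewrite /J; field; exact: lt0r_neq0 J0.
  have -> : y / J * (c * x + d) = y * (a * d - b * c) / J * (c * x + d) by rewrite det mulr1.
  have -> : a * y = a * y * J / J by rewrite mulfK// gt_eqF.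
  by rewrite /J; field; exact: lt0r_neq0 J0.
Qed.

Lemma cosh_dhyp_rownorm (g : 'M[int]_2) w w' z (t : R) : SL2Z g ->
  0 < complex.Im z -> w' < w -> 0 < t < pi ->
  Defs.cosh (dhyp (mobius g z) (geodesic_point w w' t)) =
  (rownorm w z g * (1 + cos t) + rownorm w' z g * (1 - cos t)) /
  (2%:R * (w - w') * complex.Im z * sin t).
Proof.
move=> slg y0 ww' /andP[t0 tpi].
have /SL2ZP/(congr1 (intr : int -> R)) := slg.
rewrite rmorphB !rmorphM /=.
case: z y0 => x y /= y0.
have s0 : 0 < sin t by apply: sin_gt0_pi; rewrite t0.
have cs : cos t ^+ 2 + sin t ^+ 2 = 1 by rewrite cos2Dsin2.
set r := (w - w') / 2%:R; set m := (w + w') / 2%:R.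
have r0 : 0 < r by rewrite divr_gt0// subr_gt0.
set a : R := (g 0 0)%:~R; set b : R := (g 0 1)%:~R.
set c : R := (g 1 0)%:~R; set d : R := (g 1 1)%:~R => det.
pose J := (c * x + d) ^+ 2 + (c * y) ^+ 2.
have J0 : 0 < J := automorphy_gt0 x slg y0.
have mobE := mobius_complexE x slg y0; rewrite -/a -/b -/c -/d -/J in mobE.
have p0 : upper_half_plane (geodesic_point w w' t) by rewrite /upper_half_plane /= mulr_gt0.
have g0 : upper_half_plane (mobius g (x +i* y)) by rewrite mobE /upper_half_plane /= divr_gt0.
rewrite cosh_dhyp// mobE /geodesic_point -/r -/m /=.
rewrite sqr_sqrtr ?addr_ge0 ?sqr_ge0// /rownorm /= -/a -/b -/c -/d.
have -> : w = m + r by rewrite /m /r; field.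
have -> : w' = m - r by rewrite /m /r; field.
have sn0 := lt0r_neq0 s0; have rn0 := lt0r_neq0 r0; have yn0 := lt0r_neq0 y0.
have Jn0 := lt0r_neq0 J0.
set C := cos t in cs *; set S := sin t in cs sn0 s0 *.
clearbody m r a b c d.
(* [P / J] and [y / J] are the real and imaginary parts of [g z], where [J = |c z + d|^2] and
   [K = |a z + b|^2]; [PK] expresses [|g z|^2 = K / J]. Multiplying the squared distance by [J] then
   leaves a polynomial identity. *)
pose P := (a * x + b) * (c * x + d) + a * c * y ^+ 2.
pose K := (a * x + b) ^+ 2 + (a * y) ^+ 2.
have PK : P ^+ 2 + y ^+ 2 = J * K.
  have -> : y ^+ 2 = (y * (a * d - b * c)) ^+ 2 by rewrite det mulr1.
  by rewrite /P /J /K; ring.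
rewrite -/P; set t1 := m + r * C.
have NJ : ((P / J - t1) ^+ 2 + (y / J - r * S) ^+ 2) * J =
    K - 2%:R * t1 * P - 2%:R * (r * S) * y + (t1 ^+ 2 + (r * S) ^+ 2) * J.
  have -> : K = (P ^+ 2 + y ^+ 2) / J by rewrite PK mulrC mulKf.
  by field.
have t12 : t1 ^+ 2 + (r * S) ^+ 2 = m ^+ 2 + r ^+ 2 + 2%:R * m * r * C.
  have -> : t1 ^+ 2 + (r * S) ^+ 2 = m ^+ 2 + r ^+ 2 * (C ^+ 2 + S ^+ 2) + 2%:R * m * r * C.
    by rewrite /t1; ring.
  by rewrite cs mulr1.
set N := (P / J - t1) ^+ 2 + _ in NJ *.
have -> : 1 + N / (2%:R * (y / J) * (r * S)) = (2%:R * (r * S) * y + N * J) / (2%:R * (r * S) * y).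
  by field; rewrite sn0 rn0 yn0 Jn0.
have -> : m + r - (m - r) = 2%:R * r by ring.
rewrite NJ t12; apply/eqP; rewrite eqr_div; last 2 first.
- by rewrite !mulf_neq0 ?pnatr_eq0.
- by rewrite !mulf_neq0 ?pnatr_eq0.
by apply/eqP; rewrite /t1 /K /P /J; ring.
Qed.

End HyperbolicDynamics.

(** * Summability over SL_2(Z) *)

Section Summability.
Context {R : realType}.

Lemma esum_inj_le (T T' : choiceType) (D : set T) (D' : set T') (e : T -> T')
    (F : T -> \bar R) (G : T' -> \bar R) :
  set_inj D e -> (forall t, D t -> D' (e t)) ->
  (forall t, D' t -> (0 <= G t)%E) -> (forall t, D t -> (F t <= G (e t))%E) ->
  (\esum_(t in D) F t <= \esum_(t in D') G t)%E.
Proof.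
move=> inj sub G0 FG.
have G0' t : (e @` D) t -> (0 <= G t)%E by move=> [u Du <-]; exact/G0/sub.
apply: (@le_trans _ _ (\esum_(t in D) G (e t))%E); first exact: le_esum.
rewrite -(esum_image D e G inj).
have -> : e @` D = D' `&` e @` D.
  by apply/seteqP; split=> [t Dt|t []//]; split => //; case: Dt => u Du <-; exact: sub.
rewrite esum_mkcondr; apply: le_esum => t Dt.
by case: ifPn => // _; exact: G0.
Qed.

Lemma esum_prod_mul (T T' : choiceType) (F : T -> R) (G : T' -> R) :
  (forall t, 0 <= F t) -> (forall t, 0 <= G t) ->
  (\esum_(t in [set: T]) (F t)%:E < +oo)%E ->
  (\esum_(t in [set: T']) (G t)%:E < +oo)%E ->
  (\esum_(p in [set: T * T']) (F p.1 * G p.2)%:E < +oo)%E.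
Proof.
move=> F0 G0 Foo Goo.
have -> : [set: T * T'] = [set: T] `*`` (fun=> [set: T']) by apply/seteqP; split.
rewrite -(esum_esum (a := fun t t' => (F t * G t')%:E)); last first.
  by move=> i j _ _; rewrite lee_fin mulr_ge0.
have Gfin : \esum_(t in [set: T']) (G t)%:E \is a fin_num.
  by rewrite ge0_fin_numE// esum_ge0// => t _; rewrite lee_fin.
have zl (U : choiceType) (k : R) (H : U -> R) : 0 <= k -> (forall t, 0 <= H t) ->
    (\esum_(t in [set: U]) (k * H t)%:E <= k%:E * \esum_(t in [set: U]) (H t)%:E)%E.
  move=> k0 H0; apply: ge_ereal_sup => _ [X [fX _] <-].
  under eq_fsbigr do rewrite EFinM.
  rewrite -ge0_mule_fsumr; last by move=> t; rewrite lee_fin.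
  rewrite lee_wpmul2l ?lee_fin//; apply: ereal_sup_ubound; exists X => //.
apply: (@le_lt_trans _ _ (\esum_(t in [set: T]) ((fine (\esum_(t in [set: T']) (G t)%:E) * F t)%:E))%E).
  apply: le_esum => t _; apply: le_trans (zl _ _ _ _ _) _ => //.
  by rewrite EFinM fineK// muleC.
apply: le_lt_trans (zl _ _ _ _ _) _ => //.
  by rewrite fine_ge0// esum_ge0// => t _; rewrite lee_fin.
by rewrite lte_mul_pinfty// lee_fin fine_ge0// esum_ge0// => t _; rewrite lee_fin.
Qed.

(* Each term is dominated by an increment of the telescoping sequence - n^(-q) / q. *)
Lemma series_expR_ln_lty (p : R) : 1 < p ->
  (\esum_(n in [set: nat]) (expR (- (p * ln n.+1%:R)))%:E < +oo)%E.
Proof.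
move=> p1; have [q pq] : exists q, p = q + 1 by exists (p - 1); rewrite subrK.
have q0 : 0 < q by move: p1; rewrite pq ltrDr.
rewrite -nneseries_esumT; last by move=> n; rewrite lee_fin expR_ge0.
pose v (n : nat) : R := expR (- (q * ln n.+1%:R)).
have bound n : \sum_(0 <= k < n.+1) expR (- (p * ln k.+1%:R)) <= 1 + q^-1 - q^-1 * v n.
  elim: n => [|n IH].
    by rewrite big_nat1 /v ln1 !mulr0 oppr0 expR0 mulr1 addrK.
  rewrite big_nat_recr//= (le_trans (lerD IH (lexx _)))//.
  set x : R := n.+1%:R; set x1 : R := n.+2%:R.
  have x0 : 0 < x by rewrite ltr0n.
  have x10 : 0 < x1 by rewrite ltr0n.
  have -> : expR (- (p * ln x1)) = expR (- (q * ln x1)) / x1.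
    by rewrite -[x1 in _ / x1]lnK ?posrE// -expRN -expRD pq; congr expR; ring.
  suff : expR (- (q * ln x1)) / x1 * q <= v n - expR (- (q * ln x1)).
    have -> : v n.+1 = expR (- (q * ln x1)) by [].
    rewrite -ler_pdivlMr// mulrBl !(mulrC _ q^-1) => h.
    by rewrite -addrA lerD2l addrC lerBlDr addrC.
  have -> : v n = expR (- (q * ln x1)) * expR (q * (ln x1 - ln x)).
    by rewrite /v -/x -expRD; congr expR; ring.
  rewrite -mulrA -[X in _ - X]mulr1 -mulrBr ler_pM2l ?expR_gt0//.
  rewrite lerBrDl (le_trans _ (expR_ge1Dx _))// lerD2l mulrC ler_pM2l//.
  have := expR_ge1Dx (ln x - ln x1); rewrite expRD expRN !lnK ?posrE//.
  have -> : x / x1 = 1 - x1^-1.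
    have : x1 = x + 1 by rewrite /x1 /x -[in LHS]natr1.
    by move=> e; rewrite e in x10 *; field; rewrite gt_eqF.
  by move: (ln x) (ln x1) (x1^-1) => A B C; clear; lra.
apply: (@le_lt_trans _ _ (1 + q^-1)%:E); last exact: ltry.
apply: lime_le.
  by apply: is_cvg_nneseries => n _ _; rewrite lee_fin expR_ge0.
apply: nearW => n; rewrite sumEFin lee_fin.
case: n => [|n]; first by rewrite big_geq// addr_ge0// invr_ge0 ltW.
rewrite (le_trans (bound n))// gerBl mulr_ge0 ?expR_ge0// invr_ge0 ltW//.
Qed.

(** This is [(1 + n^2)^(-p)], of the size of [|n|^(-2 p)] but meaningful at 0. *)
Definition japanese (p : R) (n : int) : R := expR (- (p * ln (1 + n%:~R ^+ 2))).

Lemma esum_japanese_lty (p : R) : 1 < 2%:R * p ->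
  (\esum_(n in [set: int]) (japanese p n)%:E < +oo)%E.
Proof.
move=> p1; have p0 : 0 < p by lra.
have S := series_expR_ln_lty p1.
have le (n : nat) (m : int) : `|m%:~R| = n.+1%:R :> R ->
    japanese p m <= expR (- (2%:R * p * ln n.+1%:R)).
  move=> mE; rewrite /japanese ler_expR lerN2.
  have -> : 2%:R * p * ln n.+1%:R = p * ln (n.+1%:R ^+ 2).
    by rewrite lnXn ?ltr0n// -mulr_natl; ring.
  rewrite ler_pM2l// ler_ln ?posrE ?exprn_gt0 ?ltr0n//; last first.
    by rewrite ltr_pwDl ?sqr_ge0.
  by rewrite -[X in _ + X]real_normK ?num_real// mE lerDr.
rewrite esum_int; last by move=> n; rewrite lee_fin expR_ge0.
apply: lte_add_pinfty.
  rewrite -nneseries_esumT; last by move=> n; rewrite lee_fin expR_ge0.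
  rewrite nneseries_recl//.
  apply: lte_add_pinfty; first exact: ltry.
  rewrite -(nneseries_addn 1%N); last by move=> n; rewrite lee_fin expR_ge0.
  rewrite nneseries_esumT; last by move=> n; rewrite lee_fin expR_ge0.
  apply: le_lt_trans S; apply: le_esum => n _; rewrite lee_fin addn1; apply: le.
    by rewrite /= ger0_norm.
  by move=> k _; rewrite lee_fin expR_ge0.
apply: le_lt_trans S; apply: le_esum => n _; rewrite lee_fin; apply: le.
by rewrite NegzE rmorphN normrN /= ger0_norm.
Qed.

(** The square of the Frobenius norm: the exponent [p > 1] of [frob] below is [2 p > 2] for the
    norm. *)
Definition frob (g : 'M[int]_2) : R :=
  (g 0 0)%:~R ^+ 2 + (g 0 1)%:~R ^+ 2 + (g 1 0)%:~R ^+ 2 + (g 1 1)%:~R ^+ 2.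

(* With v = (c, d) the bottom row and m the inner product of the rows, |g|^2 = |v|^2 + (1 + m^2) / |v|^2,
   and g is determined by v and m; k is the quotient of m by |v|^2. *)
Definition row_code (g : 'M[int]_2) : int * int * int :=
  (g 1 0, g 1 1,
   divz (g 0 0 * g 1 0 + g 0 1 * g 1 1) (g 1 0 ^+ 2 + g 1 1 ^+ 2)).

Lemma bottom_row_gt0 (g : 'M[int]_2) : SL2Z g -> 0 < g 1 0 ^+ 2 + g 1 1 ^+ 2.
Proof.
move=> /SL2ZP h; rewrite lt_neqAle addr_ge0 ?sqr_ge0// andbT eq_sym.
rewrite paddr_eq0 ?sqr_ge0// !sqrf_eq0; apply/negP => /andP[/eqP c0 /eqP d0].
by move: h; rewrite c0 d0 !mulr0 subrr.
Qed.

(** Two matrices of determinant 1 with the same bottom row differ by adding [j] times that row to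
    the top row. This changes the inner product of the rows by [j (c^2 + d^2)], hence the quotient
    by exactly [j], so [j = 0]. *)
Lemma row_code_inj : set_inj SL2Z row_code.
Proof.
move=> g h /[!inE] slg slh [c12 d12 e12].
have v0 := bottom_row_gt0 slg; have /SL2ZP dg := slg; have /SL2ZP dh := slh.
rewrite -c12 -d12 in e12 dh; move: v0 dg dh e12.
set a := g 0 0; set b := g 0 1; set c := g 1 0; set d := g 1 1.
set a' := h 0 0; set b' := h 0 1 => v0 dg dh e12.
pose j := a * (b' - b) - b * (a' - a).
have lc (x y k1 k2 : int) : x - y = k1 * (a * d - b * c - 1) + k2 * (a' * d - b' * c - 1) -> x = y.
  by rewrite dg dh !subrr !mulr0 addr0 => /eqP; rewrite subr_eq0 => /eqP.
have ea : a' = a + j * c by apply: (lc _ _ (- a') a); rewrite /j; ring.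
have eb : b' = b + j * d by apply: (lc _ _ (- b') b); rewrite /j; ring.
have em : a' * c + b' * d = j * (c ^+ 2 + d ^+ 2) + (a * c + b * d) by rewrite ea eb; ring.
have j0 : j = 0.
  move: e12; rewrite em divzMDl ?gt_eqF// -[LHS]add0r => /addIr <- //.
have ha : a' = a by rewrite ea j0 mul0r addr0.
have hb : b' = b by rewrite eb j0 mul0r addr0.
apply/matrixP => x y.
have I2 (i : 'I_2) : i = 0 \/ i = 1.
  by case: i => [] [|[|//]] ?; [left|right]; exact/val_inj.
by case: (I2 x) => ->; case: (I2 y) => ->; first [exact: (esym ha)|exact: (esym hb)|exact: c12|exact: d12].
Qed.

(** A lower bound in which the coordinates of [row_code] separate. With [v = c^2 + d^2], Lagrange's
    identity [(a^2 + b^2) v = 1 + m^2] and the division [m = k v + r], [0 <= r < v], give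
    [v (1 + k^2) <= 3 frob g]; moreover [(1 + c^2) (1 + d^2) <= (2 v)^2], whence the constant 6. *)
Lemma frob_ge (g : 'M[int]_2) : SL2Z g ->
  (1 + (g 1 0)%:~R ^+ 2) * (1 + (g 1 1)%:~R ^+ 2) * (1 + (row_code g).2%:~R ^+ 2) ^+ 2
  <= (6%:R * frob g) ^+ 2 :> R.
Proof.
move=> slg; have v0 := bottom_row_gt0 slg; have /SL2ZP dg := slg.
rewrite /frob /row_code /=; move: v0 dg.
set a := g 0 0; set b := g 0 1; set c := g 1 0; set d := g 1 1 => v0 dg.
set v := c ^+ 2 + d ^+ 2 in v0 *; set m := a * c + b * d; set k := divz m v.
have mE := divz_eq m v; have r0 := modz_ge0 m (lt0r_neq0 v0); have rv := ltz_pmod m v0.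
rewrite -/k in mE; set r := modz m v in mE r0 rv.
have lagr : (a ^+ 2 + b ^+ 2) * v = 1 + m ^+ 2.
  have -> : 1 = (a * d - b * c) ^+ 2 by rewrite dg expr1n.
  by rewrite /v /m; ring.
have key : v * (1 + k ^+ 2) <= 3%:R * (a ^+ 2 + b ^+ 2 + v).
  rewrite -(ler_pM2r v0).
  have -> : 3%:R * (a ^+ 2 + b ^+ 2 + v) * v = 3%:R * ((a ^+ 2 + b ^+ 2) * v + v ^+ 2) by ring.
  rewrite lagr; have kv : (k * v) ^+ 2 = (m - r) ^+ 2 by rewrite {1}mE addrK.
  have -> : v * (1 + k ^+ 2) * v = v ^+ 2 + (k * v) ^+ 2 by ring.
  rewrite kv; have rv2 : r ^+ 2 <= v ^+ 2 by rewrite ler_pXn2r ?nnegrE// ltW.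
  have -> : (m - r) ^+ 2 = 2%:R * m ^+ 2 + 2%:R * r ^+ 2 - (m + r) ^+ 2 by ring.
  have s0 := sqr_ge0 (m + r); have m0 := sqr_ge0 m; have w0 := sqr_ge0 v.
  move: (m ^+ 2) (r ^+ 2) (v ^+ 2) ((m + r) ^+ 2) s0 m0 w0 rv2; clear; lia.
have key2 : (1 + c ^+ 2) * (1 + d ^+ 2) <= (2%:R * v) ^+ 2.
  have c2 := sqr_ge0 c; have d2 := sqr_ge0 d.
  move: v0; rewrite /v; move: (c ^+ 2) (d ^+ 2) c2 d2; clear => C E C0 E0 v0.
  have CE : 0 <= C * E by rewrite mulr_ge0.
  have t2 : (C + E) * 1 <= (C + E) * (C + E) by rewrite ler_pM2l// -gtz0_ge1.
  have C2 := sqr_ge0 C; have E2 := sqr_ge0 E.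
  have e1 : (2%:R * (C + E)) ^+ 2 = 4%:R * ((C + E) * (C + E)) by ring.
  have e2 : (1 + C) * (1 + E) = 1 + C + E + C * E by ring.
  have e3 : (C + E) * (C + E) = C ^+ 2 + E ^+ 2 + 2%:R * (C * E) by ring.
  rewrite e1 e2; rewrite e3 in t2 *; move: (C ^+ 2) (E ^+ 2) (C * E) C2 E2 CE t2; lia.
have main : (1 + c ^+ 2) * (1 + d ^+ 2) * (1 + k ^+ 2) ^+ 2 <=
    (6%:R * (a ^+ 2 + b ^+ 2 + c ^+ 2 + d ^+ 2)) ^+ 2.
  apply: (@le_trans _ _ ((2%:R * v) ^+ 2 * (1 + k ^+ 2) ^+ 2)).
    by rewrite ler_wpM2r// sqr_ge0.
  rewrite -exprMn ler_pXn2r ?nnegrE//.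
  - rewrite -addrA -/v; have -> : 6%:R * (a ^+ 2 + b ^+ 2 + v) = 2%:R * (3%:R * (a ^+ 2 + b ^+ 2 + v)) by ring.
    by rewrite -mulrA ler_pM2l.
  - by rewrite !mulr_ge0 ?(ltW v0)// addr_ge0 ?sqr_ge0.
  - by rewrite mulr_ge0// !addr_ge0 ?sqr_ge0.
move: main; rewrite -(ler_int R).
by rewrite !(rmorphXn, rmorphM, rmorphD) /=.
Qed.

Lemma frob_gt0 (g : 'M[int]_2) : SL2Z g -> 0 < frob g.
Proof.
move=> slg; have := bottom_row_gt0 slg; rewrite -(ltr_int R) rmorphD !rmorphXn /= /frob.
by move=> h; rewrite -addrA ltr_wpDl// addr_ge0 ?sqr_ge0.
Qed.

(** Raised to the power [- p / 2], [frob_ge] bounds each term by [6^p] times a product over the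
    coordinates of [row_code], with exponents [p/2], [p/2] and [p] of [1 + n^2]; the first two
    account for [p > 1]. The sum over [unit] merely carries the constant [6^p]. *)
Lemma esum_frob_lty (p : R) : 1 < p ->
  (\esum_(g in SL2Z) (expR (- (p * ln (frob g))))%:E < +oo)%E.
Proof.
move=> p1; have p0 : 0 < p by lra.
have h1 : (\esum_(n in [set: int]) (japanese (p / 2%:R) n)%:E < +oo)%E.
  by apply: esum_japanese_lty; lra.
have h2 : (\esum_(n in [set: int]) (japanese p n)%:E < +oo)%E.
  by apply: esum_japanese_lty; lra.
have j0 q n : 0 <= japanese q n by exact: expR_ge0.
have h12 := esum_prod_mul (j0 _) (j0 _) h1 h1.
have h3 := esum_prod_mul (F := fun t : int * int => japanese (p / 2%:R) t.1 * japanese (p / 2%:R) t.2)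
  (fun t => mulr_ge0 (j0 _ _) (j0 _ _)) (j0 p) h12 h2.
have l60 : 0 <= expR (p * ln 6%:R) :> R by exact: expR_ge0.
have e60 : (\esum_(u in [set: unit]) (expR (p * ln 6%:R) : R)%:E < +oo)%E.
  by rewrite (_ : [set: unit] = [set tt]) ?esum_set1 ?ltry//; apply/seteqP; split=> // -[].
have h4 := esum_prod_mul (F := fun t : int * int * int =>
  japanese (p / 2%:R) t.1.1 * japanese (p / 2%:R) t.1.2 * japanese p t.2)
  (fun t => mulr_ge0 (mulr_ge0 (j0 _ _) (j0 _ _)) (j0 _ _)) (fun=> l60) h3 e60.
apply: le_lt_trans h4.
apply: (@esum_inj_le _ _ _ _ (fun g => (row_code g, tt))) => //.
- by move=> g h sg sh /(congr1 fst) e; exact: row_code_inj.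
- by move=> t _; rewrite lee_fin !mulr_ge0.
move=> g slg; rewrite lee_fin /= /japanese -!expRD ler_expR.
have f0 := frob_gt0 slg.
have c0 (n : int) : 0 < 1 + n%:~R ^+ 2 :> R by rewrite ltr_pwDl ?sqr_ge0.
have := frob_ge slg.
rewrite -ler_ln ?posrE ?exprn_gt0 ?mulr_gt0// ?exprn_gt0//.
rewrite !lnM ?posrE ?mulr_gt0 ?exprn_gt0//.
rewrite [(row_code g).2]/(divz _ _).
set X := ln (1 + (g 1 0)%:~R ^+ 2); set Y := ln (1 + (g 1 1)%:~R ^+ 2); set Z := ln (1 + _ ^+ 2).
move=> /(ler_wpM2l (ltW p0)); lra.
Qed.

(** An equivalence of norms with explicit constants. [M1] compares [p^2 + q^2] with [|p z + q|^2],
    which is definite since [Im z > 0]; [M2] recovers the columns of [g] from their pairings with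
    [(1, -w)] and [(1, -w')], which are independent since [w' < w]. *)
Lemma frob_le_rownorm (w w' : R) (z : R[i]) : w' < w -> 0 < complex.Im z ->
  exists2 M : R, 0 < M &
    forall g : 'M[int]_2, frob g <= M * (rownorm w z g + rownorm w' z g).
Proof.
case: z => x y /= ww' y0.
pose M1 := 2%:R + (1 + 2%:R * x ^+ 2) / y ^+ 2.
pose M2 := 2%:R + 2%:R * (1 + 2%:R * w ^+ 2) / (w - w') ^+ 2.
have dw : 0 < w - w' by rewrite subr_gt0.
have M10 : 0 < M1.
  by rewrite /M1 ltr_wpDr// divr_ge0 ?sqr_ge0// addr_ge0// mulr_ge0 ?sqr_ge0.
have M20 : 0 < M2.
  by rewrite /M2 ltr_wpDr// divr_ge0 ?sqr_ge0// mulr_ge0// addr_ge0// mulr_ge0 ?sqr_ge0.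
have b1 (p q : R) : p ^+ 2 + q ^+ 2 <= M1 * ((p * x + q) ^+ 2 + (p * y) ^+ 2).
  have -> : M1 * ((p * x + q) ^+ 2 + (p * y) ^+ 2) = 2%:R * (p * x + q) ^+ 2 + 2%:R * (p * y) ^+ 2 +
     (1 + 2%:R * x ^+ 2) / y ^+ 2 * (p * x + q) ^+ 2 + (1 + 2%:R * x ^+ 2) * p ^+ 2.
    by rewrite /M1; field; rewrite gt_eqF.
  have t1 : 0 <= (1 + 2%:R * x ^+ 2) / y ^+ 2 * (p * x + q) ^+ 2.
    by rewrite mulr_ge0 ?sqr_ge0// divr_ge0 ?sqr_ge0// addr_ge0// mulr_ge0 ?sqr_ge0.
  have t2 := sqr_ge0 (p * y).
  have t3 : 0 <= (2%:R * (p * x) + q) ^+ 2 by exact: sqr_ge0.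
  have : q ^+ 2 + (2%:R * (p * x) + q) ^+ 2 = 2%:R * (p * x + q) ^+ 2 + 2%:R * x ^+ 2 * p ^+ 2 by ring.
  lra.
have b2 (a c : R) : a ^+ 2 + c ^+ 2 <= M2 * ((a - w * c) ^+ 2 + (a - w' * c) ^+ 2).
  set p := a - w * c; set p' := a - w' * c.
  have cE : c = (p' - p) / (w - w') by rewrite /p /p'; field; rewrite gt_eqF.
  have aE : a = p + w * c by rewrite /p; ring.
  have c2 : c ^+ 2 <= 2%:R / (w - w') ^+ 2 * (p ^+ 2 + p' ^+ 2).
    rewrite cE expr_div_n -mulrA (mulrC _^-1) mulrA ler_pM2r ?invr_gt0 ?exprn_gt0//.
    have := sqr_ge0 (p + p'); rewrite !expr2; lra.
  have a2 : a ^+ 2 <= 2%:R * p ^+ 2 + 2%:R * w ^+ 2 * c ^+ 2.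
    rewrite aE; have := sqr_ge0 (p - w * c); rewrite !expr2; lra.
  have w2 : 0 <= 1 + 2%:R * w ^+ 2 by rewrite addr_ge0// mulr_ge0 ?sqr_ge0.
  have := ler_wpM2l w2 c2.
  have -> : M2 * (p ^+ 2 + p' ^+ 2) = 2%:R * p ^+ 2 + 2%:R * p' ^+ 2 +
    (1 + 2%:R * w ^+ 2) * (2%:R / (w - w') ^+ 2 * (p ^+ 2 + p' ^+ 2)).
    by rewrite /M2; field; rewrite gt_eqF.
  have := sqr_ge0 p'; lra.
exists (M1 * M2) => [|g]; first exact: mulr_gt0.
rewrite /frob /rownorm /=.
have B1 := b1 ((g 0 0)%:~R - w * (g 1 0)%:~R) ((g 0 1)%:~R - w * (g 1 1)%:~R).
have B2 := b1 ((g 0 0)%:~R - w' * (g 1 0)%:~R) ((g 0 1)%:~R - w' * (g 1 1)%:~R).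
have := ler_wpM2l (ltW M20) (lerD B1 B2).
have := b2 (g 0 0)%:~R (g 1 0)%:~R; have := b2 (g 0 1)%:~R (g 1 1)%:~R.
move: B1 B2; lra.
Qed.

End Summability.

(** * Unfolding *)

Section Unfolding.
Context {R : realType}.
Notation mu := (@lebesgue_measure R).

Lemma integral_itv_shift (f : R -> R) (a b k : R) : a <= b -> continuous f ->
  (\int[mu]_(u in `[(a + k)%R, (b + k)%R]) (f u)%:E =
   \int[mu]_(u in `[a, b]) (f (u + k))%:E)%E.
Proof.
move=> ab cf; have dF (x : R) : is_derive x 1 (fun x => x + k) (1 : R).
  by apply: is_derive_eq; rewrite addr0.
have F'E : derive1 (fun x : R => x + k) = cst 1.
  by apply/funext => x; rewrite derive1E; apply: derive_val.
have cF : continuous (fun x : R => x + k).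
  by move=> x; apply/differentiable_continuous/derivable1_diffP; exact: ex_derive.
rewrite (@integration_by_substitution_increasing _ (fun x => x + k) f a b ab) ?F'E.
- by apply: eq_integral => x _; rewrite /= mulr1.
- by move=> x y _ _ xy; rewrite ltrD2r.
- by move=> x _; exact: cst_continuous.
- by apply/cvg_ex; exists 1; exact: cvg_cst.
- by apply/cvg_ex; exists 1; exact: cvg_cst.
- split=> [x _| |]; first exact: ex_derive.
  + by apply: cvg_at_right_filter; exact: cF.
  + by apply: cvg_at_left_filter; exact: cF.
- exact: continuous_subspaceT.
Qed.

Lemma esum_single (T : choiceType) (t0 : T) (F : T -> \bar R) :
  (0 <= F t0)%E -> (forall t, t != t0 -> F t = 0%E) ->
  \esum_(t in [set: T]) F t = F t0.
Proof.
move=> F0 Fz; have Fge t : (0 <= F t)%E by have [->//|/Fz ->] := eqVneq t t0.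
rewrite (esumID [set t0])//.
rewrite setTI esum_set1// setTI esum1 ?adde0// => t /eqP; exact: Fz.
Qed.

(** Closed intervals are replaced by half-open ones, which changes no integral. The half-open
    translates tile the line: [u] lies only in the one of index [floor ((u - a) / L)]. *)
Lemma esum_int_integral_itv (f : R -> R) (a L : R) : 0 < L -> continuous f ->
  (forall x, 0 <= f x) ->
  (\esum_(n in [set: int]) \int[mu]_(u in `[(a + n%:~R * L)%R, (a + L + n%:~R * L)%R]) (f u)%:E =
   \int[mu]_u (f u)%:E)%E.
Proof.
move=> L0 cf f0.
pose I (n : int) := `[a + n%:~R * L, a + L + n%:~R * L[%classic.
have mf : measurable_fun setT (EFin \o f).
  by apply/measurable_EFinP; exact: continuous_measurable_fun.
transitivity (\esum_(n in [set: int]) (\int[mu]_u ((EFin \o f) \_ (I n)) u))%E.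
  apply: eq_esum => n _; rewrite -integral_itv_bndo_bndc; last exact: measurable_funTS.
  by rewrite integral_mkcond.
rewrite -integral_esum//; first last.
- move=> n x _ _; apply: erestrict_ge0 => y _; exact: f0.
- move=> n _; apply/(measurable_restrictT (EFin \o f)); first exact: measurable_itv.
  exact: measurable_funTS.
apply: eq_integral => u _.
pose n0 := Num.floor ((u - a) / L).
have In n : (u \in I n) = (n == n0).
  apply/idP/eqP.
    rewrite inE /I /= in_itv/= => /andP[h1 h2]; apply/esym; apply: floor_def.
    rewrite ler_pdivlMr// ltr_pdivrMr// rmorphD /= mulrDl mul1r.
    by apply/andP; split; lra.
  move=> ->; rewrite inE /I /= in_itv/=.
  have := floor_itv ((u - a) / L); rewrite -/n0.
  by rewrite ler_pdivlMr// ltr_pdivrMr// rmorphD /= mulrDl mul1r => /andP[h1 h2]; apply/andP; split; lra.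
rewrite (@esum_single _ n0).
- by rewrite patchE In eqxx.
- by rewrite patchE In eqxx lee_fin.
- by move=> n nn0; rewrite patchE In (negbTE nn0).
Qed.

Lemma esum_bool_int (F : int -> \bar R) : (forall n, (0 <= F n)%E) ->
  \esum_(p in [set: bool * int]) F p.2 = (2%:E * \esum_(n in [set: int]) F n)%E.
Proof.
move=> F0.
have -> : [set: bool * int] = [set: bool] `*`` (fun=> [set: int]) by apply/seteqP; split.
rewrite -(esum_esum (a := fun (_ : bool) n => F n))//.
rewrite (esumID [set true])//; last by move=> t _; exact: esum_ge0.
rewrite setTI (_ : _ `&` _ = [set false]); last first.
  by apply/seteqP; split=> [[] // [_ /(_ erefl)]|[] //].
rewrite !esum_set1 ?esum_ge0//.
by rewrite -[2%:E]/(1 + 1)%:E EFinD ge0_muleDl// mul1e.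
Qed.

Lemma esum_fibers (gamma : 'M[int]_2) (w w' : R) (F : 'M[int]_2 -> \bar R)
    (G : qform -> \bar R) : axis gamma w w' -> primitive gamma w ->
  (forall g, (0 <= F g)%E) -> (forall g, F (- g) = F g) ->
  (forall h, SL2Z h -> (\esum_(n in [set: int]) F (gamma ^ n *m h) =
     G (qcomp (fixform gamma) h))%E) ->
  (\esum_(g in SL2Z) F g =
   \esum_(Q in [set Q | qequiv Q (fixform gamma)]) (2%:E * G Q))%E.
Proof.
move=> ax prim F0 FN FG.
have sl := axisSL ax.
pose J Q := [set g : 'M[int]_2 | SL2Z g /\ qcomp (fixform gamma) g = Q].
(* [qequiv Q Q_gamma] writes [Q_gamma] as a transform of [Q]; the unfolding uses [Q] as a transform
   of [Q_gamma], so group elements are inverted. *)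
have orb Q : qequiv Q (fixform gamma) <-> exists2 h, SL2Z h & qcomp (fixform gamma) h = Q.
  split=> -[h slh e].
    exists (h^-1 : 'M[int]_2); first exact: SL2Z_inv.
    by rewrite e qcompA (mulmxV (SL2Z_unit slh)) qcomp1.
  exists (h^-1 : 'M[int]_2); first exact: SL2Z_inv.
  by rewrite -e qcompA (mulmxV (SL2Z_unit slh)) qcomp1.
transitivity (\esum_(Q in [set Q | qequiv Q (fixform gamma)]) \esum_(g in J Q) F g)%E.
  rewrite esum_esum//.
  rewrite (reindex_esum SL2Z _ (fun g => (qcomp (fixform gamma) g, g)))//; split.
  - by move=> g slg /=; split=> //; apply/orb; exists g.
  - by move=> g h _ _ [].
  - by move=> [Q g] [_ /= [slg <-]]; exists g.
apply: eq_esum => Q /orb[h slh <-].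
rewrite (reindex_esum _ _ _ _ (fixform_fiber ax prim slh)) -FG//.
rewrite -esum_bool_int//; apply: eq_esum => -[[] n] _ //=; exact: FN.
Qed.

Section Axis.
Variables (gamma : 'M[int]_2) (w w' : R) (z : R[i]).
Hypotheses (ax : axis gamma w w') (y0 : 0 < complex.Im z).

Definition axis_cosh (g : 'M[int]_2) (u : R) : R :=
  (rownorm w z g * expR (- u) + rownorm w' z g * expR u) / (2%:R * (w - w') * complex.Im z).

(** For [Q = Q_gamma o g] this is the minimum of [axis_cosh g] over the axis, that is, the
    hyperbolic cosine of the distance from [g z] to the axis. *)
Definition axis_dist (Q : qform) : R :=
  Normc.normc (qeval Q z 1) / ((gamma 1 0)%:~R * (w - w') * complex.Im z).

Let ww' : 0 < w - w'. Proof. by rewrite subr_gt0; exact: axis_lt ax. Qed.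
Let den0 : 0 < 2%:R * (w - w') * complex.Im z. Proof. by rewrite !mulr_gt0. Qed.

Lemma axis_cosh_gt0 g u : SL2Z g -> 0 < axis_cosh g u.
Proof.
move=> slg; rewrite divr_gt0// addr_gt0// mulr_gt0 ?expR_gt0//; exact: rownorm_gt0.
Qed.

Lemma continuous_axis_cosh g : continuous (axis_cosh g).
Proof.
move=> u; apply: cvgM; last exact: cvg_cst.
apply: cvgD; (apply: cvgM; first exact: cvg_cst); last exact: continuous_expR.
apply: (cvg_comp (fun u : R => - u) expR); last exact: continuous_expR.
by apply: cvgN; exact: cvg_id.
Qed.

Lemma axis_coshN g u : axis_cosh (- g) u = axis_cosh g u.
Proof. by rewrite /axis_cosh !rownormN. Qed.

Lemma axis_cosh_expz g (n : int) u :
  axis_cosh (gamma ^ n *m g) u = axis_cosh g (u + n%:~R * axis_length gamma w).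
Proof.
rewrite /axis_cosh; have [-> ->] := rownorm_axis_expz ax z g n.
congr (_ / _); rewrite opprD !expRD; ring.
Qed.

Lemma normc_qcomp g : Normc.normc (qeval (qcomp (fixform gamma) g) z 1) ^+ 2 =
  (gamma 1 0)%:~R ^+ 2 * (rownorm w z g * rownorm w' z g).
Proof.
rewrite qcompE; case: z y0 => x y /= _.
set X := _ * (x +i* y) + _; set Y := _ * (x +i* y) + _.
have -> : qeval (fixform gamma) X Y = (gamma 1 0)%:~R%:C * (X - w%:C * Y) * (X - w'%:C * Y).
  rewrite /qeval /fixform /= -!(rmorph_int (real_complex R)) rmorphB rmorphN /=.
  have -> : (gamma 1 1)%:~R - (gamma 0 0)%:~R = - ((gamma 1 0)%:~R * (w + w')) :> R.
    by rewrite (axisD ax) opprB.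
  have -> : - (gamma 0 1)%:~R = (gamma 1 0)%:~R * (w * w') :> R by rewrite (axisM ax).
  by rewrite !(rmorphM, rmorphD, rmorphN) /=; ring.
rewrite !Normc.normcM normc_real !exprMn real_normK ?num_real// -mulrA.
have E (v : R) : Normc.normc (X - v%:C * Y) ^+ 2 = rownorm v (x +i* y) g.
  have -> : X - v%:C * Y = (((g 0 0)%:~R - v * (g 1 0)%:~R) * x + ((g 0 1)%:~R - v * (g 1 1)%:~R))
     +i* (((g 0 0)%:~R - v * (g 1 0)%:~R) * y).
    rewrite /X /Y !mulr1 -!(rmorph_int (real_complex R)).
    by simpc; congr (_ +i* _); ring.
  by rewrite /= sqr_sqrtr// addr_ge0 ?sqr_ge0.
by rewrite !E.
Qed.

Lemma axis_dist_gt0 g : SL2Z g -> 0 < axis_dist (qcomp (fixform gamma) g).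
Proof.
move=> slg; rewrite divr_gt0// ?mulr_gt0 ?(axis_c ax)//.
rewrite lt_neqAle (_ : 0 <= _) ?andbT; last by case: (qeval _ _ _) => ? ?; exact: sqrtr_ge0.
rewrite eq_sym -sqrf_eq0 normc_qcomp gt_eqF// !mulr_gt0 ?exprn_gt0 ?(axis_c ax)//; exact: rownorm_gt0.
Qed.

(* A exp(-u) + B exp u is 2 sqrt(A B) cosh after recentering at u = ln (A / B) / 2. *)
Lemma axis_cosh_center g : SL2Z g -> exists l, forall u,
  axis_cosh g (u + l) = axis_dist (qcomp (fixform gamma) g) * Defs.cosh u.
Proof.
move=> slg; have A0 := rownorm_gt0 w slg y0; have B0 := rownorm_gt0 w' slg y0.
set A := rownorm w z g in A0 *; set B := rownorm w' z g in B0 *.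
pose a := Num.sqrt A; pose b := Num.sqrt B.
have a0 : 0 < a by rewrite sqrtr_gt0.
have b0 : 0 < b by rewrite sqrtr_gt0.
have a2 : A = a ^+ 2 by rewrite sqr_sqrtr// ltW.
have b2 : B = b ^+ 2 by rewrite sqr_sqrtr// ltW.
have c0 := axis_c ax.
have nE : Normc.normc (qeval (qcomp (fixform gamma) g) z 1) = (gamma 1 0)%:~R * (a * b).
  apply/eqP; rewrite -(@eqrXn2 _ 2)//.
  - by rewrite normc_qcomp -/A -/B a2 b2; apply/eqP; ring.
  - by case: (qeval _ _ _) => ? ?; exact: sqrtr_ge0.
  - by rewrite !mulr_ge0// ltW.
exists (ln (a / b)) => u.
rewrite /axis_cosh -/A -/B /axis_dist nE /Defs.cosh opprD !expRD !expRN lnK ?posrE ?divr_gt0//.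
rewrite a2 b2; have e0 := expR_gt0 u.
by field; rewrite !gt_eqF.
Qed.

Lemma continuous_comp_axis_cosh (phi : R -> R) g : SL2Z g -> continuous phi ->
  continuous (fun u => phi (ln (axis_cosh g u))).
Proof.
move=> slg cphi u.
apply: (cvg_comp (fun u => ln (axis_cosh g u)) phi); last exact: cphi.
apply: (cvg_comp (axis_cosh g) (@ln R)); first exact: continuous_axis_cosh.
exact/continuous_ln/axis_cosh_gt0.
Qed.

Lemma integral_axis_cosh (phi : R -> R) g : SL2Z g -> continuous phi ->
  (\int[mu]_u (phi (ln (axis_cosh g u)))%:E =
   \int[mu]_u (phi (ln (axis_dist (qcomp (fixform gamma) g) * Defs.cosh u)))%:E)%E.
Proof.
move=> slg cphi; have [l lE] := axis_cosh_center slg.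
rewrite -(integral_shift l (G := fun u => phi (ln (axis_cosh g u)))).
  by apply: eq_integral => u _; rewrite lE.
exact: continuous_comp_axis_cosh.
Qed.

(** Test functions are written [phi (ln cosh)]: the real and imaginary parts of [cosh^(-s)] have
    this form with [phi] continuous on the whole line, and so do their positive and negative
    parts. *)
Lemma axis_unfolding (phi : R -> R) (a : R) : primitive gamma w ->
  continuous phi -> (forall x, 0 <= phi x) ->
  (\esum_(g in SL2Z)
      (\int[mu]_(u in `[a, (a + axis_length gamma w)%R]) (phi (ln (axis_cosh g u)))%:E) =
   \esum_(Q in [set Q | qequiv Q (fixform gamma)])
      (2%:E * \int[mu]_u (phi (ln (axis_dist Q * Defs.cosh u)))%:E))%E.
Proof.
move=> prim cphi phi0; have L0 := axis_length_gt0 ax.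
apply: (esum_fibers (G := fun Q => (\int[mu]_u (phi (ln (axis_dist Q * Defs.cosh u)))%:E)%E) ax prim).
- by move=> g; apply: integral_ge0 => u _; rewrite lee_fin.
- by move=> g; apply: eq_integral => u _; rewrite axis_coshN.
move=> h slh; rewrite -integral_axis_cosh//.
have ch := continuous_comp_axis_cosh slh cphi.
rewrite -(esum_int_integral_itv a L0 ch)//; apply: eq_esum => n _.
have aL : a <= a + axis_length gamma w by rewrite lerDl ltW.
rewrite (integral_itv_shift (n%:~R * axis_length gamma w) aL ch).
by apply: eq_integral => u _; rewrite axis_cosh_expz.
Qed.

End Axis.

End Unfolding.

(** * The angular parameter *)

Section AngularParameter.
Context {R : realType}.
Notation mu := (@lebesgue_measure R).

(* The arc-length coordinate ln (tan (t / 2)) of the point of angle t on the half-circle. *)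
Definition ln_tan_half (t : R) : R := ln (1 - cos t) - ln (sin t).

Lemma cos_lt1 (t : R) : 0 < t < pi -> -1 < cos t < 1.
Proof.
move=> tpi; have s0 : 0 < sin t by exact: sin_gt0_pi.
have := cos2Dsin2 t; have : 0 < sin t ^+ 2 by rewrite exprn_gt0.
by move=> h1 h2; rewrite -ltr_norml -(@ltr_pXn2r _ 2)// ?nnegrE// real_normK ?num_real// expr1n; lra.
Qed.

Lemma expR_ln_tan_half (t : R) : 0 < t < pi ->
  expR (ln_tan_half t) = (1 - cos t) / sin t.
Proof.
move=> tpi; have /andP[_ c1] := cos_lt1 tpi.
by rewrite expRB !lnK ?posrE ?subr_gt0 ?sin_gt0_pi.
Qed.

Lemma expRN_ln_tan_half (t : R) : 0 < t < pi ->
  expR (- ln_tan_half t) = (1 + cos t) / sin t.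
Proof.
move=> tpi; have /andP[_ c1] := cos_lt1 tpi; have s0 := sin_gt0_pi tpi.
have cn0 : 1 - cos t != 0 by rewrite gt_eqF// subr_gt0.
have sn0 : sin t != 0 by rewrite gt_eqF.
rewrite expRN expR_ln_tan_half// invf_div; apply/eqP; rewrite eqr_div//; apply/eqP.
by rewrite -expr2 sin2cos2; ring.
Qed.

(** [dt / sin t] is the hyperbolic length element of a half-circle in terms of its angle. *)
Lemma is_derive_ln_tan_half (t : R) : 0 < t < pi ->
  is_derive t 1 ln_tan_half (sin t)^-1.
Proof.
move=> tpi; have /andP[_ c1] := cos_lt1 tpi; have s0 := sin_gt0_pi tpi.
have d1 : is_derive t 1 (fun t : R => 1 - cos t) (sin t).
  by have := is_deriveB (is_derive_cst (1 : R) t 1) (is_derive_cos t); rewrite sub0r opprK.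
have l1 : is_derive (1 - cos t) 1 (@ln R) (1 - cos t)^-1.
  by apply: is_derive1_ln; rewrite subr_gt0.
have l2 := is_derive1_ln s0.
have e1 := @is_derive1_comp R (@ln R) (fun t => 1 - cos t) t _ _ l1 d1.
have e2 := @is_derive1_comp R (@ln R) (@sin R) t _ _ l2 (is_derive_sin t).
have := is_deriveB e1 e2.
have -> : (1 - cos t)^-1 * sin t - (sin t)^-1 * cos t = (sin t)^-1.
  have c0 : 1 - cos t != 0 by rewrite gt_eqF// subr_gt0.
  apply: (mulIf c0); apply: (mulIf (lt0r_neq0 s0)).
  have -> : ((1 - cos t)^-1 * sin t - (sin t)^-1 * cos t) * (1 - cos t) * sin t =
    sin t ^+ 2 - cos t * (1 - cos t) by field; rewrite c0 gt_eqF.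
  by rewrite mulrAC mulVf ?gt_eqF// mul1r sin2cos2; ring.
by [].
Qed.

Lemma ln_tan_half_lt (x y : R) : 0 < x -> x < y -> y < pi -> ln_tan_half x < ln_tan_half y.
Proof.
move=> x0 xy ypi.
have sub t : t \in `[x, y] -> 0 < t < pi.
  by rewrite in_itv/= => /andP[h1 h2]; rewrite (lt_le_trans x0)//= (le_lt_trans h2).
have [||c cxy E] := @MVT R ln_tan_half (fun t => (sin t)^-1) x y xy.
- move=> t txy; apply: is_derive_ln_tan_half; apply: sub.
  exact: subset_itv_oo_cc.
- apply: continuous_in_subspaceT => t /[!inE] txy.
  apply/differentiable_continuous/derivable1_diffP.
  have h := is_derive_ln_tan_half (sub t txy); exact: ex_derive.
rewrite -subr_gt0 E mulr_gt0 ?subr_gt0// invr_gt0 sin_gt0_pi//; apply: sub.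
exact: subset_itv_oo_cc.
Qed.

Lemma continuous_invsin (t : R) : 0 < t < pi -> {for t, continuous (fun t : R => (sin t)^-1)}.
Proof.
by move=> tpi; apply: cvgV; [rewrite gt_eqF// sin_gt0_pi|exact: continuous_sin].
Qed.

Lemma continuous_ln_tan_half (t : R) : 0 < t < pi -> {for t, continuous ln_tan_half}.
Proof.
move=> tpi; apply/differentiable_continuous/derivable1_diffP.
have h := is_derive_ln_tan_half tpi; exact: ex_derive.
Qed.

Lemma integral_ln_tan_half (f : R -> R) (t1 t0 : R) : 0 < t1 -> t1 < t0 -> t0 < pi ->
  continuous f ->
  (\int[mu]_(u in `[ln_tan_half t1, ln_tan_half t0]) (f u)%:E =
   \int[mu]_(t in `[t1, t0]) (f (ln_tan_half t) * (sin t)^-1)%:E)%E.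
Proof.
move=> t10 t01 t0pi cf.
have sub t : t \in `[t1, t0] -> 0 < t < pi.
  by rewrite in_itv/= => /andP[h1 h2]; rewrite (lt_le_trans t10)//= (le_lt_trans h2).
have F'E t : 0 < t < pi -> derive1 ln_tan_half t = (sin t)^-1.
  by move=> /is_derive_ln_tan_half h; rewrite derive1E; apply: derive_val.
have cF' t : 0 < t < pi -> {for t, continuous (derive1 ln_tan_half)}.
  move=> tpi; rewrite /prop_for /continuous_at F'E//.
  apply: cvg_trans (continuous_invsin tpi); apply: near_eq_cvg.
  have tI : t \in `]0, pi[ by rewrite in_itv.
  by apply: filterS (near_in_itvoo tI) => y; rewrite in_itv/= => ypi; rewrite F'E.
have I1 : 0 < t1 < pi by rewrite t10 (lt_trans t01).
have I0 : 0 < t0 < pi by rewrite t0pi (lt_trans t10).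
rewrite (@integration_by_substitution_increasing _ ln_tan_half f t1 t0 (ltW t01)).
- by apply: eq_integral => t /[!inE] /sub tpi; rewrite -F'E.
- move=> x y /sub/andP[x0 _] /sub/andP[_ ypi] xy; exact: ln_tan_half_lt.
- by move=> x /subset_itv_oo_cc/sub; exact: cF'.
- by apply/cvg_ex; eexists; apply: cvg_at_right_filter; exact: cF'.
- by apply/cvg_ex; eexists; apply: cvg_at_left_filter; exact: cF'.
- split=> [x /subset_itv_oo_cc/sub/is_derive_ln_tan_half h| |]; first exact: ex_derive.
  + by apply: cvg_at_right_filter; exact: continuous_ln_tan_half.
  + by apply: cvg_at_left_filter; exact: continuous_ln_tan_half.
- exact: continuous_subspaceT.
Qed.

End AngularParameter.

(** * Summability along the axis and unfolding for signed functions *)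

Section AxisSums.
Context {R : realType}.
Notation mu := (@lebesgue_measure R).
Variables (gamma : 'M[int]_2) (w w' : R) (z : R[i]).
Hypotheses (ax : axis gamma w w') (prim : primitive gamma w) (y0 : 0 < complex.Im z).
Variable (sigma : R).
Hypothesis (sigma1 : 1 < sigma).

Let L := axis_length gamma w.
Let L0 : 0 < L. Proof. exact: (axis_length_gt0 ax). Qed.
Let orbit := [set Q | qequiv Q (fixform gamma)].
Let chi := axis_cosh w w' z.
Let I (phi : R -> R) (Q : qform) :=
  (\int[mu]_u (phi (ln (axis_dist gamma w w' z Q * Defs.cosh u)))%:E)%E.

(** In exponential form, [cosh d(g z, tau_u)] is at least a constant times [exp (-|u|) frob g],
    uniformly in [g]. This turns decay of [phi] into summability over the group. *)
Lemma axis_cosh_lower_bound : exists k : R, forall g u, SL2Z g ->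
  k - `|u| + ln (frob g) <= ln (chi g u).
Proof.
have ww' := axis_lt ax.
have [M M0 MP] := frob_le_rownorm ww' y0.
have den0 : 0 < 2%:R * (w - w') * complex.Im z by rewrite !mulr_gt0// subr_gt0.
pose c := (M * (2%:R * (w - w') * complex.Im z))^-1.
have c0 : 0 < c by rewrite invr_gt0 mulr_gt0.
exists (ln c) => g u slg; have f0 : 0 < frob g :> R := frob_gt0 slg.
have A0 := rownorm_gt0 w slg y0; have B0 := rownorm_gt0 w' slg y0.
rewrite -[X in _ - X]expRK.
rewrite -ln_div ?posrE ?expR_gt0// -lnM ?posrE ?divr_gt0 ?expR_gt0//.
have ch0 : 0 < chi g u by exact: (axis_cosh_gt0 ax y0 u slg).
rewrite ler_ln ?posrE//; last by rewrite mulr_gt0// divr_gt0// expR_gt0.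
rewrite /chi /axis_cosh ler_pdivlMr//.
have -> : c / expR `|u| * frob g * (2%:R * (w - w') * complex.Im z) = expR (- `|u|) * (frob g / M).
  by rewrite /c expRN; field; rewrite !gt_eqF ?expR_gt0// subr_gt0.
apply: (@le_trans _ _ (expR (- `|u|) * (rownorm w z g + rownorm w' z g))).
  by rewrite ler_pM2l ?expR_gt0// ler_pdivrMr// mulrC.
rewrite mulrDr lerD// mulrC ler_pM2l// ler_expR.
  by rewrite lerN2 ler_norm.
by rewrite lerNl -normrN ler_norm.
Qed.

(** A summable majorant uniform in [|u| <= U], used pointwise as well as integrated over one
    period. *)
Lemma esum_axis_lty (phi : R -> R) (U : R) :
  (forall x, 0 <= phi x <= expR (- (sigma * x))) ->
  exists2 C : 'M[int]_2 -> R, (forall g u, SL2Z g -> `|u| <= U -> phi (ln (chi g u)) <= C g) &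
   (forall g, 0 <= C g) /\ (\esum_(g in SL2Z) (C g)%:E < +oo)%E.
Proof.
move=> phiP; have [k kP] := axis_cosh_lower_bound.
have s0 : 0 < sigma by rewrite (lt_trans ltr01).
exists (fun g => expR (sigma * (U - k)) * expR (- (sigma * ln (frob g)))) => [g u slg uU|].
  have /andP[_ h] := phiP (ln (chi g u)); rewrite (le_trans h)// -expRD ler_expR.
  have := kP g u slg; have : - `|u| >= - U by rewrite lerN2.
  move=> h1 h2; have : sigma * (k - U + ln (frob g)) <= sigma * ln (chi g u).
    by rewrite ler_pM2l//; lra.
  lra.
split=> [g|]; first by rewrite mulr_ge0 ?expR_ge0.
rewrite ge0_esumZl ?expR_ge0//.
by rewrite lte_mul_pinfty ?lee_fin ?expR_ge0// esum_frob_lty.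
Qed.

Section Nonneg.
Variable (phi : R -> R).
Hypotheses (cphi : continuous phi) (phiP : forall x, 0 <= phi x <= expR (- (sigma * x))).

Let phi0 x : 0 <= phi x. Proof. by have /andP[] := phiP x. Qed.

Lemma esum_axis_pointwise_lty u : (\esum_(g in SL2Z) (phi (ln (chi g u)))%:E < +oo)%E.
Proof.
have [C CP [C0 Coo]] := esum_axis_lty `|u| phiP.
by apply: le_lt_trans Coo; apply: le_esum => g slg; rewrite lee_fin CP.
Qed.

Lemma axis_integral_ge0 Q : (0 <= I phi Q)%E.
Proof. by apply: integral_ge0 => u _; rewrite lee_fin. Qed.

(** The unfolding is read backwards: over the period [[0, L]] the sum over the group has a summable
    majorant, and finiteness passes to the sum over forms. *)
Lemma esum_axis_integral_lty : (\esum_(Q in orbit) (2%:E * I phi Q) < +oo)%E.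
Proof.
rewrite -(axis_unfolding ax y0 0 prim cphi phi0) add0r -/L.
have [C CP [C0 Coo]] := esum_axis_lty L phiP.
apply: (@le_lt_trans _ _ (\esum_(g in SL2Z) (L * C g)%:E)%E); last first.
  rewrite (ge0_esumZl (ltW L0) (fun g _ => C0 g)).
  by rewrite lte_mul_pinfty// lee_fin ltW.
apply: le_esum => g slg.
have ch := continuous_comp_axis_cosh (w := w) (w' := w') ax y0 slg cphi.
apply: (@le_trans _ _ (\int[mu]_(u in `[0%R, L]) (C g)%:E)%E).
  apply: ge0_le_integral => //.
  - by move=> u _; rewrite lee_fin.
  - apply/measurable_EFinP; apply: measurable_funTS; exact: continuous_measurable_fun.
  move=> u /=; rewrite in_itv/= => /andP[u0 uL]; rewrite lee_fin; apply: CP => //.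
  by rewrite ger0_norm.
by rewrite integral_cst//= lebesgue_measure_itv/= lte_fin L0 oppr0 adde0 -EFinM mulrC.
Qed.

Lemma axis_integral_fin_num Q : orbit Q -> I phi Q \is a fin_num.
Proof.
move=> oQ; rewrite ge0_fin_numE ?axis_integral_ge0//.
have S : summable orbit (fun Q => (2%:E * I phi Q)%E).
  rewrite /summable; apply: le_lt_trans esum_axis_integral_lty; apply: le_esum => q _.
  by rewrite gee0_abs// mule_ge0// axis_integral_ge0.
have := summable_pinfty S oQ; rewrite gee0_abs ?mule_ge0 ?axis_integral_ge0//.
apply: le_lt_trans; rewrite -[leLHS]mul1e lee_wpmul2r ?axis_integral_ge0// lee_fin ler1n //.
Qed.

Lemma esum_fine_axis_integral_lty : (\esum_(Q in orbit) (fine (I phi Q))%:E < +oo)%E.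
Proof.
apply: le_lt_trans esum_axis_integral_lty; apply: le_esum => Q oQ; rewrite fineK ?axis_integral_fin_num//.
by rewrite -[leLHS]mul1e lee_wpmul2r ?axis_integral_ge0// lee_fin ler1n.
Qed.

Let P (t : R) := (\esum_(g in SL2Z) (phi (ln (chi g (ln_tan_half t))) * (sin t)^-1)%:E)%E.

Lemma integral_esum_angle (t1 t0 : R) : 0 < t1 -> t1 < t0 -> t0 < pi ->
  ln_tan_half t0 = ln_tan_half t1 + L ->
  measurable_fun `[t1, t0] P /\
  (\int[mu]_(t in `[t1, t0]) P t = (2%:R * fine (\esum_(Q in orbit) (fine (I phi Q))%:E))%:E)%E.
Proof.
move=> t10 t01 t0pi FL.
have sub t : `[t1, t0]%classic t -> 0 < t < pi.
  by rewrite /= in_itv/= => /andP[h1 h2]; rewrite (lt_le_trans t10)//= (le_lt_trans h2).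
have term0 g t : SL2Z g -> `[t1, t0]%classic t ->
    (0 <= (phi (ln (chi g (ln_tan_half t))) * (sin t)^-1)%:E)%E.
  by move=> _ /sub tpi; rewrite lee_fin mulr_ge0// invr_ge0 ltW// sin_gt0_pi.
have mterm g : SL2Z g ->
    measurable_fun `[t1, t0] (fun t => (phi (ln (chi g (ln_tan_half t))) * (sin t)^-1)%:E).
  move=> slg; apply/measurable_EFinP; apply: subspace_continuous_measurable_fun => //.
  apply: continuous_in_subspaceT => t /[!inE] /sub tpi.
  apply: cvgM; last exact: continuous_invsin.
  have ch := continuous_comp_axis_cosh (w := w) (w' := w') ax y0 slg cphi.
  apply: (cvg_comp ln_tan_half (fun u => phi (ln (chi g u)))); last exact: ch.
  exact: continuous_ln_tan_half.
split; first exact: measurable_esum.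
rewrite integral_esum//.
have E g : SL2Z g -> (\int[mu]_(t in `[t1, t0])
    (phi (ln (chi g (ln_tan_half t))) * (sin t)^-1)%:E =
    \int[mu]_(u in `[ln_tan_half t1, (ln_tan_half t1 + L)%R]) (phi (ln (chi g u)))%:E)%E.
  move=> slg; rewrite -FL.
  by rewrite (integral_ln_tan_half t10 t01 t0pi (continuous_comp_axis_cosh ax y0 slg cphi)).
rewrite (eq_esum E) (axis_unfolding ax y0 _ prim cphi phi0).
have -> : (\esum_(Q in orbit) (2%:E * I phi Q) = \esum_(Q in orbit) (2%:R * fine (I phi Q))%:E)%E.
  by apply: eq_esum => Q oQ; rewrite EFinM fineK ?axis_integral_fin_num.
rewrite ge0_esumZl//; last by move=> Q _; rewrite fine_ge0 ?axis_integral_ge0.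
rewrite EFinM fineK// esum_fin_num//; last exact: esum_fine_axis_integral_lty.
by move=> Q _; rewrite fine_ge0 ?axis_integral_ge0.
Qed.

Lemma fine_esum_angle t : 0 < t < pi ->
  fine (P t) = fine (\esum_(g in SL2Z) (phi (ln (chi g (ln_tan_half t))))%:E) * (sin t)^-1
  /\ P t \is a fin_num.
Proof.
move=> tpi; have s0 : 0 <= (sin t)^-1 by rewrite invr_ge0 ltW// sin_gt0_pi.
have f := esum_fin_num (fun g _ => phi0 (ln (chi g (ln_tan_half t)))) (esum_axis_pointwise_lty _).
have -> : P t = ((sin t)^-1%:E * \esum_(g in SL2Z) (phi (ln (chi g (ln_tan_half t))))%:E)%E.
  by rewrite -ge0_esumZl//; apply: eq_esum => g _; rewrite mulrC.
by rewrite fineM// mulrC; split => //; rewrite fin_numM.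
Qed.

End Nonneg.

(** The positive and negative parts of [phi] obey the same bound and unfold separately.
    Integrability and absolute convergence are returned as well, since moving complex constants out
    of the integral and of [csum] relies on them. *)
Lemma axis_unfolding_rsum (phi : R -> R) (t1 t0 : R) : continuous phi ->
  (forall x, `|phi x| <= expR (- (sigma * x))) ->
  0 < t1 -> t1 < t0 -> t0 < pi -> ln_tan_half t0 = ln_tan_half t1 + L ->
  [/\ mu.-integrable `[t1, t0]
    (EFin \o (fun t => rsum SL2Z (fun g => phi (ln (chi g (ln_tan_half t)))) * (sin t)^-1)),
  Rintegral mu `[t1, t0] (fun t => rsum SL2Z (fun g => phi (ln (chi g (ln_tan_half t)))) * (sin t)^-1)
  = 2%:R * rsum orbit (fun Q => fine (I phi Q)) &
  (\esum_(Q in orbit) `|fine (I phi Q)|%:E < +oo)%E].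
Proof.
move=> cphi phiP t10 t01 t0pi FL.
pose p x := Num.max (phi x) 0; pose n x := Num.max (- phi x) 0.
have cp : continuous p.
  by move=> x; apply: (@continuous_max _ _ phi (cst 0)); [exact: cphi|exact: cst_continuous].
have cn : continuous n.
  move=> x; apply: (@continuous_max _ _ (- phi) (cst 0)); last exact: cst_continuous.
  by apply: continuousN; exact: cphi.
have pP x : 0 <= p x <= expR (- (sigma * x)).
  rewrite /p le_max lexx orbT ge_max expR_ge0 andbT/=.
  by rewrite (le_trans _ (phiP x))// ler_norm.
have nP x : 0 <= n x <= expR (- (sigma * x)).
  rewrite /n le_max lexx orbT ge_max expR_ge0 andbT/=.
  by rewrite (le_trans _ (phiP x))// -normrN ler_norm.
have sub t : `[t1, t0]%classic t -> 0 < t < pi.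
  by rewrite /= in_itv/= => /andP[h1 h2]; rewrite (lt_le_trans t10)//= (le_lt_trans h2).
pose P (psi : R -> R) t :=
  (\esum_(g in SL2Z) (psi (ln (chi g (ln_tan_half t))) * (sin t)^-1)%:E)%E.
have [mp ip] := integral_esum_angle cp pP t10 t01 t0pi FL.
have [mn im] := integral_esum_angle cn nP t10 t01 t0pi FL.
have IQ Q : orbit Q -> fine (I phi Q) = fine (I p Q) - fine (I n Q).
  move=> oQ; rewrite -fineB ?axis_integral_fin_num//; congr fine.
  rewrite {1}/I integralE; congr (_ - _)%E; apply: eq_integral => u _.
    by rewrite funeposE /= EFin_max.
  by rewrite funenegE /= EFin_max.
have fI0 psi Q : (forall x, 0 <= psi x <= expR (- (sigma * x))) -> 0 <= fine (I psi Q).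
  by move=> psiP; rewrite fine_ge0// axis_integral_ge0.
have Sp := esum_fine_axis_integral_lty cp pP; have Sn := esum_fine_axis_integral_lty cn nP.
have -> : rsum orbit (fun Q => fine (I phi Q)) =
    fine (\esum_(Q in orbit) (fine (I p Q))%:E) - fine (\esum_(Q in orbit) (fine (I n Q))%:E).
  rewrite -(@rsumB R qform orbit (fun Q => fine (I p Q)) (fun Q => fine (I n Q))
    (fun Q _ => fI0 p Q pP) (fun Q _ => fI0 n Q nP) Sp Sn).
  by rewrite /rsum; congr (fine _ - fine _); apply: eq_esum => Q oQ;
    rewrite ?funeposE ?funenegE /= IQ.
have intP psi (c : R) : (forall x, 0 <= psi x <= expR (- (sigma * x))) ->
    measurable_fun `[t1, t0] (P psi) -> (\int[mu]_(t in `[t1, t0]) P psi t = c%:E)%E ->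
    mu.-integrable `[t1, t0] (EFin \o (fun t => fine (P psi t))) /\
    Rintegral mu `[t1, t0] (fun t => fine (P psi t)) = c.
  move=> psiP mP iP.
  have E t : `[t1, t0]%classic t -> (fine (P psi t))%:E = P psi t.
    by move=> /sub tpi; rewrite fineK//; have [] := fine_esum_angle psiP tpi.
  have P0 t : `[t1, t0]%classic t -> (0 <= P psi t)%E.
    move=> /sub tpi; apply: esum_ge0 => g _; rewrite lee_fin mulr_ge0//.
      by have /andP[] := psiP (ln (chi g (ln_tan_half t))).
    by rewrite invr_ge0 ltW// sin_gt0_pi.
  split.
    apply: (@eq_integrable _ _ _ mu _ _ (P psi)) => //.
      by move=> t /[!inE] /E /= ->.
    apply/integrableP; split => //.
    rewrite (@eq_integral _ _ _ mu _ (P psi)); last by move=> t /[!inE] h; rewrite gee0_abs ?P0.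
    by rewrite iP ltry.
  rewrite /Rintegral (@eq_integral _ _ _ mu _ (P psi)) ?iP//.
  by move=> t /[!inE] h; rewrite E.
have [ip1 ip2] := intP p _ pP mp ip; have [in1 in2] := intP n _ nP mn im.
have E t : `[t1, t0]%classic t -> fine (P p t) - fine (P n t) =
    rsum SL2Z (fun g => phi (ln (chi g (ln_tan_half t)))) * (sin t)^-1.
  move=> /sub tpi.
  by rewrite /P (fine_esum_angle pP tpi).1 (fine_esum_angle nP tpi).1 -mulrBl; congr (_ * _); rewrite rsum_posneg.
split.
- have := fun m => integrableB m ip1 in1.
  move=> /(_ (measurable_itv _)); apply: eq_integrable => // t /[!inE] /E h /=; by rewrite -h.
- rewrite mulrBr -ip2 -in2 -RintegralB//.
  by apply: eq_Rintegral => t /[!inE] /E.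
- apply: (@le_lt_trans _ _ (\esum_(Q in orbit) (fine (I p Q))%:E + \esum_(Q in orbit) (fine (I n Q))%:E)%E).
    rewrite -esumD; try by move=> Q _; rewrite lee_fin fI0.
    apply: le_esum => Q oQ; rewrite -EFinD lee_fin IQ// (le_trans (ler_normB _ _))//.
    by rewrite !ger0_norm ?fI0.
  exact: lte_add_pinfty.
Qed.

End AxisSums.

(** * The action of gamma on its axis in the angular parameter *)

Section Geodesic.
Context {R : realType}.
Notation mu := (@lebesgue_measure R).
Variables (gamma : 'M[int]_2) (w w' : R).
Hypothesis ax : axis gamma w w'.

Let c : R := (gamma 1 0)%:~R.
Let d : R := (gamma 1 1)%:~R.
Let m := (w + w') / 2%:R.
Let r := (w - w') / 2%:R.

Let ww' : w' < w. Proof. exact: axis_lt ax. Qed.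
Let r0 : 0 < r. Proof. by rewrite divr_gt0// subr_gt0. Qed.

Lemma acos_itv (x : R) : -1 < x < 1 -> 0 < acos x < pi /\ cos (acos x) = x.
Proof.
move=> /andP[x1 x2]; rewrite acos_gt0 ?acos_ltpi ?(ltW x1) ?(ltW x2) ?x1 ?x2//.
by split=> //; apply: acosK; rewrite in_itv/= !ltW.
Qed.

Lemma geodesic_angle_itv (tau : R[i]) : geodesic w w' tau ->
  0 < geodesic_angle w w' tau < pi.
Proof.
move=> gt; have [t0 _] := gt; have E := geodesic_angleK ww' gt.
have s0 : 0 < sin (geodesic_angle w w' tau).
  move: t0; rewrite -{1}E /upper_half_plane /= -/r => h.
  by rewrite -(pmulr_rgt0 _ r0).
have [x1|x1] := boolP (-1 <= (complex.Re tau - m) / r <= 1).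
  have := acos_ge0 x1; have := acos_lepi x1; rewrite -/(geodesic_angle w w' tau) -/m -/r.
  rewrite !le_eqVlt => /orP[/eqP h|h1] /orP[/eqP h'|h2].
  - by rewrite h sinpi ltxx in s0.
  - by rewrite h sinpi ltxx in s0.
  - by rewrite -h' sin0 ltxx in s0.
  - by rewrite h1 h2.
move: x1; rewrite -{1 2}E /geodesic_point /= -/m -/r => /negP[].
have -> : (m + r * cos (geodesic_angle w w' tau) - m) / r = cos (geodesic_angle w w' tau).
  by field; rewrite gt_eqF.
by rewrite cos_geN1 cos_le1.
Qed.

(** [gamma] moves the points of its axis towards [w], the end of angle 0, by its translation length
    in the coordinate [ln tan (t/2)]; hence the angle decreases. *)
Lemma mobius_angle (t0 : R) : 0 < t0 < pi ->
  let t1 := geodesic_angle w w' (mobius gamma (geodesic_point w w' t0)) in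
  [/\ 0 < t1, t1 < t0 & ln_tan_half t0 = ln_tan_half t1 + axis_length gamma w].
Proof.
move=> t0pi t1; have slg := axisSL ax.
have /andP[c1 c2] := cos_lt1 t0pi; have s0 := sin_gt0_pi t0pi.
set C := cos t0 in c1 c2; set S := sin t0 in s0.
have e1 := axis_eps_gt1 ax; have eV := axis_epsV ax.
rewrite -/c -/d in e1 eV; set e := c * w + d in e1 eV; set f := c * w' + d in eV.
have e0 : 0 < e by rewrite (lt_trans ltr01).
have f0 : 0 < f by rewrite -(pmulr_rgt0 _ e0) eV.
have f1 : f < 1 by rewrite -(ltr_pM2l e0) eV mulr1.
pose N := e ^+ 2 * (1 + C) + f ^+ 2 * (1 - C).
have C1 : 0 < 1 + C by lra.
have C2 : 0 < 1 - C by lra.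
have u0 : 0 < e ^+ 2 * (1 + C) by rewrite mulr_gt0// exprn_gt0.
have v0 : 0 < f ^+ 2 * (1 - C) by rewrite mulr_gt0// exprn_gt0.
have N0 : 0 < N by rewrite addr_gt0.
(* The new cosine: [tan^2 (t/2) = (1 - cos t) / (1 + cos t)] has to be multiplied by [f^2 / e^2],
   and solving for the cosine gives [x]. *)
pose x := (e ^+ 2 * (1 + C) - f ^+ 2 * (1 - C)) / N.
have x1 : -1 < x < 1.
  by rewrite /x ltr_pdivlMr// ltr_pdivrMr// /N; apply/andP; split; lra.
have Y0 : 0 < r * S by rewrite mulr_gt0.
have t1E : t1 = acos x.
  rewrite /t1 /geodesic_angle; congr acos; rewrite -/m -/r.
  rewrite /geodesic_point -/m -/r -/C -/S mobius_complexE// -/c -/d.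
  have := automorphy_gt0 (m + r * C) slg Y0; rewrite -/c -/d /=.
  set J := _ + (c * (r * S)) ^+ 2 => J0.
  set a : R := (gamma 0 0)%:~R; set b : R := (gamma 0 1)%:~R.
  have aE : a = c * (w + w') + d by rewrite (axisD ax) subrK.
  have bE : b = - (c * (w * w')) by rewrite (axisM ax) opprK.
  have S2 : S ^+ 2 = (1 - C) * (1 + C) by rewrite /S /C sin2cos2; ring.
  have wE : w = m + r by rewrite /m /r; field.
  have wE' : w' = m - r by rewrite /m /r; field.
  have JE : J = N / 2%:R.
    have -> : J = (c * (m + r * C) + d) ^+ 2 + c ^+ 2 * r ^+ 2 * S ^+ 2 by rewrite /J; ring.
    by rewrite S2 /N /e /f wE wE'; field.
  rewrite JE; apply: (mulIf (lt0r_neq0 N0)); rewrite divfK ?gt_eqF//.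
  have Nn0 := lt0r_neq0 N0; have rn0 := lt0r_neq0 r0.
  have -> (A : R) : (A / (N / 2%:R) - m) / r * N = (2%:R * A - m * N) / r.
    by field; rewrite Nn0 rn0.
  rewrite [(r * S) ^+ 2]exprMn S2.
  apply: (mulIf rn0); rewrite divfK//.
  have eV' : e * f = 1 := eV.
  have key : e * f * (4%:R * (r ^+ 2 * c)) = 4%:R * (r ^+ 2 * c) by rewrite eV' mul1r.
  rewrite /N aE bE; move: key; rewrite /e /f wE wE' => key.
  apply/eqP; rewrite -subr_eq0; apply/eqP.
  by ring.
have [t1pi cosE] := acos_itv x1; rewrite -t1E in t1pi cosE.
have FE (t : R) : 0 < t < pi -> expR (2%:R * ln_tan_half t) = (1 - cos t) / (1 + cos t).
  move=> tpi; have sn := sin_gt0_pi tpi; have /andP[h1 h2] := cos_lt1 tpi.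
  have p0 : 1 + cos t != 0 by rewrite gt_eqF//; lra.
  have -> : 2%:R * ln_tan_half t = ln_tan_half t - - ln_tan_half t by ring.
  rewrite expRB expR_ln_tan_half// expRN_ln_tan_half//.
  by field; rewrite p0 gt_eqF.
have FL : ln_tan_half t0 = ln_tan_half t1 + axis_length gamma w.
  apply: (@mulfI _ 2%:R) => //; apply: expR_inj; rewrite FE// mulrDr expRD FE// cosE.
  rewrite expRM_natl (expR_axis_length ax) -/c -/d -/e -/C.
  have -> : (1 - x) / (1 + x) = f ^+ 2 * (1 - C) / (e ^+ 2 * (1 + C)).
    rewrite /x /N; field.
    apply/and4P; split; [by rewrite gt_eqF|by rewrite gt_eqF|by rewrite gt_eqF|].
    by rewrite addrACA addrN addr0 gt_eqF// addr_gt0.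
  have ef : e ^+ 2 * f ^+ 2 = 1 by rewrite -exprMn eV expr1n.
  have -> : f ^+ 2 * (1 - C) / (e ^+ 2 * (1 + C)) * (e ^+ 2) ^+ 2 = e ^+ 2 * f ^+ 2 * ((1 - C) / (1 + C)).
    by field; rewrite !gt_eqF.
  by rewrite ef mul1r.
have /andP[t10 t1p] := t1pi; have /andP[t00 t0p] := t0pi.
split=> //; rewrite ltNge; apply/negP => t01.
have : ln_tan_half t0 <= ln_tan_half t1.
  move: t01; rewrite le_eqVlt => /predU1P[->//|t01].
  by apply: ltW; exact: ln_tan_half_lt.
by rewrite FL leNgt ltrDl (axis_length_gt0 ax).
Qed.

Lemma derive_geodesic_point (t : R) :
  derive1 (fun u => complex.Re (geodesic_point w w' u)) t = - (r * sin t) /\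
  derive1 (fun u => complex.Im (geodesic_point w w' u)) t = r * cos t.
Proof.
rewrite /geodesic_point /= -/m -/r.
have D1 : is_derive t 1 (fun u => m + r * cos u) (- (r * sin t)).
  by apply: is_derive_eq; rewrite /GRing.scale /=; ring.
have D2 : is_derive t 1 (fun u => r * sin u) (r * cos t).
  by apply: is_derive_eq; rewrite /GRing.scale /=; ring.
by split; rewrite derive1E derive_val.
Qed.

(** With [tau = m + r exp (i t)], [(tau - w) (tau - w') = r^2 (exp (2 i t) - 1)], which is
    [2 r sin t] times the tangent vector [i r exp (i t)]. Thus [d tau / Q_gamma] is real: the length
    element divided by the square root of the discriminant. *)
Lemma geodesic_differential (t : R) : 0 < t < pi ->
  (- (r * sin t) +i* (r * cos t)) / qeval (fixform gamma) (geodesic_point w w' t) 1 =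
  ((c * (w - w'))^-1 * (sin t)^-1)%:C.
Proof.
move=> tpi; have s0 := sin_gt0_pi tpi; have c0 : 0 < c := axis_c ax.
have qE : qeval (fixform gamma) (geodesic_point w w' t) 1 =
    (- (r * sin t) +i* (r * cos t)) * (c * (w - w') * sin t)%:C.
  rewrite /qeval /fixform /= -!(rmorph_int (real_complex R)) rmorphB rmorphN /=.
  have -> : (gamma 1 1)%:~R - (gamma 0 0)%:~R = - (c * (w + w')) :> R.
    by rewrite (axisD ax) opprB.
  have -> : - (gamma 0 1)%:~R = c * (w * w') :> R by rewrite (axisM ax).
  rewrite -/c /geodesic_point -/m -/r.
  have -> : w = m + r by rewrite /m /r; field.
  have -> : w' = m - r by rewrite /m /r; field.
  have S2 : sin t ^+ 2 = 1 - cos t ^+ 2 := sin2cos2 t.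
  rewrite expr2 mulr1 expr1n mulr1; simpc; congr (_ +i* _); last by ring.
  apply/eqP; rewrite -subr_eq0; apply/eqP.
  transitivity (c * r ^+ 2 * (sin t ^+ 2 - (1 - cos t ^+ 2))); first by ring.
  by rewrite S2 subrr mulr0.
have k0 : (c * (w - w') * sin t)%:C != 0 :> R[i].
  by rewrite (inj_eq (@complexI _)) !mulf_neq0 ?gt_eqF// subr_gt0.
have v0 : (- (r * sin t) +i* (r * cos t)) != 0.
  by apply/eqP => -[/eqP]; rewrite oppr_eq0 mulf_eq0 !gt_eqF.
rewrite qE invfM mulrA mulfV// mul1r -fmorphV; congr (_ %:C).
by rewrite !invfM.
Qed.

End Geodesic.

Lemma eq_rsum (R : realType) (T : choiceType) (D : set T) (f g : T -> R) :
  (forall t, D t -> f t = g t) -> rsum D f = rsum D g.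
Proof.
move=> fg; rewrite /rsum; congr (fine _ - fine _); apply: eq_esum => t Dt.
  by rewrite !funeposE /= fg.
by rewrite !funenegE /= fg.
Qed.

Lemma eq_csum (R : realType) (T : choiceType) (D : set T) (f g : T -> R[i]) :
  (forall t, D t -> f t = g t) -> csum D f = csum D g.
Proof. by move=> fg; congr (_ +i* _); apply: eq_rsum => t Dt; rewrite fg. Qed.

(** * The cycle integral *)

Section CycleIntegral.
Context {R : realType}.
Notation mu := (@lebesgue_measure R).
Variables (gamma : 'M[int]_2) (w w' : R) (z s : R[i]).
Hypotheses (ax : axis gamma w w') (prim : primitive gamma w) (y0 : 0 < complex.Im z).
Hypothesis (s1 : 1 < complex.Re s).

Let s0 : 0 < complex.Re s. Proof. exact: lt_trans s1. Qed.
Let orbit := [set Q | qequiv Q (fixform gamma)].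
Let k : R := (gamma 1 0)%:~R * (w - w').
Let k0 : 0 < k. Proof. by rewrite mulr_gt0 ?(axis_c ax)// subr_gt0; exact: axis_lt ax. Qed.
Let I0 : R[i] := cintegral setT (fun u => cpow (Defs.cosh u) (- s)).

Lemma cosh_dhyp_axis g t : SL2Z g -> 0 < t < pi ->
  Defs.cosh (dhyp (mobius g z) (geodesic_point w w' t)) = axis_cosh w w' z g (ln_tan_half t).
Proof.
move=> slg tpi; have ww' := axis_lt ax.
rewrite cosh_dhyp_rownorm// /axis_cosh expRN_ln_tan_half// expR_ln_tan_half//.
have sn := sin_gt0_pi tpi.
field; rewrite !gt_eqF//; lra.
Qed.

Let phi1 v := complex.Re (cexp (- s * v%:C)).
Let phi2 v := complex.Im (cexp (- s * v%:C)).

Let normc_phi v : Normc.normc (cexp (- s * v%:C)) = expR (- (complex.Re s * v)).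
Proof. by rewrite normc_cexp Re_mul_real; case: (s) => a b /=; rewrite mulNr. Qed.

Let phi1P v : `|phi1 v| <= expR (- (complex.Re s * v)).
Proof. by rewrite -normc_phi ler_Re_normc. Qed.

Let phi2P v : `|phi2 v| <= expR (- (complex.Re s * v)).
Proof. by rewrite -normc_phi ler_Im_normc. Qed.

Let cphi1 : continuous phi1. Proof. exact: (ccontinuous_cexp_lin (- s)).1. Qed.
Let cphi2 : continuous phi2. Proof. exact: (ccontinuous_cexp_lin (- s)).2. Qed.

Let I Q := cintegral setT (fun u => cpow (axis_dist gamma w w' z Q * Defs.cosh u) (- s)).

Lemma cintegral_axis_dist Q : 0 < axis_dist gamma w w' z Q ->
  I Q = cpow (axis_dist gamma w w' z Q) (- s) * I0.
Proof.
move=> c0; rewrite -cintegralZl//; last exact: cintegrable_cpow_cosh.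
by apply: eq_cintegral => u _; rewrite cpowM// cosh_gt0.
Qed.

Lemma Qker_axis t : 0 < t < pi -> Qker z (geodesic_point w w' t) s =
  rsum SL2Z (fun g => phi1 (ln (axis_cosh w w' z g (ln_tan_half t)))) +i*
  rsum SL2Z (fun g => phi2 (ln (axis_cosh w w' z g (ln_tan_half t)))).
Proof.
move=> tpi; rewrite /Qker /csum; congr (_ +i* _); apply: eq_rsum => g slg;
  by rewrite (cosh_dhyp_axis slg tpi).
Qed.

Lemma cycle_integral (t1 t0 : R) : 0 < t1 -> t1 < t0 -> t0 < pi ->
  ln_tan_half t0 = ln_tan_half t1 + axis_length gamma w ->
  [/\ cintegral `[t1, t0] (fun t => Qker z (geodesic_point w w' t) s /
        qeval (fixform gamma) (geodesic_point w w' t) 1 *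
        (derive1 (fun u => complex.Re (geodesic_point w w' u)) t +i*
         derive1 (fun u => complex.Im (geodesic_point w w' u)) t)) =
      (k^-1)%:C * (2%:R * csum orbit I),
      (\esum_(Q in orbit) `|complex.Re (I Q)|%:E < +oo)%E &
      (\esum_(Q in orbit) `|complex.Im (I Q)|%:E < +oo)%E].
Proof.
move=> t10 t01 t0pi FL.
have [i1 e1 h1] := axis_unfolding_rsum ax prim y0 s1 cphi1 phi1P t10 t01 t0pi FL.
have [i2 e2 h2] := axis_unfolding_rsum ax prim y0 s1 cphi2 phi2P t10 t01 t0pi FL.
split=> //.
pose F phi t := rsum SL2Z (fun g => phi (ln (axis_cosh w w' z g (ln_tan_half t)))) * (sin t)^-1.
transitivity (cintegral `[t1, t0] (fun t => (k^-1)%:C * (F phi1 t +i* F phi2 t))).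
  apply: eq_cintegral => t /=; rewrite in_itv/= => /andP[h3 h4].
  have tpi : 0 < t < pi by rewrite (lt_le_trans t10)//= (le_lt_trans h4).
  have [-> ->] := derive_geodesic_point w w' t.
  rewrite mulrAC -mulrA (geodesic_differential ax tpi) Qker_axis// -/k.
  by rewrite /F; simpc; congr (_ +i* _); ring.
rewrite cintegralZl//; congr (_ * _).
rewrite /cintegral /=; rewrite /F e1 e2 /csum.
rewrite -[X in _ = X * _](rmorph_nat (real_complex R)) cmulE /= !mul0r subr0 addr0.
by [].
Qed.

Lemma E0_orbit : (forall Q, orbit Q -> 0 < axis_dist gamma w w' z Q) ->
  E0 gamma z s = csum orbit (fun Q => cpow k (- s) * cpow (axis_dist gamma w w' z Q) (- s)).
Proof.
move=> pos; apply: eq_csum => Q oQ; have c0 := pos Q oQ.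
have -> : Normc.normc (qeval Q z 1) = k * axis_dist gamma w w' z Q * complex.Im z.
  rewrite /axis_dist -/k; field; rewrite !gt_eqF//.
rewrite (cpowM s (mulr_gt0 k0 c0) y0) (cpowM s k0 c0) !cpowNr; field.
by rewrite !cpow_neq0.
Qed.

End CycleIntegral.

Theorem theoremB9 (R : realType) (gamma : 'M[int]_2) (w w' : R)
    (s z tau0 : R[i]) :
  hyperbolic gamma ->
  fixes gamma w -> fixes gamma w' -> w' < w ->
  primitive gamma w ->
  0 < qsgn (fixform gamma) ->
  2%:R < \tr gamma ->
  1 < complex.Re s ->
  upper_half_plane z ->
  geodesic w w' tau0 ->
  E0 gamma z s =
  - (cGamma ((s + 1) / 2%:R)
     / (2%:R * cpow ((discr gamma)%:~R : R) ((s - 1) / 2%:R)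
        * (Num.sqrt (pi : R))%:C * cGamma (s / 2%:R)))
  * geodesic_integral w w' tau0 (mobius gamma tau0)
      (fun tau => Qker z tau s / qeval (fixform gamma) tau 1).
Proof.
move=> [slg _] fw fw' ww' prim sg tr s1 z0 gt0.
have ax := hyperbolic_axis slg fw fw' ww' sg tr.
have c0 := axis_c ax; have s0 : 0 < complex.Re s by exact: lt_trans s1.
set orbit := [set Q | qequiv Q (fixform gamma)].
have pos Q : orbit Q -> 0 < axis_dist gamma w w' z Q.
  move=> [g slg' E].
  have -> : Q = qcomp (fixform gamma) (g^-1 : 'M[int]_2).
    by rewrite E qcompA (mulmxV (SL2Z_unit slg')) qcomp1.
  by apply: axis_dist_gt0 => //; exact: SL2Z_inv.
pose k : R := (gamma 1 0)%:~R * (w - w').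
have k0 : 0 < k by rewrite mulr_gt0// subr_gt0.
have tpi := geodesic_angle_itv ax gt0; have tK := geodesic_angleK ww' gt0.
have := mobius_angle ax tpi; rewrite tK /=.
set t0 := geodesic_angle w w' tau0 in tpi *.
set t1 := geodesic_angle w w' _ => -[t10 t01 FL].
have t0pi : t0 < pi by case/andP: tpi.
have [cI h1 h2] := cycle_integral ax prim z0 s1 t10 t01 t0pi FL.
(* The endpoint [gamma tau0] has the smaller angle, so [ointegral] takes its reversed branch; the
   sign cancels the one in the statement. *)
rewrite /geodesic_integral /path_integral /ointegral -/t0 -/t1 leNgt t01 /= cI -/k.
rewrite (E0_orbit s ax z0 pos) -/k.
set I0 := cintegral setT (fun u => cpow (Defs.cosh u) (- s)).
have sp0 : (Num.sqrt (pi : R))%:C != 0 by rewrite (inj_eq (@complexI _)) gt_eqF// sqrtr_gt0 pi_gt0.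
have half (t : R[i]) : complex.Re (t / 2%:R) = complex.Re t / 2%:R.
  by rewrite -(rmorph_nat (real_complex R)) -fmorphV Re_mul_real.
have G2 : cGamma (s / 2%:R) != 0 by rewrite cGamma_neq0// half divr_gt0.
have GI := cintegral_cpow_cosh s0; rewrite -/I0 in GI.
(* Nonvanishing of [Gamma (s/2)] makes the right side of [GI] nonzero, hence also the integral [I0],
   by which each power of [axis_dist] is now divided to become an unfolded integral. *)
have I00 : I0 != 0.
  by apply/eqP => I00; move: GI; rewrite I00 mulr0 => /esym/eqP; rewrite mulf_eq0 (negbTE sp0) (negbTE G2).
set S := csum orbit _ in cI *.
rewrite (@eq_csum R qform _ _ (fun Q => (cpow k (- s) / I0) *
   cintegral setT (fun u => cpow (axis_dist gamma w w' z Q * Defs.cosh u) (- s)))); last first.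
  move=> Q oQ; rewrite (cintegral_axis_dist s1)//; last exact: pos.
  by rewrite -/I0 [RHS]mulrACA mulVf// mulr1.
rewrite csumZl// -/S.
rewrite (axis_discr ax) -/k.
have -> : cpow (k ^+ 2) ((s - 1) / 2%:R) = cpow k s / k%:C.
  rewrite expr2 cpowM// -cpowDr -(cpowr1 k0) -cpowNr -cpowDr.
  by congr cpow; field.
have kn0 : k%:C != 0 by rewrite (inj_eq (@complexI _)) gt_eqF.
have P0 : cpow k s != 0 := cpow_neq0 k s.
rewrite cpowNr; have -> : (k^-1)%:C = (k%:C)^-1 by rewrite -fmorphV.
have -> : cGamma ((s + 1) / 2%:R) = (Num.sqrt pi)%:C * cGamma (s / 2%:R) / I0.
  by rewrite -GI mulfK.
set A := (Num.sqrt pi)%:C in sp0 *; set B := cGamma _ in G2 *; set C := cpow k s in P0 *.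
set K := k%:C in kn0 *. clearbody A B C K.
field; rewrite sp0 G2 I00 P0 kn0 //.
Qed.
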